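(* Let $s\ge\frac12$, $\phi\in\mathcal S_s(\mathbf R^d)\setminus 0$, and let $f\in\mathcal S_{1/2}'(\mathbf R^d)$. Then the following conditions are equivalent: (1) $f\in\Gamma_s^\infty(\mathbf R^d)$; (2) there exists a constant $h>0$ such that $$|V_\phi f(x,\xi)|\lesssim e^{\varepsilon|x|^{1/s}-h|\xi|^{1/s}}$$ for every $\varepsilon>0$.
   Context: $g_1\lesssim g_2$ means $g_1\le Cg_2$ with a constant $C>0$ independent of the variables and of the multi-indices involved (but allowed to depend on $\varepsilon$, $h$). **Gelfand-Shilov spaces.** For $s>0$, $\mathcal S_s(\mathbf R^d)$ consists of all $f\in C^\infty(\mathbf R^d)$ with $|x^\beta\partial^\alpha f(x)|\lesssim h^{|\alpha+\beta|}(\alpha!\beta!)^s$ for some $h>0$, with the inductive limit topology over $h$; $\mathcal S_s'$ is its dual. **Symbol class.** $\Gamma_s^\infty(\mathbf R^d)$ consists of all $f\in C^\infty(\mathbf R^d)$ for which there is $\varepsilon>0$ such that for every $h>0$: $|\partial^\alpha f(x)|\lesssim\varepsilon^{|\alpha|}(\alpha!)^se^{h|x|^{1/s}}$ for all $\alpha\in \mathbf N^d$, $x\in \mathbf R^d$. **Short-time Fourier transform.** $V_\phi f(x,\xi)=(2\pi)^{-d/2}\int f(y)\overline{\phi(y-x)}e^{-i\langle y,\xi\rangle}\,dy$ when the integral makes sense. For $f\in\mathcal S_{1/2}'(\mathbf R^d)$ and $\phi\in\mathcal S_{1/2}(\mathbf R^d)$ it is $(2\pi)^{-d/2}(f,\phi(\cdot-x)e^{i\langle\cdot,\xi\rangle})$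 with $(\cdot,\cdot)$ the extension of the $L^2$ scalar product. In general, for $f\in\mathcal S_{1/2}'$ and $\phi\in\mathcal S_s$, $V_\phi f\in\mathcal S_{1/2}'(\mathbf R^{2d})$ is the partial Fourier transform with respect to $y$ (with normalization $(2\pi)^{-d/2}\int\cdot\,e^{-i\langle y,\xi\rangle}dy$) of the distribution $f(y)\overline{\phi(y-x)}$, and the estimate in (2) means that this distribution is a function satisfying the bound. *)

(* Defs.v *)
From HB Require Import structures.
From mathcomp Require Import all_boot all_order all_algebra.
From mathcomp Require Import all_classical all_reals all_analysis.
From mathcomp Require Import complex.

Set Implicit Arguments.
Unset Strict Implicit.
Unset Printing Implicit Defensive.

Import Order.TTheory GRing.Theory Num.Theory.
Import numFieldNormedType.Exports.

Local Open Scope classical_set_scope.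
Local Open Scope ring_scope.
Local Open Scope complex_scope.

Section LebesgueMeasure.
Context {R : realType}.
Local Notation mR := (measurableTypeR R).

Definition cons_pair n (p : n.-tuple mR * mR) : n.+1.-tuple mR :=
  [tuple of p.2 :: p.1].

Lemma measurable_cons_pair n : measurable_fun setT (@cons_pair n).
Proof. by apply: measurable_cons; [exact: measurable_snd|exact: measurable_fst]. Qed.

Definition lebesgue_step n (m : {measure set (n.-tuple mR) -> \bar R}) :
  {measure set (n.+1.-tuple mR) -> \bar R}.
Proof.
refine (pushforward (m \x @lebesgue_measure R)%E (@cons_pair n) : measure _ _).
exact: measurable_cons_pair.
Defined.

(* n-fold product of the Lebesgue measure on R; on R^0, the unit point mass. *)
Fixpoint lebesgue_tuple (n : nat) : {measure set (n.-tuple mR) -> \bar R} :=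
  match n with
  | 0 => dirac [tuple]
  | n'.+1 => lebesgue_step (lebesgue_tuple n')
  end.

End LebesgueMeasure.

Section Analysis.
Context {R : realType} {d : nat}.
Local Notation E := 'rV[R]_d.
Local Notation C := R[i].
Implicit Types (f g : E -> C) (x y : E).

Definition cabs (z : C) : R := ComplexField.Normc.normc z.

(* The library norm on 'rV[R]_d is the sup norm, so the Euclidean norm and
   inner product are spelled out. *)
Definition dot x y : R := \sum_(i < d) x 0 i * y 0 i.
Definition enorm x : R := Num.sqrt (dot x x).

Definition cis (t : R) : C := cos t +i* sin t.

Definition re_part f : E -> R := fun x => complex.Re (f x).
Definition im_part f : E -> R := fun x => complex.Im (f x).

Definition tuple_vec (t : d.-tuple (measurableTypeR R)) : E :=
  \row_(i < d) tnth t i.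

Definition integrableC f : Prop :=
  (lebesgue_tuple d).-integrable setT (fun t => (re_part f (tuple_vec t))%:E) /\
  (lebesgue_tuple d).-integrable setT (fun t => (im_part f (tuple_vec t))%:E).

Definition integralC f : C :=
  (\int[lebesgue_tuple d]_t re_part f (tuple_vec t))
  +i* (\int[lebesgue_tuple d]_t im_part f (tuple_vec t)).

Definition unit_vec (i : 'I_d) : E := delta_mx 0 i.

Definition partial (i : 'I_d) f : E -> C := fun x =>
  'D_(unit_vec i) (re_part f) x +i* 'D_(unit_vec i) (im_part f) x.

Definition smooth f : Prop := forall l : seq 'I_d,
  let g := foldr partial f l in
  [/\ continuous (re_part g), continuous (im_part g) &
      forall i x, derivable (re_part g) x (unit_vec i) /\
                  derivable (im_part g) x (unit_vec i)].

Definition multi_index := {ffun 'I_d -> nat}.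
Implicit Types a b : multi_index.

Definition mlen a : nat := (\sum_(i < d) a i)%N.
Definition mfact a : nat := (\prod_(i < d) (a i)`!)%N.
Definition monomial b x : R := \prod_(i < d) x 0 i ^+ b i.
Definition mpartial a f : E -> C :=
  foldr (fun i g => iter (a i) (partial i) g) f (enum 'I_d).

(* The closed ball of radius r of the Banach space of those f whose norm
   sup |x^b D^a f(x)| / (h^|a+b| (a! b!)^s) is finite. *)
Definition GS_ball (s h r : R) : set (E -> C) := [set f | smooth f /\
  forall a b x, cabs ((monomial b x)%:C * mpartial a f x) <=
    r * (h ^+ (mlen a + mlen b)%N * ((mfact a * mfact b)%N%:R `^ s))].

Definition GS (s : R) : set (E -> C) :=
  [set f | exists2 h, 0 < h & exists2 r, 0 < r & GS_ball s h r f].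

Definition abs_convex (V : set (E -> C)) : Prop :=
  forall f g (a b : C), V f -> V g -> cabs a + cabs b <= 1 ->
    V (fun x => a * f x + b * g x).

(* Neighbourhoods of 0 in GS s for the (locally convex) inductive limit
   topology: the supersets of absolutely convex sets whose trace on each step
   is a neighbourhood of 0 there. *)
Definition GS_nbhs0 (s : R) (U : set (E -> C)) : Prop :=
  exists V : set (E -> C), [/\ V `<=` U, V `<=` GS s, abs_convex V &
    forall h, 0 < h -> exists2 r, 0 < r & GS_ball s h r `<=` V].

(* Functionals are total on functions; only the values on GS s matter. *)
Definition functional := (E -> C) -> C.

Definition GS_dual (s : R) (u : functional) : Prop :=
  (forall f g (c : C), GS s f -> GS s g ->
     u (fun x => c * f x + g x) = c * u f + u g) /\
  (forall f, GS s f -> forall e : R, 0 < e ->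
     GS_nbhs0 s [set g | GS s g /\ cabs (u (fun x => f x + g x) - u f) < e]).

(* u, as an element of the dual of GS (1/2), is given by the function g through
   the bilinear pairing <g, psi> = \int g psi. *)
Definition is_function (u : functional) g : Prop :=
  forall psi, GS 2^-1 psi ->
    integrableC (fun x => g x * psi x) /\
    u psi = integralC (fun x => g x * psi x).

Definition Gamma (s : R) : set (E -> C) := [set f | smooth f /\
  exists2 e, 0 < e & forall h, 0 < h -> exists2 K, 0 < K &
    forall a x, cabs (mpartial a f x) <=
      K * (e ^+ mlen a * ((mfact a)%:R `^ s) * expR (h * enorm x `^ s^-1))].

End Analysis.

Arguments multi_index : clear implicits.
Arguments functional : clear implicits.
Arguments GS {R} d s.
Arguments GS_dual {R} d s.
Arguments Gamma {R} d s.

Section STFT.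
Context {R : realType} {d : nat}.
Local Notation E := 'rV[R]_d.
Local Notation E2 := 'rV[R]_(d + d).
Local Notation C := R[i].

(* The distribution f(y) conj(phi(y - x)) in the variables (x, y), that is
   f (x) conj phi pulled back by (x, y) |-> (y, y - x):
   <., Theta> = < f, y |-> \int conj(phi(y - x)) Theta(x, y) dx >. *)
Definition twist (f : functional R d) (phi : E -> C) : functional R (d + d) :=
  fun Theta => f (fun y =>
    integralC (fun x => conjc (phi (y - x)) * Theta (row_mx x y))).

Definition fourier_snd (Psi : E2 -> C) : E2 -> C := fun z =>
  ((2 * pi) `^ (- (d%:R / 2)))%:C *
  integralC (fun xi : E =>
    Psi (row_mx (lsubmx z) xi) * cis (- dot (rsubmx z) xi)).

(* Partial Fourier transform in the second variable, by transposition. *)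
Definition fourier_snd_dual (T : functional R (d + d)) : functional R (d + d) :=
  fun Psi => T (fourier_snd Psi).

Definition STFT (phi : E -> C) (f : functional R d) : functional R (d + d) :=
  fourier_snd_dual (twist f phi).

End STFT.

(* Main.v *)
Require Import Defs.
From HB Require Import structures.
From mathcomp Require Import all_boot all_order all_algebra.
From mathcomp Require Import all_classical all_reals all_analysis.
From mathcomp Require Import measurable_realfun complex ring lra.

Set Implicit Arguments.
Unset Strict Implicit.
Unset Printing Implicit Defensive.

Import Order.TTheory GRing.Theory Num.Theory.
Import numFieldNormedType.Exports.

Local Open Scope classical_set_scope.
Local Open Scope ring_scope.

(**
   Membership in a Gelfand-Shilov space is equivalent to the bounds
   [|W f| <= K H^N N!^s] for all words [W] of [N] letters, each a multiplication
   by a coordinate or a partial derivative. A family of functions that is stable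
   under letters up to sums of two terms satisfies such bounds automatically;
   this applies to partial Fourier transforms, to tensors
   [psi(y) chi(y - x)] and to the partial integral defining the twist.

   (1) => (2): [V_phi f(x, .)] is the Fourier transform of
   [f(y) conj(phi(y - x))]; integrating by parts [m] times in each coordinate
   bounds [|xi_j|^m |V_phi f|] by [C H^m m!^s e^(eps |x|^(1/s))], and optimizing
   in [m] gives the decay in [xi].

   (2) => (1): a narrow Gaussian [chi] has [\int chi conj(phi) <> 0]. Testing
   [V_phi f] against the partial Fourier transform of [psi(y) chi(y - x)] gives
   back a multiple of [<f, psi>], so [f] is represented by a multiple of
   [\int V_phi f(x, xi) chi(y - x) e^(i<y, xi>) dx dxi], and this integral can
   be differentiated under the integral sign. Constants are never computed: only
   the inversion formula up to a nonzero factor is used.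
*)

(** * Powers of factorials against stretched exponentials *)

(** An identity of distributions may only be tested on functions of order 1/2, whereas the window
    belongs to the larger class of order [s]; test functions of order 1/2 must therefore be formed
    out of a window that is only of order [s]. This works because, in forming them, no derivative
    has to fall on the window: after the substitution x -> y - x in the twist, y occurs in the given
    test function alone. The hypothesis [s >= 1/2] enters through 1/s <= 2: the Gaussian decay of
    test functions absorbs a growth exp(eps |x|^(1/s)) for small eps, and weights satisfy |x +
    y|^(1/s) <= 4 (|x|^(1/s) + |y|^(1/s)). All integrals are controlled by one weight, the product
    of the 1/(1 + x_i^2), which factors over blocks of variables; a bound by a multiple of it serves
    integrability, Fubini and domination of derivatives alike. Constants may be lost freely, but the
    order of quantifiers may not: the decay rate in xi, respectively the geometric constant of the
    derivatives, has to be fixed before eps. *)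

Section OneVariable.
Context {R : realType}.
Implicit Types (s h c t r A : R) (n m : nat).

Lemma fact_mul_le n m : (n`! * m`! <= (n + m)`!)%N.
Proof.
rewrite -(@bin_fact (n + m) n) ?leq_addr// addKn.
by rewrite leq_pmull// bin_gt0 leq_addr.
Qed.

(** The binomial coefficient is a single term in the expansion of (1 + 1)^(n+m). *)
Lemma fact_add_le n m : ((n + m)`! <= 2 ^ (n + m) * (n`! * m`!))%N.
Proof.
rewrite -(@bin_fact (n + m) n) ?leq_addr// addKn leq_mul2r; apply/orP; right.
have -> : (2 ^ (n + m) = \sum_(i < (n + m).+1) 'C(n + m, i))%N.
  by rewrite -[2%N]/(1 + 1)%N Pascal; apply: eq_bigr => i _; rewrite !exp1n !muln1.
have nlt : (n < (n + m).+1)%N by rewrite ltnS leq_addr.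
by rewrite (bigD1 (Ordinal nlt))//= leq_addr.
Qed.

Definition factp s n : R := (n`!)%:R `^ s.

Lemma factp_gt0 s n : 0 < factp s n.
Proof. by rewrite powR_gt0// ltr0n fact_gt0. Qed.

Lemma factp_ge0 s n : 0 <= factp s n.
Proof. exact/ltW/factp_gt0. Qed.

Lemma factp0 s : factp s 0 = 1.
Proof. by rewrite /factp fact0 powR1. Qed.

Lemma le_factp s (n m : nat) : 0 <= s -> (n <= m)%N -> factp s n <= factp s m.
Proof.
by move=> s0 nm; apply: ge0_ler_powR; rewrite ?nnegrE// ler_nat leq_fact.
Qed.

Lemma le_factp_exponent s s' n : s <= s' -> factp s n <= factp s' n.
Proof. by move=> ss'; rewrite ler_powR// ler1n fact_gt0. Qed.

Lemma factpM s n m : 0 <= s -> factp s n * factp s m <= factp s (n + m).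
Proof.
move=> s0; rewrite -powRM//; apply: ge0_ler_powR; rewrite ?nnegrE ?mulr_ge0//.
by rewrite -natrM ler_nat fact_mul_le.
Qed.

Lemma factpD s n m : 0 <= s ->
  factp s (n + m) <= (2 `^ s) ^+ (n + m) * (factp s n * factp s m).
Proof.
move=> s0; rewrite -powRM// -powR_mulrn ?powR_ge0// powRAC powR_mulrn// -powRM//.
apply: ge0_ler_powR; rewrite ?nnegrE ?mulr_ge0//.
by rewrite -!natrM -natrX -natrM ler_nat fact_add_le.
Qed.

(* A commutator [[d/dx, x]] trades two letters for the factor [n + 1]; this is
   affordable exactly when [s >= 1/2]. *)
Lemma factpSS s n : 2^-1 <= s -> n.+1%:R * factp s n <= factp s n.+2.
Proof.
move=> s2; have s0 : 0 <= s by lra.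
rewrite /factp !factS !natrM !powRM ?mulr_ge0//.
rewrite mulrA ler_wpM2r ?powR_ge0//.
rewrite [leLHS](_ : _ = n.+1%:R `^ 2^-1 * n.+1%:R `^ 2^-1); last first.
  by rewrite powR12_sqrt// -expr2 sqr_sqrtr.
rewrite ler_pM ?powR_ge0// ?ler_powR ?ler1n//.
rewrite (@le_trans _ _ (n.+1%:R `^ s))// ?ler_powR ?ler1n//.
by rewrite ge0_ler_powR ?nnegrE// ler_nat.
Qed.

Lemma expR_ge_term t n : 0 <= t -> t ^+ n / (n`!)%:R <= expR t.
Proof.
move=> t0; case: n => [|n].
  by rewrite expr0 fact0 divr1 -[leLHS]addr0 (le_trans _ (expR_ge1Dx t))// lerD2l.
by apply: le_trans (expR_ge1Dxn n t0); rewrite lerDr.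
Qed.

Lemma powRX (t s : R) n : 0 <= t -> (t `^ s) ^+ n = (t ^+ n) `^ s.
Proof. by move=> t0; rewrite -powR_mulrn ?powR_ge0// powRAC powR_mulrn. Qed.

(** With u = t^(1/s), the claim is the s-th power of (c u / s)^n / n! <= exp(c u / s), one term of
    the exponential series; this is where h = (s/c)^s comes from. *)
Lemma powX_le_expR s c : 0 < s -> 0 < c -> exists2 h, 0 < h &
  forall t n, 0 <= t -> t ^+ n <= h ^+ n * factp s n * expR (c * t `^ s^-1).
Proof.
move=> s0 c0; exists ((s / c) `^ s) => [|t n t0]; first by rewrite powR_gt0 ?divr_gt0.
have sn0 : s != 0 by rewrite gt_eqF.
have cn0 : c != 0 by rewrite gt_eqF.
set u := t `^ s^-1; have u0 : 0 <= u by exact: powR_ge0.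
have -> : t = u `^ s by rewrite -powRrM mulVf// powRr1.
pose y := c / s * u; have y0 : 0 <= y by rewrite mulr_ge0// divr_ge0 ?ltW.
have -> : u = s / c * y by rewrite /y; field; apply/andP.
have -> : c * (s / c * y) = y * s by field.
clearbody y.
have scn : 0 <= s / c by rewrite divr_ge0 ?ltW.
rewrite !powRX//; last exact: mulr_ge0.
rewrite exprMn powRM ?exprn_ge0// -mulrA.
rewrite ler_wpM2l ?powR_ge0// expRM -powRM ?expR_ge0//.
apply: ge0_ler_powR; rewrite ?nnegrE ?exprn_ge0 ?mulr_ge0 ?expR_ge0 ?(ltW s0)//.
by rewrite mulrC -ler_pdivrMr ?ltr0n ?fact_gt0// expR_ge_term.
Qed.

(** Converse of [powX_le_expR]. The power 1/s turns the hypothesis into A^(1/s) y^n / n! <= r^(1/s)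
    2^-n for y = t^(1/s) / (2 h^(1/s)). Summing over n gives A^(1/s) exp(y) <= 2 r^(1/s), and the
    power s of this is the conclusion. The 2 in y is there to make the right-hand side summable. *)
Lemma le_expR_of_powX s h : 0 < s -> 0 < h -> exists2 c, 0 < c &
  forall A r t, 0 <= A -> 0 <= r -> 0 <= t ->
  (forall n, A * t ^+ n <= r * h ^+ n * factp s n) ->
  A <= 2 `^ s * r * expR (- (c * t `^ s^-1)).
Proof.
move=> s0 h0; exists (s / (2 * h `^ s^-1)).
  by rewrite divr_gt0// mulr_gt0// powR_gt0.
move=> A r t A0 r0 t0 H.
have sn0 : s != 0 by rewrite gt_eqF.
set p := s^-1; have p0 : 0 <= p by rewrite invr_ge0 ltW.
have hp0 : 0 < h `^ p by rewrite powR_gt0.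
pose y := t `^ p / (2 * h `^ p).
have y0 : 0 <= y by rewrite divr_ge0 ?powR_ge0// mulr_ge0// ltW.
have -> : s / (2 * h `^ p) * t `^ p = y * s by rewrite /y; ring.
rewrite expRN -ler_pdivrMr ?invr_gt0 ?expR_gt0// invrK expRM.
have pow_s (z : R) : 0 <= z -> (z `^ p) `^ s = z.
  by move=> z0; rewrite -powRrM mulVf// powRr1.
rewrite -(pow_s A)// -(pow_s r)// -!powRM ?powR_ge0 ?expR_ge0//.
apply: ge0_ler_powR; rewrite ?nnegrE ?mulr_ge0 ?powR_ge0 ?expR_ge0 ?(ltW s0)//.
have Hn n : A `^ p * (y ^+ n / (n`!)%:R) <= r `^ p * 2^-1 ^+ n.
  have := ge0_ler_powR p0 _ _ (H n).
  rewrite !nnegrE !mulr_ge0 ?exprn_ge0 ?(ltW h0) ?factp_ge0// => /(_ isT isT).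
  rewrite !powRM ?mulr_ge0 ?exprn_ge0 ?(ltW h0) ?factp_ge0//.
  rewrite -!powRX ?(ltW h0)// /factp -powRrM mulfV// powRr1// => {}H.
  rewrite mulrA ler_pdivrMr ?ltr0n ?fact_gt0// /y !exprMn !exprVn exprMn mulrA.
  rewrite ler_pdivrMr ?mulr_gt0 ?exprn_gt0//.
  rewrite (le_trans H)// le_eqVlt; apply/orP; left; apply/eqP.
  by field; rewrite !expf_neq0// ?pnatr_eq0// gt_eqF.
have cv := @is_cvg_series_exp_coeff R y.
rewrite /expR mulrC.
(* The bound on partial sums passes to the limit after division by A^(1/s), hence the separate zero
   case. *)
have [A0'|Apos] := eqVneq (A `^ p) 0.
  by rewrite A0' mulr0 mulr_ge0 ?powR_ge0.
have Ap0 : 0 < A `^ p by rewrite lt_neqAle eq_sym Apos powR_ge0.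
rewrite -ler_pdivlMr//; apply: limr_le => //; near=> N.
rewrite ler_pdivlMr// mulrC /series/= mulr_sumr.
apply: (@le_trans _ _ (\sum_(0 <= k < N) r `^ p * 2^-1 ^+ k)).
  by apply: ler_sum => k _; exact: Hn.
rewrite -mulr_sumr mulrC ler_wpM2r ?powR_ge0//.
have := @geometric_seriesE R 1 2^-1.
rewrite lt_eqF ?invf_lt1 ?ltr1n// => /(_ isT)/(congr1 (fun f => f N)) /=.
rewrite /series/= mul1r => E.
rewrite (eq_bigr (fun k => 1 * 2^-1 ^+ k)); last by move=> k _; rewrite mul1r.
rewrite E ler_pdivrMr; last by lra.
have : 0 <= 2^-1 ^+ N :> R by rewrite exprn_ge0.
by lra.
Unshelve. all: by end_near. Qed.
End OneVariable.

(** * Complex-valued calculus on R^n *)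

Local Open Scope complex_scope.

Section ComplexModulus.
Context {R : realType}.
Implicit Types (z w : R[i]) (a b : R).

Lemma cabs_ge0 z : 0 <= cabs z.
Proof. by case: z => a b; exact: sqrtr_ge0. Qed.

Lemma cabsM z w : cabs (z * w) = cabs z * cabs w.
Proof. exact: ComplexField.Normc.normcM. Qed.

Lemma cabsD z w : cabs (z + w) <= cabs z + cabs w.
Proof. exact: le_normcD. Qed.

Lemma cabsN z : cabs (- z) = cabs z.
Proof. exact: normcN. Qed.

Lemma cabs0 : cabs (0 : R[i]) = 0.
Proof. exact: ComplexField.Normc.normc0. Qed.

Lemma cabs1 : cabs (1 : R[i]) = 1.
Proof. exact: ComplexField.Normc.normc1. Qed.

Lemma cabs_real a : cabs a%:C = `|a|.
Proof. by rewrite /cabs/= expr0n addr0 sqrtr_sqr. Qed.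

Lemma cabs_i : cabs ('i : R[i]) = 1.
Proof. by rewrite /cabs/= expr0n add0r expr1n sqrtr1. Qed.

Lemma cabs_conj z : cabs (conjc z) = cabs z.
Proof. by case: z => a b; rewrite /cabs/= sqrrN. Qed.

Lemma norm_Re_le z : `|complex.Re z| <= cabs z.
Proof.
case: z => a b; rewrite /cabs/= -sqrtr_sqr ler_sqrt ?lerDl ?sqr_ge0//.
by rewrite addr_ge0 ?sqr_ge0.
Qed.

Lemma norm_Im_le z : `|complex.Im z| <= cabs z.
Proof.
case: z => a b; rewrite /cabs/= -sqrtr_sqr ler_sqrt ?lerDr ?sqr_ge0//.
by rewrite addr_ge0 ?sqr_ge0.
Qed.

Lemma cabs_le z : cabs z <= `|complex.Re z| + `|complex.Im z|.
Proof.
case: z => a b; have -> : a +i* b = a%:C + 'i * b%:C.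
  by apply/eqP; rewrite eq_complex/=; apply/andP; split; apply/eqP; ring.
rewrite (le_trans (cabsD _ _))// cabsM cabs_i !cabs_real mul1r/=.
by rewrite !mul0r !mul1r ?mulr0 ?subr0 ?subrr ?addr0 ?add0r.
Qed.

Lemma cisD a b : cis (a + b) = cis a * cis b :> R[i].
Proof.
apply/eqP; rewrite eq_complex /= cosD sinD; apply/andP.
by split; apply/eqP; ring.
Qed.

Lemma cis0 : cis 0 = 1 :> R[i].
Proof. by rewrite /cis cos0 sin0. Qed.

Lemma cabs_cis a : cabs (cis a : R[i]) = 1.
Proof. by rewrite /cabs/= cos2Dsin2 sqrtr1. Qed.

Lemma Re_addc z w : complex.Re (z + w) = complex.Re z + complex.Re w.
Proof. by case: z w => [? ?] [? ?]. Qed.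
Lemma Im_addc z w : complex.Im (z + w) = complex.Im z + complex.Im w.
Proof. by case: z w => [? ?] [? ?]. Qed.
Lemma Re_mulc z w : complex.Re (z * w) =
  complex.Re z * complex.Re w - complex.Im z * complex.Im w.
Proof. by case: z w => [? ?] [? ?]. Qed.
Lemma Im_mulc z w : complex.Im (z * w) =
  complex.Re z * complex.Im w + complex.Im z * complex.Re w.
Proof. by case: z w => [? ?] [? ?]. Qed.

Lemma complex_eq z w : complex.Re z = complex.Re w ->
  complex.Im z = complex.Im w -> z = w.
Proof. by case: z w => [? ?] [? ?] /= -> ->. Qed.

End ComplexModulus.

(** * Directional and iterated partial derivatives of complex functions *)

Section Words.
Context {R : realType}.
Local Notation C := R[i].

Section OneSpace.
Context {n : nat}.
Local Notation E := 'rV[R]_n.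
Implicit Types (f g : E -> C) (x v : E) (l : seq 'I_n).

(** Arbitrary directions are allowed because affine substitutions produce directions such as - e_i
    or a sum of two unit vectors. *)
Definition isd f x v (df : C) : Prop :=
  is_derive x v (re_part f) (complex.Re df) /\
  is_derive x v (im_part f) (complex.Im df).

Definition cont f : Prop := continuous (re_part f) /\ continuous (im_part f).

(** The instance of [smooth] for the empty list; [smooth] asks it of every iterated partial
    derivative. *)
Definition pdiff f : Prop := [/\ continuous (re_part f), continuous (im_part f) &
  forall i x, derivable (re_part f) x (unit_vec i) /\
              derivable (im_part f) x (unit_vec i)].

Definition dl l f : E -> C := foldr partial f l.

Lemma isd_cst (c : C) x v : isd (fun=> c) x v 0.
Proof. by split; exact: is_derive_cst. Qed.

Lemma isdD f g x v df dg : isd f x v df -> isd g x v dg ->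
  isd (fun x => f x + g x) x v (df + dg).
Proof.
move=> [f1 f2] [g1 g2]; split.
- rewrite (_ : re_part _ = re_part f + re_part g).
    by rewrite Re_addc; exact: is_deriveD.
  by apply/funext => y; rewrite /re_part Re_addc.
- rewrite (_ : im_part _ = im_part f + im_part g).
    by rewrite Im_addc; exact: is_deriveD.
  by apply/funext => y; rewrite /im_part Im_addc.
Qed.

Lemma isdM f g x v df dg : isd f x v df -> isd g x v dg ->
  isd (fun x => f x * g x) x v (df * g x + f x * dg).
Proof.
move=> [f1 f2] [g1 g2]; split.
- rewrite (_ : re_part _ =
     re_part f * re_part g - im_part f * im_part g); last first.
    by apply/funext => y; rewrite /re_part Re_mulc.
  have H1 := is_deriveM f1 g1; have H2 := is_deriveM f2 g2.
  apply: (is_derive_eq (is_deriveB H1 H2)).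
  by rewrite Re_addc !Re_mulc /re_part /im_part -![_ *: _]/(_ * _); ring.
- rewrite (_ : im_part _ =
     re_part f * im_part g + im_part f * re_part g); last first.
    by apply/funext => y; rewrite /im_part Im_mulc.
  have H1 := is_deriveM f1 g2; have H2 := is_deriveM f2 g1.
  apply: (is_derive_eq (is_deriveD H1 H2)).
  by rewrite Im_addc !Im_mulc /re_part /im_part -![_ *: _]/(_ * _); ring.
Qed.

Lemma isdZ (c : C) f x v df : isd f x v df -> isd (fun x => c * f x) x v (c * df).
Proof. by move=> H; have := isdM (isd_cst c x v) H; rewrite mul0r add0r. Qed.

Lemma isd_conj f x v df : isd f x v df -> isd (fun x => conjc (f x)) x v (conjc df).
Proof.
move=> [f1 f2]; split.
- rewrite (_ : re_part _ = re_part f); first by case: df f1 f2.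
  by apply/funext => y; rewrite /re_part; case: (f y).
- rewrite (_ : im_part _ = - im_part f); last first.
    by apply/funext => y; rewrite /im_part fctE; case: (f y).
  by case: df f1 f2 => a b f1 f2 /=; exact: is_deriveN.
Qed.

Lemma isd_eq f x v df df' : isd f x v df -> df = df' -> isd f x v df'.
Proof. by move=> ? <-. Qed.

Lemma isd_partial f x i df : isd f x (unit_vec i) df -> partial i f x = df.
Proof.
move=> [f1 f2]; rewrite /partial.
by case: df f1 f2 => a b /= f1 f2; rewrite !derive_val.
Qed.

Lemma pdiff_isd f i x : pdiff f -> isd f x (unit_vec i) (partial i f x).
Proof. by case=> _ _ /(_ i x)[d1 d2]; split; exact: derivableP. Qed.

Lemma pdiff_cont f : pdiff f -> cont f.
Proof. by case. Qed.

(** Turns pointwise formulas into equalities of functions, the form in which iterated derivatives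
    can be rewritten. *)
Lemma pdiff_of_isd f (df : 'I_n -> E -> C) : cont f ->
  (forall i x, isd f x (unit_vec i) (df i x)) ->
  pdiff f /\ forall i, partial i f = df i.
Proof.
move=> [c1 c2] H; split.
  by split=> // i x; have [d1 d2] := H i x; split; exact: ex_derive.
by move=> i; apply/funext => x; exact: isd_partial.
Qed.

Lemma contD f g : cont f -> cont g -> cont (fun x => f x + g x).
Proof.
move=> [f1 f2] [g1 g2]; split => x.
- rewrite (_ : re_part _ = re_part f + re_part g); first exact: (cvgD (f1 x) (g1 x)).
  by apply/funext => y; rewrite /re_part Re_addc.
- rewrite (_ : im_part _ = im_part f + im_part g); first exact: (cvgD (f2 x) (g2 x)).
  by apply/funext => y; rewrite /im_part Im_addc.
Qed.

Lemma contM f g : cont f -> cont g -> cont (fun x => f x * g x).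
Proof.
move=> [f1 f2] [g1 g2]; split => x.
- rewrite (_ : re_part _ = re_part f * re_part g - im_part f * im_part g).
    exact: (cvgB (cvgM (f1 x) (g1 x)) (cvgM (f2 x) (g2 x))).
  by apply/funext => y; rewrite /re_part Re_mulc.
- rewrite (_ : im_part _ = re_part f * im_part g + im_part f * re_part g).
    exact: (cvgD (cvgM (f1 x) (g2 x)) (cvgM (f2 x) (g1 x))).
  by apply/funext => y; rewrite /im_part Im_mulc.
Qed.

Lemma cont_cst (c : C) : cont (fun=> c).
Proof. by split => x; exact: cst_continuous. Qed.

Lemma cont_conj f : cont f -> cont (fun x => conjc (f x)).
Proof.
move=> [f1 f2]; split => x.
- rewrite (_ : re_part _ = re_part f); first exact: f1.
  by apply/funext => y; rewrite /re_part; case: (f y).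
- rewrite (_ : im_part _ = - im_part f); first exact: (cvgN (f2 x)).
  by apply/funext => y; rewrite /im_part fctE; case: (f y).
Qed.

Lemma cont_real (h : E -> R) : continuous h -> cont (fun x => (h x)%:C).
Proof. by move=> ch; split => // x; exact: cst_continuous. Qed.

Lemma cont_cis (h : E -> R) : continuous h -> cont (fun x => cis (h x)).
Proof.
move=> ch; split => x.
- by apply: (@continuous_comp _ _ _ h cos); [exact: ch|exact: continuous_cos].
- by apply: (@continuous_comp _ _ _ h sin); [exact: ch|exact: continuous_sin].
Qed.

Lemma isd_real (h : E -> R) x v (dh : R) : is_derive x v h dh ->
  isd (fun x => (h x)%:C) x v dh%:C.
Proof. by move=> H; split => //; exact: is_derive_cst. Qed.

Lemma pdiffD f g : pdiff f -> pdiff g -> pdiff (fun x => f x + g x) /\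
  forall i, partial i (fun x => f x + g x) = fun x => partial i f x + partial i g x.
Proof.
move=> pf pg; apply: (pdiff_of_isd (df := fun i x => partial i f x + partial i g x)).
  by apply: contD; exact: pdiff_cont.
by move=> i x; apply: isdD; exact: pdiff_isd.
Qed.

Lemma pdiffM f g : pdiff f -> pdiff g -> pdiff (fun x => f x * g x) /\
  forall i, partial i (fun x => f x * g x) =
    fun x => partial i f x * g x + f x * partial i g x.
Proof.
move=> pf pg; apply: (pdiff_of_isd
  (df := fun i x => partial i f x * g x + f x * partial i g x)).
  by apply: contM; exact: pdiff_cont.
by move=> i x; apply: isdM; exact: pdiff_isd.
Qed.

Lemma pdiffZ (c : C) f : pdiff f -> pdiff (fun x => c * f x) /\
  forall i, partial i (fun x => c * f x) = fun x => c * partial i f x.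
Proof.
move=> pf; apply: (pdiff_of_isd (df := fun i x => c * partial i f x)).
  by apply: contM; [exact: cont_cst|exact: pdiff_cont].
by move=> i x; apply: isdZ; exact: pdiff_isd.
Qed.

Lemma pdiff_conj f : pdiff f -> pdiff (fun x => conjc (f x)) /\
  forall i, partial i (fun x => conjc (f x)) = fun x => conjc (partial i f x).
Proof.
move=> pf; apply: (pdiff_of_isd (df := fun i x => conjc (partial i f x))).
  by apply: cont_conj; exact: pdiff_cont.
by move=> i x; apply: isd_conj; exact: pdiff_isd.
Qed.

Lemma pdiff_cst (c : C) : pdiff (fun _ : E => c) /\
  forall i, partial i (fun _ : E => c) = fun=> 0.
Proof.
apply: (pdiff_of_isd (df := fun _ _ => 0)); first exact: cont_cst.
by move=> i x; exact: isd_cst.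
Qed.

Lemma dl_rcons l i f : dl (rcons l i) f = dl l (partial i f).
Proof. by rewrite /dl foldr_rcons. Qed.

Lemma smooth_dl l f : smooth f -> smooth (dl l f).
Proof. by move=> sf l'; rewrite /dl -foldr_cat; exact: sf. Qed.

Lemma smooth_pdiff f : smooth f -> pdiff f.
Proof. by move=> /(_ [::]). Qed.

Lemma smooth_partial i f : smooth f -> smooth (partial i f).
Proof. exact: (@smooth_dl [:: i]). Qed.

Lemma smooth_cont f : smooth f -> cont f.
Proof. by move=> /smooth_pdiff/pdiff_cont. Qed.

(** Coinduction: in a class closed under partial derivatives, every iterated derivative of a member
    is again a member, hence differentiable. *)
Lemma smooth_coind (P : (E -> C) -> Prop) :
  (forall f, P f -> pdiff f /\ forall i, P (partial i f)) ->
  forall f, P f -> smooth f.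
Proof.
move=> PP f Pf; suff H l : P (dl l f) by move=> l; exact: (PP _ (H l)).1.
by elim: l => // i l /PP[_]; exact.
Qed.

(** Finite order is what products need: the derivative of a product is a sum of products, so
    [smooth_coind] does not apply to the class of products, and induction on the order replaces
    it. *)
Fixpoint Ck k f : Prop :=
  pdiff f /\ if k is k'.+1 then forall i, Ck k' (partial i f) else True.

Lemma Ck_pdiff k f : Ck k f -> pdiff f. Proof. by case: k => [|k] []. Qed.

Lemma Ck_partial k f i : Ck k.+1 f -> Ck k (partial i f).
Proof. by case=> _; exact. Qed.

Lemma Ck_pred k f : Ck k.+1 f -> Ck k f.
Proof.
elim: k f => [|k IH] f [pf H]; split => // i; exact/IH/H.
Qed.

Lemma smoothP f : smooth f <-> forall k, Ck k f.
Proof.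
split=> [sf k|H].
  elim: k f sf => [|k IH] f sf; split=> //; try exact: smooth_pdiff.
  by move=> i; apply/IH/smooth_partial.
apply: (smooth_coind (P := fun f => forall k, Ck k f)) H => {}f H; split.
  exact: Ck_pdiff (H 0%N).
by move=> i k; exact: Ck_partial (H k.+1).
Qed.

Lemma CkD k f g : Ck k f -> Ck k g -> Ck k (fun x => f x + g x).
Proof.
elim: k f g => [|k IH] f g cf cg; have [p H] := pdiffD (Ck_pdiff cf) (Ck_pdiff cg).
  by split.
by split => // i; rewrite H; apply: IH; exact: Ck_partial.
Qed.

Lemma CkM k f g : Ck k f -> Ck k g -> Ck k (fun x => f x * g x).
Proof.
elim: k f g => [|k IH] f g cf cg; have [p H] := pdiffM (Ck_pdiff cf) (Ck_pdiff cg).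
  by split.
split => // i; rewrite H; apply: CkD; apply: IH.
- exact: Ck_partial.
- exact: Ck_pred.
- exact: Ck_pred.
- exact: Ck_partial.
Qed.

Lemma smoothM f g : smooth f -> smooth g -> smooth (fun x => f x * g x).
Proof. by move=> /smoothP sf /smoothP sg; apply/smoothP => k; exact: CkM. Qed.

Lemma smooth_cst (c : C) : smooth (fun _ : E => c).
Proof.
apply: (smooth_coind (P := fun f => exists c, f = fun=> c)); last by exists c.
move=> _ [c' ->]; have [p H] := pdiff_cst c'; split => // i.
by rewrite H; exists 0.
Qed.

Lemma smoothZ (c : C) f : smooth f -> smooth (fun x => c * f x).
Proof. by apply: smoothM; exact: smooth_cst. Qed.

Lemma smooth_conj f : smooth f -> smooth (fun x => conjc (f x)).
Proof.
move=> sf; apply: (smooth_coind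
  (P := fun h => exists2 f, smooth f & h = fun x => conjc (f x))); last by exists f.
move=> _ [g sg ->]; have [p H] := pdiff_conj (smooth_pdiff sg); split; first exact: p.
by move=> i; rewrite H; exists (partial i g); [exact: smooth_partial|].
Qed.

Lemma dlD l f g : smooth f -> smooth g ->
  dl l (fun x => f x + g x) = fun x => dl l f x + dl l g x.
Proof.
elim/last_ind: l f g => // l i IH f g sf sg; rewrite !dl_rcons.
rewrite (pdiffD (smooth_pdiff sf) (smooth_pdiff sg)).2.
by rewrite IH; [|exact: smooth_partial..].
Qed.

Lemma dlZ l (c : C) f : smooth f -> dl l (fun x => c * f x) = fun x => c * dl l f x.
Proof.
elim/last_ind: l f => // l i IH f sf; rewrite !dl_rcons.
rewrite (pdiffZ c (smooth_pdiff sf)).2.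
by rewrite IH; [|exact: smooth_partial].
Qed.

Lemma dl_conj l f : smooth f ->
  dl l (fun x => conjc (f x)) = fun x => conjc (dl l f x).
Proof.
elim/last_ind: l f => // l i IH f sf; rewrite !dl_rcons.
rewrite (pdiff_conj (smooth_pdiff sf)).2.
by rewrite IH; [|exact: smooth_partial].
Qed.

(** Leibniz rule with its 2^N terms counted rather than listed; asking the bound for every pair of
    lists of total length N avoids tracking which sublists occur. *)
Lemma dl_mul_le l f g x (M : R) : smooth f -> smooth g ->
  (forall l1 l2, (size l1 + size l2 = size l)%N ->
     cabs (dl l1 f x) * cabs (dl l2 g x) <= M) ->
  cabs (dl l (fun x => f x * g x) x) <= 2 ^+ size l * M.
Proof.
elim/last_ind: l f g => [|l i IH] f g sf sg H.
  by rewrite expr0 mul1r/= cabsM; exact: (H [::] [::]).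
have [sf' sg'] := (smooth_partial i sf, smooth_partial i sg).
rewrite dl_rcons (pdiffM (smooth_pdiff sf) (smooth_pdiff sg)).2 dlD; [|exact: smoothM..].
rewrite (le_trans (cabsD _ _))// size_rcons exprS -mulrA mulr2n mulrDl mul1r lerD//.
- apply: IH => // l1 l2 ll; rewrite -dl_rcons; apply: H.
  by rewrite !size_rcons addSn ll.
- apply: IH => // l1 l2 ll; rewrite -dl_rcons; apply: H.
  by rewrite !size_rcons addnS ll.
Qed.

End OneSpace.

(** A directional derivative depends only on the restriction to the line, so it can be carried
    between functions on different spaces. This replaces the chain rule for affine substitutions. *)
Lemma isd_line m n (f : 'rV[R]_m -> C) (g : 'rV[R]_n -> C) x v y w df :
  (forall t : R, g (t *: w + y) = f (t *: v + x)) ->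
  isd f x v df -> isd g y w df.
Proof.
move=> H [d1 d2].
have lineE (F : 'rV[R]_m -> R) (G : 'rV[R]_n -> R) (d : R) :
    (forall t : R, G (t *: w + y) = F (t *: v + x)) -> is_derive x v F d ->
    is_derive y w G d.
  move=> GF [dF <-].
  have E : (fun h : R => h^-1 *: ((G \o shift y) (h *: w) - G y)) =
           (fun h : R => h^-1 *: ((F \o shift x) (h *: v) - F x)).
    apply/funext => h /=; rewrite GF.
    by have := GF 0; rewrite !scale0r !add0r => ->.
  by split; rewrite /derivable /derive E.
by split; [apply: lineE d1 => t; rewrite /re_part H|
           apply: lineE d2 => t; rewrite /im_part H].
Qed.

Lemma cont_comp m n (A : 'rV[R]_m -> 'rV[R]_n) (f : 'rV[R]_n -> C) :
  continuous A -> cont f -> cont (f \o A).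
Proof.
move=> cA [c1 c2]; split => x.
- by apply: (@continuous_comp _ _ _ A (re_part f)); [exact: cA|exact: c1].
- by apply: (@continuous_comp _ _ _ A (im_part f)); [exact: cA|exact: c2].
Qed.

End Words.

(** * Mean value theorem along lines and symmetry of second derivatives *)

Section Lines.
Context {R : realType}.

Lemma is_derive_line (V W : normedModType R) (F : V -> R) (G : W -> R) x v y w d :
  (forall t : R, G (t *: w + y) = F (t *: v + x)) ->
  is_derive x v F d -> is_derive y w G d.
Proof.
move=> GF [dF <-].
have E : (fun h : R => h^-1 *: ((G \o shift y) (h *: w) - G y)) =
         (fun h : R => h^-1 *: ((F \o shift x) (h *: v) - F x)).
  apply/funext => h /=; rewrite GF.
  by have := GF 0; rewrite !scale0r !add0r => ->.
by split; rewrite /derivable /derive E.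
Qed.

Lemma is_derive_scale (V : normedModType R) (F : V -> R) x v d (a : R) :
  is_derive x v F d -> is_derive x (a *: v) F (a * d).
Proof.
move=> H.
pose G t : R := F (t *: v + x).
have H1 : is_derive (0 : R) (1 : R) G d.
  apply: (@is_derive_line V R^o F G x v 0 1 d) H => t.
  by rewrite /G addr0 [t *: 1]mulr1.
have H2 : is_derive (0 : R) (1 : R) (G \o (fun t => a * t)) (d * a).
  have Ha : is_derive (0 : R) (1 : R) (fun t : R => a * t) a.
    by have := is_deriveZ a (is_derive_id (0 : R^o) 1); rewrite [a *: 1]mulr1.
  have Hd : is_derive (a * 0) (1 : R) G d by rewrite mulr0.
  exact: (is_derive1_comp Hd Ha).
apply: (@is_derive_line R^o V (G \o (fun t => a * t)) F 0 1 x (a *: v)).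
  by move=> t; rewrite /G/= addr0 [t *: 1]mulr1 scalerA mulrC.
by rewrite mulrC.
Qed.

Lemma mvt_line (V : normedModType R) (F dF : V -> R) v :
  (forall y, is_derive y v F (dF y)) -> forall x t, exists2 th, `|th| <= `|t| &
  F (t *: v + x) - F x = t * dF (th *: v + x).
Proof.
move=> H.
have pos x t : 0 <= t -> exists2 th, 0 <= th <= t &
    F (t *: v + x) - F x = t * dF (th *: v + x).
  move=> t0; pose G t := F (t *: v + x).
  have dG u : is_derive (u : R) (1 : R) G (dF (u *: v + x)).
    apply: (@is_derive_line V R^o F G (u *: v + x) v u 1) (H _) => r.
    by rewrite /G [r *: 1]mulr1 scalerDl addrA.
  have cG : {within `[0, t], continuous G}.
    apply: continuous_subspaceT => u.
    by apply: differentiable_continuous; apply/derivable1_diffP; exact: ex_derive.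
  have [th tht E] := @MVT_segment R G _ 0 t t0 (fun u _ => dG u) cG.
  exists th; first by move: tht; rewrite in_itv.
  by move: E; rewrite /G scale0r add0r subr0 mulrC.
move=> x t; have [t0|t0] := leP 0 t.
  have [th /andP[h0 h1] E] := pos x t t0; exists th => //.
  by rewrite !ger0_norm.
(* A negative increment is a positive one read from the other end point [t *: v + x]. *)
have [|th /andP[h0 h1] E] := pos (t *: v + x) (- t); first by rewrite oppr_ge0 ltW.
exists (th + t).
  by rewrite ler_norml (ltr0_norm t0) opprK; apply/andP; split; lra.
move: E; rewrite scaleNr addrA addNr add0r addrA -scalerDl => E.
by rewrite -opprB E mulNr opprK.
Qed.

(** The increment along v + w is cut into a step h v from x and a step h w from the moved point. The
    mean value theorem evaluates the second step, and continuity of [dF] brings the result back to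
    x. This serves integrands in which one variable enters two blocks. *)
Lemma is_derive_dirD (V : normedModType R) (F dF : V -> R) x v w a :
  (forall y, is_derive y w F (dF y)) -> {for x, continuous dF} ->
  is_derive x v F a -> is_derive x (v + w) F (a + dF x).
Proof.
move=> H c [dv av].
suff L : h^-1 *: ((F \o shift x) (h *: (v + w)) - F x) @[h --> 0^'] --> a + dF x.
  by split; [exact: cvgP L|exact: cvg_lim L].
have E (h : R) : h != 0 -> h^-1 *: ((F \o shift x) (h *: (v + w)) - F x) =
   h^-1 *: ((F \o shift x) (h *: v) - F x) +
   h^-1 *: (F (h *: w + (h *: v + x)) - F (h *: v + x)).
  move=> h0 /=; rewrite -[in RHS]mulrDr; congr (_ * _).
  have -> : h *: w + (h *: v + x) = h *: (v + w) + x.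
    by rewrite scalerDr addrA [h *: w + _]addrC.
  ring.
have Lv : h^-1 *: ((F \o shift x) (h *: v) - F x) @[h --> 0^'] --> a.
  by rewrite -av; exact: dv.
have Lw : h^-1 *: (F (h *: w + (h *: v + x)) - F (h *: v + x)) @[h --> 0^'] --> dF x.
  apply/cvgrPdist_lt => e e0; move/cvgrPdist_lt : c => /(_ e e0).
  move=> /nbhs_ballP[r /= r0 Hr].
  have N0 : 0 < `|v| + `|w| + 1 by rewrite ltr_wpDl// addr_ge0.
  exists (r / (`|v| + `|w| + 1)) => /=; first by rewrite divr_gt0.
  move=> h /=; rewrite sub0r normrN ltr_pdivlMr// => hr h0.
  have [th tht ->] := mvt_line H (h *: v + x) h.
  rewrite [_ *: _]mulrA mulVf// mul1r; apply: Hr.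
  rewrite -ball_normE/= addrA opprD addrCA subrr addr0 normrN.
  rewrite (le_lt_trans (ler_normD _ _))// !normrZ.
  apply: le_lt_trans hr.
  by have := ler_wpM2r (normr_ge0 w) tht; have := normr_ge0 h; lra.
apply: cvg_trans (cvgD Lv Lw); apply: near_eq_cvg.
by near=> h; apply/esym/E; near: h; exact: nbhs_dnbhs_neq.
Unshelve. all: by end_near. Qed.

(** The second difference over the parallelogram with sides t v and t w is symmetric in v and w. The
    mean value theorem applied twice, in either order, makes it t^2 times a mixed derivative at a
    point near x. *)
Lemma schwarz (V : normedModType R) (F Fv Fw Fvw Fwv : V -> R) v w x :
  (forall y, is_derive y v F (Fv y)) -> (forall y, is_derive y w F (Fw y)) ->
  (forall y, is_derive y w Fv (Fvw y)) -> (forall y, is_derive y v Fw (Fwv y)) ->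
  {for x, continuous Fvw} -> {for x, continuous Fwv} -> Fvw x = Fwv x.
Proof.
move=> Hv Hw Hvw Hwv cvw cwv.
have half (p q : V) (G Gp Gpq : V -> R) t :
    (forall y, is_derive y p G (Gp y)) -> (forall y, is_derive y q Gp (Gpq y)) ->
    exists2 y, `|y - x| <= `|t| * (`|p| + `|q|) &
    G (t *: p + (t *: q + x)) - G (t *: p + x) - (G (t *: q + x) - G x) =
      t * (t * Gpq y).
  move=> Hp Hq.
  pose D y := G (t *: q + y) - G y.
  have HD y : is_derive y p D (Gp (t *: q + y) - Gp y).
    apply: is_deriveB; apply: (@is_derive_line V V G _ (t *: q + y) p) (Hp _) => r.
    by rewrite addrCA.
  have [th tht E] := mvt_line HD x t.
  have [th' tht' E'] := mvt_line Hq (th *: p + x) t.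
  exists (th' *: q + (th *: p + x)).
    rewrite addrA addrK (le_trans (ler_normD _ _))// !normrZ mulrDr addrC.
    by rewrite lerD// ler_wpM2r.
  by rewrite -E' -E /D addrCA.
apply/eqP; rewrite -subr_eq0 -normr_le0; apply/ler_addgt0Pl => e e0.
rewrite addr0.
have e20 : 0 < e / 2 by rewrite divr_gt0.
move/cvgrPdist_lt : cvw => /(_ _ e20) /nbhs_ballP[r1 /= r10 H1].
move/cvgrPdist_lt : cwv => /(_ _ e20) /nbhs_ballP[r2 /= r20 H2].
(* This size keeps both intermediate points in the balls on which each mixed derivative is within
   e/2 of its value at x. *)
pose t := Num.min r1 r2 / (`|v| + `|w| + 1).
have N0 : 0 < `|v| + `|w| + 1 by rewrite ltr_wpDl// addr_ge0.
have t0 : 0 < t by rewrite divr_gt0// lt_min r10.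
have tr : `|t| * (`|v| + `|w|) < Num.min r1 r2.
  rewrite gtr0_norm// /t mulrAC ltr_pdivrMr// ltr_pM2l ?lt_min ?r10//.
  by rewrite ltrDl.
have [y yx Ey] := half v w F Fv Fvw t Hv Hvw.
have [z zx Ez] := half w v F Fw Fwv t Hw Hwv.
have tt : t * (t * Fvw y) = t * (t * Fwv z).
  by rewrite -Ey -Ez addrCA !opprB; ring.
have yz : Fvw y = Fwv z.
  by apply: (mulfI (lt0r_neq0 t0)); exact: (mulfI (lt0r_neq0 t0) tt).
have := H1 y; rewrite -ball_normE/= distrC => /(_ _)/= {}H1.
have := H2 z; rewrite -ball_normE/= distrC => /(_ _)/= {}H2.
rewrite [in X in _ <= X](splitr e).
rewrite (_ : Fvw x - Fwv x = (Fvw x - Fvw y) - (Fwv x - Fwv z)); last first.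
  by rewrite yz; ring.
rewrite (le_trans (ler_normB _ _))// lerD// ltW//.
- apply: H1; rewrite (le_lt_trans yx)// (lt_le_trans tr)// ge_min lexx//.
- apply: H2; rewrite (le_lt_trans zx)// [`|w| + _]addrC (lt_le_trans tr)//.
  by rewrite ge_min lexx orbT.
Qed.

End Lines.

(** * Reordering of partial derivatives and coordinate functions *)

Section MoreWords.
Context {R : realType}.
Local Notation C := R[i].

Lemma isd_scale n (f : 'rV[R]_n -> C) x v df (a : R) :
  isd f x v df -> isd f x (a *: v) (a%:C * df).
Proof.
move=> [d1 d2]; split.
- by rewrite Re_mulc/= mul0r subr0; exact: is_derive_scale.
- by rewrite Im_mulc/= mul0r addr0; exact: is_derive_scale.
Qed.

Lemma isd_opp n (f : 'rV[R]_n -> C) x v df : isd f x v df -> isd f x (- v) (- df).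
Proof.
move=> /(isd_scale (- 1)); rewrite scaleN1r => /isd_eq; apply.
by rewrite rmorphN1 mulN1r.
Qed.

Lemma isd_dirD n (f dw : 'rV[R]_n -> C) x v w a :
  (forall y, isd f y w (dw y)) -> cont dw -> isd f x v a ->
  isd f x (v + w) (a + dw x).
Proof.
move=> H [c1 c2] [a1 a2]; split.
- rewrite Re_addc; apply: (is_derive_dirD (dF := re_part dw)) => //; last exact: c1.
  by move=> y; case: (H y).
- rewrite Im_addc; apply: (is_derive_dirD (dF := im_part dw)) => //; last exact: c2.
  by move=> y; case: (H y).
Qed.

Lemma partialC n (f : 'rV[R]_n -> C) i j : smooth f ->
  partial i (partial j f) = partial j (partial i f).
Proof.
move=> sf; have [sfi sfj] := (smooth_partial i sf, smooth_partial j sf).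
have d1 k y := pdiff_isd k y (smooth_pdiff sf).
have d2 k y := pdiff_isd k y (smooth_pdiff sfi).
have d3 k y := pdiff_isd k y (smooth_pdiff sfj).
have [c1 c2] := smooth_cont (smooth_partial i sfj).
have [c3 c4] := smooth_cont (smooth_partial j sfi).
apply/funext => x; apply: complex_eq.
- exact: (schwarz (fun y => (d1 j y).1) (fun y => (d1 i y).1)
    (fun y => (d3 i y).1) (fun y => (d2 j y).1) (c1 x) (c3 x)).
- exact: (schwarz (fun y => (d1 j y).2) (fun y => (d1 i y).2)
    (fun y => (d3 i y).2) (fun y => (d2 j y).2) (c2 x) (c4 x)).
Qed.

(** Lists of derivatives come in any order, whereas [mpartial] runs through the coordinates one by
    one; symmetry of second derivatives reconciles the two. *)
Lemma dl_perm n (f : 'rV[R]_n -> C) l l' : smooth f -> perm_eq l l' ->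
  dl l f = dl l' f.
Proof.
move=> sf; elim: l l' => [|i l IH] l' ll'.
  by move: ll'; rewrite perm_sym => /perm_nilP ->.
have il' : i \in l' by rewrite -(perm_mem ll') mem_head.
case/splitPr : il' ll' => p1 p2.
move=> H; have {}H : perm_eq l (p1 ++ p2).
  by move: H; rewrite -cat1s perm_sym -[i :: p2]cat1s perm_catCA perm_cat2l perm_sym.
rewrite -[LHS]/(partial i (dl l f)) (IH _ H) {H IH} /dl !foldr_cat /=.
rewrite -/(dl p2 f); have := smooth_dl p2 sf; move: (dl p2 f) => g sg.
elim: p1 => //= j p1 <-; rewrite partialC//.
exact: (smooth_dl p1 sg).
Qed.

Lemma isd_coord n (i : 'I_n) (x v : 'rV[R]_n) :
  isd (fun x => (x 0 i)%:C) x v (v 0 i)%:C.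
Proof.
apply: isd_real; apply: (@is_derive_line R R^o _ id _ (x 0 i) (v 0 i)).
  by move=> t; rewrite !mxE.
Qed.

Lemma coord_cont n (i : 'I_n) : continuous (fun x : 'rV[R]_n => x 0 i).
Proof. exact: coord_continuous. Qed.

Lemma smooth_coord n (i : 'I_n) : smooth (fun x : 'rV[R]_n => (x 0 i)%:C).
Proof.
have [p H] : pdiff (fun x : 'rV[R]_n => (x 0 i)%:C) /\
    forall j, partial j (fun x : 'rV[R]_n => (x 0 i)%:C) = fun=> (unit_vec j 0 i)%:C.
  apply: (pdiff_of_isd (df := fun j _ => (unit_vec j 0 i)%:C)).
    by apply: cont_real; exact: coord_cont.
  by move=> j x; exact: isd_coord.
apply/smoothP => -[|k]; split => // j; rewrite H.
by move: k; apply/smoothP; exact: smooth_cst.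
Qed.

Lemma partial_coord n (i j : 'I_n) :
  partial j (fun x : 'rV[R]_n => (x 0 i)%:C) = fun=> (j == i)%:R.
Proof.
apply/funext => x; rewrite (isd_partial (isd_coord i x _)) mxE eqxx/= eq_sym.
by rewrite rmorph_nat.
Qed.

Lemma cont_rV m n (A : 'rV[R]_m -> 'rV[R]_n) :
  (forall i, continuous (fun x => A x 0 i)) -> continuous A.
Proof.
move=> H x P [Q HQ QP].
have := @filter_forall _ _ (fun i y => Q 0 i (A y 0 i)) (nbhs x) (nbhs_filter x)
  (fun i => H i x _ (HQ 0 i)).
by apply: filterS => y Hy; apply: QP => i j; rewrite ord1; exact: Hy.
Qed.

End MoreWords.

(** * Gelfand-Shilov spaces through words in multiplications and derivatives *)

#[local] Opaque smooth.

Section GelfandShilov.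
Context {R : realType} {n : nat}.
Local Notation C := R[i].
Local Notation E := 'rV[R]_n.
Implicit Types (f g : E -> C) (x y : E) (s K H : R).

(** A substitute for 1 + |x| that is subadditive and dominates every coordinate; since it is at
    least 1, its powers increase with the exponent. *)
Definition rho x : R := 1 + \sum_(i < n) `|x 0 i|.

Lemma rho_ge1 x : 1 <= rho x.
Proof. by rewrite lerDl sumr_ge0. Qed.

Lemma rho_gt0 x : 0 < rho x.
Proof. exact: lt_le_trans (rho_ge1 x). Qed.

Lemma rho_ge0 x : 0 <= rho x.
Proof. exact/ltW/rho_gt0. Qed.

Lemma coord_le_rho x i : `|x 0 i| <= rho x.
Proof. by rewrite /rho (bigD1 i)//= addrCA lerDl addr_ge0// sumr_ge0. Qed.

Lemma rhoN x : rho (- x) = rho x.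
Proof. by congr (_ + _); apply: eq_bigr => i _; rewrite mxE normrN. Qed.

Lemma rhoD x y : rho (x + y) <= rho x + rho y.
Proof.
rewrite /rho addrACA -big_split/= lerD//; first by lra.
by apply: ler_sum => i _; rewrite mxE ler_normD.
Qed.

(** [rho x] is a sum of n + 1 terms, one of which is at least the mean. Powers of [rho] thus reduce
    to powers of a single coordinate. *)
Lemma rho_max x : rho x <= n.+1%:R \/ exists i, rho x <= n.+1%:R * `|x 0 i|.
Proof.
have [[i Hi]|H] := pselect (exists i, rho x <= n.+1%:R * `|x 0 i|).
  by right; exists i.
left; rewrite leNgt; apply/negP => r1; apply: H; apply: contrapT => H.
have n0 : (0 : R) < n.+1%:R by [].
have lt_i i : `|x 0 i| < rho x / n.+1%:R.
  rewrite ltr_pdivlMr// mulrC ltNge; apply/negP => Hi.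
  by apply: H; exists i.
have : rho x < rho x / n.+1%:R + \sum_(i < n) (rho x / n.+1%:R).
  rewrite {1}/rho ltr_leD//; first by rewrite ltr_pdivlMr// mul1r.
  by apply: ler_sum => i _; exact: ltW.
rewrite sumr_const card_ord -mulrS -[X in _ < X]mulr_natr divfK ?ltxx//.
Qed.

Definition letter (a : 'I_n + 'I_n) f : E -> C :=
  match a with
  | inl i => fun x => (x 0 i)%:C * f x
  | inr i => partial i f
  end.

Definition word (W : seq ('I_n + 'I_n)) f : E -> C := foldr letter f W.

Lemma smooth_letter a f : smooth f -> smooth (letter a f).
Proof.
case: a => i sf; last exact: smooth_partial.
exact: (smoothM (smooth_coord i) sf).
Qed.

Lemma smooth_word W f : smooth f -> smooth (word W f).
Proof. by move=> sf; elim: W => [|a W IH]; [exact: sf|exact: smooth_letter]. Qed.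

Lemma word_cat W W' f : word (W ++ W') f = word W (word W' f).
Proof. exact: foldr_cat. Qed.

Lemma word_inr l f : word (map inr l) f = dl l f.
Proof. by elim: l => //= i l ->. Qed.

(** The bounds for ordered words, with all multiplications outside the derivatives and [rho] in
    place of the worst coordinate. *)
Definition decay s K H f : Prop := smooth f /\ forall k l x,
  rho x ^+ k * cabs (dl l f x) <= K * H ^+ (k + size l) * factp s (k + size l).

Definition wordb s K H f : Prop := smooth f /\ forall W x,
  cabs (word W f x) <= K * H ^+ size W * factp s (size W).

Lemma partial_mul_coord f i j : smooth f ->
  partial i (fun x => (x 0 j)%:C * f x) =
  fun x => (i == j)%:R * f x + (x 0 j)%:C * partial i f x.
Proof.
move=> sf; rewrite (pdiffM (smooth_pdiff (smooth_coord j)) (smooth_pdiff sf)).2.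
by rewrite partial_coord.
Qed.

(** Moving x_j out through N derivatives produces at most N commutators, each with one derivative
    fewer. *)
Lemma dl_mul_coord_le f j l x B : smooth f ->
  (forall l', (size l').+1 = size l -> cabs (dl l' f x) <= B) ->
  cabs (dl l (fun x => (x 0 j)%:C * f x) x) <=
  `|x 0 j| * cabs (dl l f x) + (size l)%:R * B.
Proof.
move=> sf HB.
suff : cabs (dl l (fun x => (x 0 j)%:C * f x) x - (x 0 j)%:C * dl l f x) <=
    (size l)%:R * B.
  move=> HH; rewrite -[X in cabs X](subrK ((x 0 j)%:C * dl l f x)).
  by rewrite (le_trans (cabsD _ _))// addrC cabsM cabs_real lerD2l.
elim/last_ind: l f sf HB => [|l i IH] f sf HB.
  by rewrite /= subrr cabs0 mul0r.
have sfi := smooth_partial i sf.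
rewrite !dl_rcons partial_mul_coord// dlD; last 2 first.
- exact: smoothZ.
- by apply: smoothM => //; exact: smooth_coord.
rewrite dlZ// -addrA (le_trans (cabsD _ _))// size_rcons -natr1 mulrDl mul1r [leRHS]addrC.
apply: lerD; last first.
  apply: IH => // l' Hl'; rewrite -dl_rcons; apply: HB.
  by rewrite !size_rcons Hl'.
have B0 : cabs (dl l f x) <= B by apply: HB; rewrite size_rcons.
rewrite cabsM; case: (i == j); rewrite ?mulr1n ?mulr0n; first by rewrite cabs1 mul1r.
by rewrite cabs0 mul0r (le_trans (cabs_ge0 _) B0).
Qed.

(** A multiplication met under the derivatives [l] is commuted out: it either becomes a factor [rho]
    or cancels one of the derivatives, at most |l| times. In the second case two letters disappear,
    and [factpSS] lets them pay for the factor |l|. The two alternatives double the bound at each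
    letter. *)
Lemma wordb_of_decay s K H f : 2^-1 <= s -> 0 <= K -> 1 <= H ->
  decay s K H f -> wordb s K (2 * H) f.
Proof.
move=> s2 K0 H1 [sf df]; split => // W x.
have s0 : 0 <= s by lra.
have H0 : 0 <= H by lra.
(* The induction peels letters off the left of the word, so it carries the powers of [rho] and the
   derivatives already peeled off. *)
suff main k l : rho x ^+ k * cabs (dl l (word W f) x) <=
    2 ^+ size W * (K * H ^+ (k + size l + size W) * factp s (k + size l + size W)).
  have := main 0%N [::]; rewrite expr0 mul1r !add0n /= exprMn => /le_trans; apply.
  by rewrite le_eqVlt; apply/orP; left; apply/eqP; ring.
elim: W k l => [|[j|i] W IH] k l.
- by rewrite expr0 mul1r !addn0.
- set M := (k + size l + _)%N.
  have sW := smooth_word W sf.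
  have b0 m : 0 <= K * H ^+ m * factp s m by rewrite !mulr_ge0 ?exprn_ge0 ?factp_ge0.
  pose B := 2 ^+ size W * (K * H ^+ M * factp s M).
  have B0 : 0 <= B by rewrite mulr_ge0 ?exprn_ge0.
  have first_term : rho x ^+ k * (`|x 0 j| * cabs (dl l (word W f) x)) <= B.
    have := IH k.+1 l; have -> : (k.+1 + size l + size W = M)%N.
      by rewrite /M /= addnS !addSn.
    apply: le_trans.
    rewrite exprSr -mulrA ler_wpM2l ?exprn_ge0 ?rho_ge0//.
    by rewrite ler_wpM2r ?cabs_ge0// coord_le_rho.
  have rk0 : 0 < rho x ^+ k by rewrite exprn_gt0 ?rho_gt0.
  have second_term l' : (size l').+1 = size l ->
      rho x ^+ k * ((size l)%:R * cabs (dl l' (word W f) x)) <= B.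
    move=> ll'; rewrite mulrCA.
    have ME : M = (k + size l' + size W).+2 by rewrite /M -ll' /= !addnS !addSn.
    set m := (k + size l' + size W)%N in ME.
    apply: (@le_trans _ _ ((size l)%:R * (2 ^+ size W * (K * H ^+ m * factp s m)))).
      by rewrite ler_wpM2l.
    rewrite mulrCA /B ler_wpM2l ?exprn_ge0// ME mulrCA -[leRHS]mulrA -[leLHS]mulrA.
    rewrite ler_wpM2l//.
    have hm : H ^+ m <= H ^+ m.+2 by rewrite ler_weXn2l// leqW// leqW.
    apply: ler_pM => //; rewrite ?exprn_ge0 ?mulr_ge0 ?factp_ge0//.
    apply: le_trans (factpSS m s2); rewrite ler_wpM2r ?factp_ge0// ler_nat.
    by rewrite -ll' ltnS /m -addnA addnCA leq_addr.
  (* [dl_mul_coord_le] multiplies its bound by |l|, which the division anticipates. For empty [l] no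
     such [l'] exists, and the statement is vacuous. *)
  have Bk l' : (size l').+1 = size l ->
      cabs (dl l' (word W f) x) <= B / rho x ^+ k / (size l)%:R.
    move=> ll'; have l0 : (0 : R) < (size l)%:R by rewrite -ll'.
    rewrite !ler_pdivlMr// (_ : _ * _ * _ =
      rho x ^+ k * ((size l)%:R * cabs (dl l' (word W f) x))) ?second_term//; ring.
  rewrite exprS -mulrA mulrDl mul1r -/B.
  have := ler_wpM2l (ltW rk0) (dl_mul_coord_le j sW Bk).
  move=> /le_trans; apply; rewrite mulrDr lerD//.
  have [->|l0] := eqVneq (size l) 0%N; first by rewrite mul0r mulr0.
  have ln0 : (size l)%:R != 0 :> R by rewrite pnatr_eq0.
  rewrite le_eqVlt; apply/orP; left; apply/eqP.
  by field; rewrite ln0 /= expf_neq0// gt_eqF// rho_gt0.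
- rewrite /= -dl_rcons (le_trans (IH k (rcons l i)))// size_rcons addnS addSnnS.
  by rewrite ler_wpM2r ?mulr_ge0 ?exprn_ge0 ?factp_ge0// ler_weXn2l// ler1n.
Qed.

Definition mword (a : multi_index n) : seq 'I_n :=
  flatten [seq nseq (a i) i | i <- enum 'I_n].

Lemma mpartialE a f : mpartial a f = dl (mword a) f.
Proof.
rewrite /mpartial /mword; elim: (enum 'I_n) => //= i r ->.
rewrite /dl foldr_cat; move: (foldr _ _ _) => g.
by elim: (a i) => //= k ->.
Qed.

Lemma size_mword (a : multi_index n) : size (mword a) = mlen a.
Proof.
rewrite /mword size_flatten /shape -map_comp /mlen -big_enum/=.
by rewrite sumnE big_map; apply: eq_bigr => i _; rewrite /= size_nseq.
Qed.

Lemma count_mword (a : multi_index n) i : count_mem i (mword a) = a i.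
Proof.
rewrite /mword count_flatten -map_comp sumnE big_map big_enum/= (bigD1 i)//=.
rewrite count_nseq /= eqxx mul1n big1 ?addn0// => j ji.
by rewrite /= count_nseq /= (negbTE ji) mul0n.
Qed.

Lemma dl_mpartial f l : smooth f ->
  dl l f = mpartial [ffun i => count_mem i l] f.
Proof.
move=> sf; rewrite mpartialE; apply: dl_perm => //.
by apply/allP => i _ /=; rewrite count_mword ffunE.
Qed.

Lemma mlen_count l : mlen ([ffun i => count_mem i l] : multi_index n) = size l.
Proof.
rewrite -size_mword; apply/esym/perm_size/allP => i _ /=.
by rewrite count_mword ffunE.
Qed.

Lemma word_inl l f x : word (map inl l) f x = (\prod_(i <- l) x 0 i)%:C * f x.
Proof.
elim: l => [|i l IH] /=; first by rewrite big_nil mul1r.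
by rewrite IH big_cons rmorphM mulrA.
Qed.

Lemma monomialE b x : monomial b x = \prod_(i <- mword b) x 0 i.
Proof.
rewrite /monomial /mword -big_enum/=; elim: (enum 'I_n) => [|i r IH] /=.
  by rewrite !big_nil.
rewrite big_cons big_cat/= IH; congr (_ * _).
by elim: (b i) => [|k]; rewrite ?big_nil//= big_cons exprS => ->.
Qed.

Lemma mfact_le (a : multi_index n) : (mfact a <= (mlen a)`!)%N.
Proof.
rewrite /mfact /mlen; elim/big_ind2 : _ => // p q p' q' H1 H2.
by rewrite (leq_trans (leq_mul H1 H2))// fact_mul_le.
Qed.

(** The inequality (p + q)! <= 2^(p+q) p! q! is applied once per coordinate, each time with p + q at
    most |a|, hence the exponent n |a|. *)
Lemma mlen_fact_le (a : multi_index n) : ((mlen a)`! <= 2 ^ (n * mlen a) * mfact a)%N.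
Proof.
rewrite /mfact /mlen -!big_enum/=.
rewrite -[X in (2 ^ (X * _))%N]size_enum_ord.
elim: (enum 'I_n) => [|i r IH] /=; first by rewrite !big_nil.
rewrite !big_cons mulSn expnD -mulnA.
rewrite (leq_trans (fact_add_le _ _))// leq_mul2l; apply/orP; right.
rewrite mulnCA leq_mul2l; apply/orP; right.
rewrite (leq_trans IH)// leq_mul2r leq_exp2l//; apply/orP; right.
by rewrite leq_mul2l leq_addl orbT.
Qed.

Lemma GS_of_wordb s K H f : 0 <= s -> 0 < K -> 0 < H -> wordb s K H f -> GS n s f.
Proof.
move=> s0 K0 H0 [sf wf].
(* Of the n + 1 factors 2, one splits (|a| + |b|)! and n bring |a|! and |b|! down to multi-index
   factorials. *)
exists (H * (2 ^+ n.+1) `^ s); first by rewrite mulr_gt0 ?powR_gt0 ?exprn_gt0.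
exists K => //; split => // a b x.
have -> : (monomial b x)%:C * mpartial a f x =
    word (map inl (mword b) ++ map inr (mword a)) f x.
  by rewrite word_cat word_inr word_inl monomialE mpartialE.
rewrite (le_trans (wf _ _))// size_cat !size_map !size_mword addnC -mulrA.
rewrite ler_wpM2l ?(ltW K0)// exprMn -mulrA ler_wpM2l ?exprn_ge0 ?(ltW H0)//.
rewrite powRX ?exprn_ge0// -powRM ?exprn_ge0//; apply: ge0_ler_powR => //.
- by rewrite nnegrE.
- by rewrite nnegrE mulr_ge0// exprn_ge0// exprn_ge0.
rewrite -!natrX -natrM ler_nat (leq_trans (fact_add_le _ _))//.
rewrite -expnM mulSn [X in (_ <= X * _)%N]expnD -[leqRHS]mulnA leq_mul2l.
apply/orP; right; rewrite (leq_trans (leq_mul (mlen_fact_le a) (mlen_fact_le b)))//.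
by rewrite mulnACA -expnD -mulnDr.
Qed.

(** By [rho_max], rho^k is at most (n + 1)^k times 1 or the k-th power of one coordinate; both are
    monomials of degree at most k, controlled by the seminorms of [GS]. *)
Lemma decay_of_GS s f : 0 <= s -> GS n s f ->
  exists K H, [/\ 0 < K, 1 <= H & decay s K H f].
Proof.
move=> s0 [h h0 [r r0 [sf gf]]].
pose h1 := Num.max 1 h.
have h11 : 1 <= h1 by rewrite le_max lexx.
have h10 : 0 <= h1 by lra.
have N1 : (1 : R) <= n.+1%:R by rewrite ler1n.
exists r, (n.+1%:R * h1); split=> //.
  by rewrite (le_trans h11)// ler_peMl.
split => // k l x.
have base b : (mlen b <= k)%N -> `|monomial b x| * cabs (dl l f x) <=
    r * h1 ^+ (k + size l) * factp s (k + size l).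
  move=> bk; rewrite dl_mpartial// -cabs_real -cabsM.
  rewrite (le_trans (gf _ _ _))// -mulrA ler_wpM2l ?(ltW r0)// mlen_count.
  apply: ler_pM; rewrite ?exprn_ge0 ?powR_ge0 ?(ltW h0)//.
    apply: (@le_trans _ _ (h1 ^+ (size l + mlen b))).
      by rewrite lerXn2r ?nnegrE ?(ltW h0)// le_max lexx orbT.
    by rewrite ler_weXn2l// addnC leq_add2r.
  apply: ge0_ler_powR; rewrite ?nnegrE// ler_nat.
  rewrite (leq_trans (leq_mul (mfact_le _) (mfact_le _)))// mlen_count.
  by rewrite (leq_trans (fact_mul_le _ _))// leq_fact// addnC leq_add2r.
have fin (b : multi_index n) : (mlen b <= k)%N ->
    rho x ^+ k <= n.+1%:R ^+ k * `|monomial b x| ->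
    rho x ^+ k * cabs (dl l f x) <=
      r * (n.+1%:R * h1) ^+ (k + size l) * factp s (k + size l).
  move=> bk Hb; rewrite (le_trans (ler_wpM2r (cabs_ge0 _) Hb))// -[leLHS]mulrA.
  rewrite (le_trans (ler_wpM2l _ (base _ bk))) ?exprn_ge0//.
  rewrite [leRHS](_ : _ = n.+1%:R ^+ (k + size l) *
    (r * h1 ^+ (k + size l) * factp s (k + size l))); last by rewrite exprMn; ring.
  rewrite ler_wpM2r ?mulr_ge0 ?exprn_ge0 ?factp_ge0 ?(ltW r0)//.
  by rewrite ler_weXn2l// leq_addr.
have [H|[i H]] := rho_max x.
- pose b : multi_index n := [ffun=> 0%N].
  have mb : monomial b x = 1.
    by rewrite /monomial big1// => i _; rewrite ffunE expr0.
  apply: (fin b); first by rewrite /mlen big1// => i _; rewrite ffunE.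
  by rewrite mb normr1 mulr1 lerXn2r ?nnegrE ?rho_ge0.
- pose b : multi_index n := [ffun j => if j == i then k else 0%N].
  apply: (fin b).
    rewrite /mlen (bigD1 i)//= big1 ?addn0 ?ffunE ?eqxx// => j ji.
    by rewrite ffunE (negbTE ji).
  rewrite /monomial (bigD1 i)//= big1 ?mulr1 ?ffunE ?eqxx; last first.
    by move=> j ji; rewrite ffunE (negbTE ji) expr0.
  by rewrite normrX -exprMn lerXn2r ?nnegrE ?rho_ge0.
Qed.

(** For a fixed list the factorial of k + |l| is split at the cost of 2^s per letter, and the bounds
    over all k are combined by [le_expR_of_powX]. Writing K + 1 keeps the constant positive. *)
Lemma decay_exp s K H f : 0 < s -> 0 <= K -> 1 <= H -> decay s K H f ->
  exists K' H' c, [/\ 0 < K', 1 <= H', 0 < c & forall l x,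
    cabs (dl l f x) <=
      K' * H' ^+ size l * factp s (size l) * expR (- (c * rho x `^ s^-1))].
Proof.
move=> s0 K0 H1 [sf df]; have s0' := ltW s0.
pose H2 := 2 `^ s * H.
have p21 : 1 <= 2 `^ s :> R.
  by rewrite -[leLHS](powRr0 2) ler_powR// ler1n.
have H21 : 1 <= H2 by rewrite (le_trans H1)// ler_peMl//; lra.
have [c c0 Hc] := le_expR_of_powX s0 (lt_le_trans ltr01 H21).
exists (2 `^ s * (K + 1)), H2, c; split => //.
  by rewrite mulr_gt0 ?powR_gt0//; lra.
move=> l x.
have H20 : 0 <= H2 by lra.
rewrite -!(mulrA (2 `^ s)) mulrA.
apply: Hc; rewrite ?cabs_ge0 ?rho_ge0 ?mulr_ge0 ?exprn_ge0 ?factp_ge0//; first by lra.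
move=> k; rewrite mulrC (le_trans (df _ _ _))//.
apply: (@le_trans _ _ ((K + 1) * H ^+ (k + size l) *
    ((2 `^ s) ^+ (k + size l) * (factp s k * factp s (size l))))).
  apply: ler_pM; rewrite ?mulr_ge0 ?exprn_ge0 ?factp_ge0//; first by lra.
    by rewrite ler_wpM2r ?exprn_ge0//; lra.
  exact: factpD.
rewrite le_eqVlt; apply/orP; left; apply/eqP.
by rewrite /H2 !exprMn !exprD; ring.
Qed.

End GelfandShilov.

(** * Lebesgue measure on tuples *)

Section LebesgueTuple.
Context {R : realType}.
Local Notation mR := (measurableTypeR R).
Local Notation T n := (n.-tuple mR).
Local Notation lambda := (@lebesgue_measure R).

(** An unbundled name for the measure, to which the sigma-finite structure required by Fubini is
    attached. *)
Definition lam n : set (T n) -> \bar R := lebesgue_tuple n.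

Arguments lam : clear implicits.

HB.instance Definition _ n := Measure.on (lam n).

Lemma measurable_tuple_box n (P : 'I_n -> set mR) : (forall i, measurable (P i)) ->
  measurable [set t : T n | forall i, P i (tnth t i)].
Proof.
move=> mP; rewrite [X in measurable X](_ : _ =
    \bigcap_(i in [set: 'I_n]) ((fun t : T n => tnth t i) @^-1` P i)); last first.
  by apply/seteqP; split => t H i; [move=> _|]; exact: H.
apply: fin_bigcap_measurable => // i _; rewrite -[X in measurable X]setTI.
exact: measurable_tnth.
Qed.

Definition cube (n : nat) (k : R) := [set t : T n | forall i, `]- k, k]%classic (tnth t i)].
Arguments cube : clear implicits.

Lemma forall_ord_S n (P : 'I_n.+1 -> Prop) :
  (forall i, P i) <-> P ord0 /\ (forall i, P (lift ord0 i)).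
Proof.
split=> [H|[H0 H] i]; first by split => // i; exact: H.
by case: (unliftP ord0 i) => [j ->|->].
Qed.

Lemma cube_succ n k : @cons_pair R n @^-1` cube n.+1 k = cube n k `*` `]- k, k].
Proof.
apply/seteqP; split=> -[t x]; rewrite /cube/=.
  move=> H; split=> /=; last exact: (H ord0).
  by move=> i; have := H (lift ord0 i); rewrite /cons_pair tnthS.
move=> [/= Ht Hx]; apply/forall_ord_S; split => // i.
by rewrite /cons_pair tnthS; exact: Ht.
Qed.

Lemma measurable_cube n k : measurable (cube n k).
Proof.
by apply: (@measurable_tuple_box n (fun=> `]- k, k]%classic)) => i; exact: measurable_itv.
Qed.

Lemma lam_cube_lty n k : (lam n (cube n k) < +oo)%E.
Proof.
elim: n => [|n IH].
  by rewrite /lam/= /dirac/= ltry.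
rewrite -[lam n.+1 (cube n.+1 k)]/((lam n \x lambda)%E (@cons_pair R n @^-1` cube n.+1 k)).
rewrite cube_succ product_measure1E//=; last exact: measurable_cube.
rewrite lte_mul_pinfty// ?ge0_fin_numE//.
by rewrite lebesgue_measure_itv/=; case: ifP; rewrite ?ltry.
Qed.

Lemma lam_sigma_finite n : sigma_finite setT (lam n).
Proof.
exists (fun k : nat => cube n k%:R); last first.
  by move=> k; split; [exact: measurable_cube|exact: lam_cube_lty].
apply/esym; rewrite -subTset => t _.
exists (Num.bound (\sum_(i < n) `|tnth t i|)) => //= i.
have S0 : 0 <= \sum_(i < n) `|tnth t i| by rewrite sumr_ge0.
have := archi_boundP S0; set k := (Num.bound _)%:R => Sk.
have tk : `|tnth t i| < k.
  apply: le_lt_trans Sk; rewrite (bigD1 i)//= lerDl sumr_ge0//.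
have /andP[kt /ltW tk'] : - k < tnth t i < k by rewrite -ltr_norml.
by rewrite /= in_itv/= kt.
Qed.

HB.instance Definition _ n :=
  Measure_isSigmaFinite.Build _ (T n) R (lam n) (lam_sigma_finite n).

Lemma measurable_tonelli d1 d2 (X : measurableType d1) (Y : measurableType d2)
    (mu : {sigma_finite_measure set Y -> \bar R}) (f : X * Y -> \bar R) :
  measurable_fun setT f -> (forall p, 0 <= f p)%E ->
  measurable_fun setT (fun x => \int[mu]_y f (x, y))%E.
Proof. exact: measurable_fun_fubini_tonelli_F. Qed.

Lemma tonelli_cons n (f : T n.+1 -> \bar R) : measurable_fun setT f ->
  (forall t, 0 <= f t)%E ->
  (\int[lam n.+1]_t f t =
   \int[lam n]_w \int[lambda]_x f [tuple of x :: w])%E.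
Proof.
move=> mf f0.
rewrite -[lam n.+1]/(pushforward (lam n \x lambda)%E (@cons_pair R n)).
rewrite (ge0_integral_pushforward (@measurable_cons_pair R n))//.
rewrite preimage_setT.
apply: (@fubini_tonelli1 _ _ (T n) mR R (lam n) lambda (f \o @cons_pair R n)).
  by apply: measurableT_comp => //; exact: measurable_cons_pair.
by move=> p; exact: f0.
Qed.

Lemma tonelli_cons' n (f : T n.+1 -> \bar R) : measurable_fun setT f ->
  (forall t, 0 <= f t)%E ->
  (\int[lam n.+1]_t f t =
   \int[lambda]_x \int[lam n]_w f [tuple of x :: w])%E.
Proof.
move=> mf f0; rewrite tonelli_cons//.
apply: (@fubini_tonelli _ _ (T n) mR R (lam n) lambda
  (f \o @cons_pair R n)) => //; last by move=> p; exact: f0.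
by apply: measurableT_comp => //; exact: measurable_cons_pair.
Qed.

Definition cat_pair m n (p : T m * T n) : T (m + n) := [tuple of p.1 ++ p.2].

Lemma tnth_cat_l m n (p : T m * T n) i : tnth (cat_pair p) (lshift n i) = tnth p.1 i.
Proof. exact: tnth_lshift. Qed.

Lemma tnth_cat_r m n (p : T m * T n) i : tnth (cat_pair p) (rshift m i) = tnth p.2 i.
Proof. exact: tnth_rshift. Qed.

Lemma measurable_cat_pair m n : measurable_fun setT (@cat_pair m n).
Proof.
apply/measurable_fun_tnthP => i; case: (split_ordP i) => j ->.
- rewrite (_ : _ \o _ = (fun t => tnth t j) \o fst); last first.
    by apply/funext => p /=; rewrite tnth_cat_l.
  by apply: measurableT_comp => //; exact: measurable_tnth.
- rewrite (_ : _ \o _ = (fun t => tnth t j) \o snd); last first.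
    by apply/funext => p /=; rewrite tnth_cat_r.
  by apply: measurableT_comp => //; exact: measurable_tnth.
Qed.

Lemma cons_cat_pair m n x (w : T m) (y : T n) :
  cat_pair ([tuple of x :: w], y) = [tuple of x :: cat_pair (w, y)].
Proof. exact: val_inj. Qed.

Lemma tonelli_cat m n (f : T (m + n) -> \bar R) : measurable_fun setT f ->
  (forall t, 0 <= f t)%E ->
  (\int[lam (m + n)]_t f t =
   \int[lam m]_x \int[lam n]_y f (cat_pair (x, y)))%E.
Proof.
elim: m f => [|m IH] f mf f0.
  rewrite -[lam 0]/(dirac [tuple]) integral_dirac//=.
  - rewrite diracT mul1e; apply: eq_integral => y _.
    by congr (f _); exact: val_inj.
  - apply: (@measurable_tonelli _ _ (T 0) (T n) (lam n) (f \o @cat_pair 0 n)) => //; last by move=> x; exact: f0.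
    by apply: measurableT_comp => //; exact: measurable_cat_pair.
have mg : measurable_fun setT (fun x => \int[lam n]_y f (cat_pair (x, y)))%E.
  apply: (@measurable_tonelli _ _ (T m.+1) (T n) (lam n) (f \o @cat_pair m.+1 n)) => //; last by move=> x; exact: f0.
  by apply: measurableT_comp => //; exact: measurable_cat_pair.
(* On both sides the first coordinate becomes the outermost variable, so that the induction
   hypothesis applies inside. *)
rewrite (tonelli_cons' mg); last by move=> x; exact: integral_ge0.
rewrite (@tonelli_cons' (m + n) f)//; apply: eq_integral => x _.
rewrite IH//; last first.
  apply: measurableT_comp => //.
  rewrite (_ : (fun w : T (m + n) => _) = @cons_pair R (m + n) \o (fun w => (w, x)))//.
  by apply: measurableT_comp; [exact: measurable_cons_pair|exact: measurable_pair2].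
by apply: eq_integral => w _; apply: eq_integral => y _; rewrite -cons_cat_pair.
Qed.

(** Tonelli on indicators. It turns integrals over [lam (m + n)] into integrals over a product
    measure, to which Fubini for integrable functions applies. *)
Lemma lam_cat m n A : measurable A ->
  lam (m + n) A = pushforward (lam m \x lam n)%E (@cat_pair m n) A.
Proof.
move=> mA.
have mI : measurable_fun setT (fun t : T (m + n) => (\1_A t)%:E : \bar R).
  by apply/measurable_EFinP; exact: measurable_indic.
have I0 (t : T (m + n)) : (0 <= (\1_A t)%:E :> \bar R)%E by rewrite lee_fin.
have mc := @measurable_cat_pair m n.
pose P : {measure set (T (m + n)) -> \bar R} :=
  ltac:(refine (pushforward (lam m \x lam n)%E (@cat_pair m n) : measure _ _); exact: mc).
have H (mu : {measure set (T (m + n)) -> \bar R}) :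
    mu A = (\int[mu]_t (\1_A t)%:E)%E.
  by rewrite integral_indic// setIT.
rewrite (H (lam (m + n))) tonelli_cat// -[RHS]/(P A) (H P).
rewrite (ge0_integral_pushforward mc)// preimage_setT.
apply/esym/(@fubini_tonelli1 _ _ (T m) (T n) R (lam m) (lam n)
  ((fun t => (\1_A t)%:E) \o @cat_pair m n)).
- exact: measurableT_comp.
- by move=> p; exact: I0.
Qed.

Definition affine n (a : R) (v : 'I_n -> R) (t : T n) : T n :=
  [tuple (a * tnth t i + v i : mR) | i < n].

Lemma measurable_affine1 (a b : R) : measurable_fun setT (fun x : mR => a * x + b : mR).
Proof.
apply: measurable_funD => //; exact: (mulrl_measurable setT a).
Qed.

Lemma measurable_affine n a (v : 'I_n -> R) : measurable_fun setT (affine a v).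
Proof.
apply/measurable_fun_tnthP => i.
rewrite (_ : _ \o _ = (fun x : mR => a * x + v i : mR) \o (fun t => tnth t i)).
  apply: measurableT_comp; first exact: measurable_affine1.
  exact: measurable_tnth.
by apply/funext => t /=; rewrite tnth_mktuple.
Qed.

Lemma affine_cons n a (v : 'I_n.+1 -> R) (x : mR) (w : T n) :
  affine a v [tuple of x :: w] =
  [tuple of (a * x + v ord0 : mR) :: affine a (fun i => v (lift ord0 i)) w].
Proof.
apply: eq_from_tnth; apply/forall_ord_S; split=> [|i].
  by rewrite !tnth_mktuple !tnth0.
by rewrite tnthS !tnth_mktuple tnthS.
Qed.

Definition push_affine (a b : R) : {measure set mR -> \bar R}.
Proof.
refine (pushforward lambda (fun x : mR => a * x + b : mR) : measure _ _).
exact: measurable_affine1.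
Defined.

(** By uniqueness of Lebesgue measure it suffices to compare the two sides on half-open
    intervals. *)
Lemma lebesgue_affine (a b : R) (a0 : a != 0) A : measurable A ->
  (`|a|%:E * push_affine a b A = lambda A)%E.
Proof.
move=> mA; have pa : 0 < `|a| by rewrite normr_gt0.
pose k : {nonneg R} := NngNum (normr_ge0 a).
apply/esym/(@lebesgue_measure_unique R (mscale k (push_affine a b))) => //= _ [[u w]] _ <-.
rewrite /mscale/= /pushforward.
have [a_gt0|a_lt0] : 0 < a \/ a < 0 by apply/orP; rewrite orbC -neq_lt.
- rewrite (_ : _ @^-1` _ = `](u - b) / a, (w - b) / a]%classic); last first.
    by apply/seteqP; split=> x /=; rewrite !in_itv/=
      ltr_pdivrMr// ler_pdivlMr// ltrBlDr lerBrDr (mulrC x).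
  rewrite !lebesgue_measure_itv/= !lte_fin ltr_pM2r ?invr_gt0// ltrD2r.
  case: ifP => uw; last by rewrite mule0.
  rewrite -!EFinB -EFinM; congr (_%:E); rewrite gtr0_norm//; field.
  by rewrite gt_eqF.
(* For negative a the preimage is half-open at the other end, with the same length. *)
- rewrite (_ : _ @^-1` _ = `[(w - b) / a, (u - b) / a[%classic); last first.
    by apply/seteqP; split=> x /=; rewrite !in_itv/=
      ltr_ndivlMr// ler_ndivrMr// ltrBlDr lerBrDr (mulrC x) andbC.
  rewrite !lebesgue_measure_itv/= !lte_fin ltr_nM2r ?invr_lt0// ltrD2r.
  case: ifP => uw; last by rewrite mule0.
  rewrite -!EFinB -EFinM; congr (_%:E); rewrite ltr0_norm//; field.
  by rewrite lt_eqF.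
Qed.

Lemma ge0_integral_affine1 (a b : R) (f : mR -> \bar R) : a != 0 ->
  measurable_fun setT f -> (forall x, 0 <= f x)%E ->
  (\int[lambda]_x f x = `|a|%:E * \int[lambda]_x f (a * x + b)%R)%E.
Proof.
move=> a0 mf f0; have mphi := measurable_affine1 a b.
pose k : {nonneg R} := NngNum (normr_ge0 a).
rewrite (eq_measure_integral (mscale k (push_affine a b))); last first.
  by move=> A mA _; exact/esym/(@lebesgue_affine a b a0 A mA).
rewrite ge0_integral_mscale//; congr (_ * _)%E.
by rewrite (ge0_integral_pushforward mphi)// preimage_setT.
Qed.

Lemma ge0_integral_affine n (a : R) (v : 'I_n -> R) (f : T n -> \bar R) : a != 0 ->
  measurable_fun setT f -> (forall t, 0 <= f t)%E ->
  (\int[lam n]_t f t = (`|a| ^+ n)%:E * \int[lam n]_t f (affine a v t))%E.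
Proof.
move=> a0; elim: n v f => [|n IH] v f mf f0.
  rewrite expr0 mul1e; apply: eq_integral => t _; congr (f _).
  by rewrite [t]tuple0 [RHS]tuple0.
have maff := measurable_affine a v.
rewrite (tonelli_cons mf f0) (@tonelli_cons n (f \o affine a v)); last 2 first.
- exact: measurableT_comp.
- by move=> t; exact: f0.
pose g (w : T n) := (\int[lambda]_x f [tuple of x :: w])%E.
have mg : measurable_fun setT g.
  apply: (@measurable_tonelli _ _ (T n) mR lambda (f \o @cons_pair R n)) => //; last by move=> x; exact: f0.
  by apply: measurableT_comp => //; exact: measurable_cons_pair.
have g0 w : (0 <= g w)%E by exact: integral_ge0.
rewrite -/g -[in LHS]/(\int[lam n]_w g w)%E (IH (fun i => v (lift ord0 i)) g)//.
rewrite exprS mulrC EFinM -muleA; congr (_ * _)%E.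
rewrite -ge0_integralZl_EFin//; last 2 first.
- by move=> w _; apply: integral_ge0 => x _; exact: f0.
- apply: (@measurable_tonelli _ _ (T n) mR lambda (f \o affine a v \o @cons_pair R n)) => //; last by move=> x; exact: f0.
  apply: measurableT_comp; last exact: measurable_cons_pair.
  exact: measurableT_comp.
apply: eq_integral => w _; rewrite /g (@ge0_integral_affine1 a (v ord0))//.
  by congr (_ * _)%E; apply: eq_integral => x _ /=; rewrite affine_cons.
apply: measurableT_comp => //.
rewrite (_ : (fun x : mR => _) = @cons_pair R n \o
  (fun x => (affine a (fun i => v (lift ord0 i)) w, x)))//.
by apply: measurableT_comp; [exact: measurable_cons_pair|exact: measurable_pair1].
Qed.

End LebesgueTuple.
Arguments lam {R} n.

(** * Integrals of functions dominated by an integrable weight *)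

Section RealIntegrals.
Context {R : realType}.
Local Notation mR := (measurableTypeR R).
Local Notation T n := (n.-tuple mR).
Local Notation lambda := (@lebesgue_measure R).
Local Notation E n := 'rV[R]_n.

Definition measR n (h : E n -> R) : Prop :=
  measurable_fun setT (fun t : T n => h (tuple_vec t)).

Lemma tuple_vec_cat m n (x : T m) (y : T n) :
  tuple_vec (cat_pair (x, y)) = row_mx (tuple_vec x) (tuple_vec y) :> E (m + n).
Proof.
apply/rowP => i; rewrite !mxE; case: split_ordP => j ->.
  by rewrite tnth_cat_l mxE.
by rewrite tnth_cat_r mxE.
Qed.

Lemma tuple_vec_affine n (a : R) (v : E n) (t : T n) :
  tuple_vec (affine a (fun i => v 0 i) t) = a *: tuple_vec t + v.
Proof. by apply/rowP => i; rewrite !mxE tnth_mktuple. Qed.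

Lemma tuple_vecK n (x : E n) : exists t : T n, tuple_vec t = x.
Proof.
by exists [tuple x 0 i : mR | i < n]; apply/rowP => i; rewrite !mxE tnth_mktuple.
Qed.

(** The sigma-algebra on tuples is generated by coordinates, while open sets come from the sup norm
    on row vectors. An open set is the union of the rational boxes inside it, and these are
    countably many. *)
Lemma measurable_open_rV n (V : set (E n)) : open V ->
  measurable [set t : T n | V (tuple_vec t)].
Proof.
move=> oV.
have flip (u r k : R) : u - k < r < u + k -> r - k < u < r + k.
  by move=> /andP[H1 H2]; apply/andP; split; lra.
have close (u w r k e : R) : k + k < e -> r - k < u < r + k -> r - k < w < r + k ->
    `|u - w| < e.
  by move=> ke /andP[h1 h2] /andP[h3 h4]; rewrite ltr_norml; apply/andP; split; lra.
pose B (q : n.-tuple rat * nat) := [set t : T n | forall i,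
  `](ratr (tnth q.1 i) - q.2.+1%:R^-1), (ratr (tnth q.1 i) + q.2.+1%:R^-1)[%classic (tnth t i)].
(* Boxes not contained in V are replaced by the empty set, so that the union runs over a fixed
   countable type. *)
pose F q := if pselect (B q `<=` [set t | V (tuple_vec t)]) then B q else set0.
rewrite [X in measurable X](_ : _ = \bigcup_q F q); last first.
  apply/seteqP; split=> [t /= Vt|t [q _]]; last first.
    by rewrite /F; case: pselect => // H /H.
  have /nbhs_ballP[e /= e0 He] : nbhs (tuple_vec t) V by exact: open_nbhs_nbhs.
  have [k Hk] : exists k : nat, k.+1%:R^-1 + k.+1%:R^-1 < e.
    exists (Num.bound (2 / e)).
    have := archi_boundP (divr_ge0 (ler0n R 2) (ltW e0)); set N := Num.bound _ => HN.
    rewrite -mulr2n -[X in X < _]mulr_natl -ltr_pdivlMr ?ltr0n//.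
    by rewrite invrK mulrC -ltr_pdivrMr// (lt_trans HN)// ltr_nat.
  have /choice[q Hq] : forall i, exists q : rat,
      ratr q \in `](tnth t i - k.+1%:R^-1), (tnth t i + k.+1%:R^-1)[.
    by move=> i; apply: rat_in_itvoo; rewrite ltrD2l gtrN// invr_gt0.
  have Bt : B ([tuple q i | i < n], k) t.
    move=> i /=; have := Hq i; rewrite tnth_mktuple !in_itv/=.
    exact: flip.
  exists ([tuple q i | i < n], k) => //; rewrite /F; case: pselect => // H.
  exfalso; apply: H => t' Bt'; apply: He; split => // i j; rewrite !mxE.
  have := Bt j; have := Bt' j; rewrite /= !in_itv/= => H1 H2.
  exact: (close _ _ _ _ _ Hk H2 H1).
apply: countable_bigcupT_measurable => [|q]; first exact: countableP.
rewrite /F; case: pselect => [H|H]; last exact: measurable0.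
apply: (@measurable_tuple_box R n (fun i => `](ratr (tnth q.1 i) - q.2.+1%:R^-1),
  (ratr (tnth q.1 i) + q.2.+1%:R^-1)[%classic)) => i.
exact: measurable_itv.
Qed.

Lemma cont_measR n (h : E n -> R) : continuous h -> measR h.
Proof.
move=> ch; rewrite /measR.
apply: (measurability _ (RGenOInfty.measurableE R)) => // _ [_ [x ->] <-].
rewrite setTI.
rewrite (_ : _ @^-1` _ = [set t : T n | (h @^-1` [set y | x < y]) (tuple_vec t)]).
  by apply: measurable_open_rV; exact: (open_comp (fun y _ => ch y) (@open_gt R x)).
by apply/seteqP; split => t /=; rewrite in_itv/= andbT.
Qed.

(** The reference weight. As a product over the coordinates it factors over blocks, so a bound by
    [K * pw] on a product space gives bounds of the same kind on all sections. *)
Definition pw n (x : E n) : R := \prod_(i < n) (1 + x 0 i ^+ 2)^-1.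

Lemma one_sqr_gt0 (a : R) : 0 < 1 + a ^+ 2.
Proof. by rewrite ltr_pwDl// sqr_ge0. Qed.

Lemma pw_gt0 n (x : E n) : 0 < pw x.
Proof. by apply: prodr_gt0 => i _; rewrite invr_gt0 one_sqr_gt0. Qed.

Lemma pw_ge0 n (x : E n) : 0 <= pw x.
Proof. exact/ltW/pw_gt0. Qed.

Lemma pw_le1 n (x : E n) : pw x <= 1.
Proof.
apply: prodr_ile1 => i; rewrite invr_ge0 ltW ?one_sqr_gt0//=.
by rewrite invf_le1 ?one_sqr_gt0// lerDl sqr_ge0.
Qed.

Lemma pw_row m n (x : E m) (y : E n) : pw (row_mx x y) = pw x * pw y.
Proof.
rewrite /pw big_split_ord/=; congr (_ * _); apply: eq_bigr => i _.
  by rewrite row_mxEl.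
by rewrite row_mxEr.
Qed.

Lemma pw_cons n (x : mR) (w : T n) :
  pw (tuple_vec [tuple of x :: w]) = (1 + x ^+ 2)^-1 * pw (tuple_vec w).
Proof.
rewrite /pw big_ord_recl mxE tnth0; congr (_ * _).
by apply: eq_bigr => i _; rewrite !mxE tnthS.
Qed.

Lemma measR_pw n : measR (@pw n).
Proof.
rewrite /measR (_ : (fun t => _) =
  fun t : T n => \prod_(i < n) (fun i (t : T n) => (1 + tnth t i ^+ 2)^-1) i t).
  apply: measurable_prod => i _.
  apply: (measurableT_comp (f := fun x : mR => (1 + x ^+ 2)^-1) _ (measurable_tnth i)).
  exact: (continuous_measurable_fun (@continuous_oneDsqrV R)).
by apply/funext => t; apply: eq_bigr => i _; rewrite mxE.
Qed.

Lemma pw_integral_lty n : (\int[lam n]_t (pw (tuple_vec t))%:E < +oo)%E.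
Proof.
have mo : measurable_fun setT (fun x : mR => ((1 + x ^+ 2)^-1)%:E : \bar R).
  by apply/measurable_EFinP; exact: (continuous_measurable_fun (@continuous_oneDsqrV R)).
have o0 (x : mR) : (0 <= ((1 + x ^+ 2)^-1)%:E :> \bar R)%E.
  by rewrite lee_fin invr_ge0 ltW// one_sqr_gt0.
have I1 : (\int[lambda]_x ((1 + x ^+ 2)^-1)%:E < +oo :> \bar R)%E.
  rewrite (@ge0_symfun_integralT R (fun x => (1 + x ^+ 2)^-1)).
  - have := integral0y_oneDsqr R; rewrite /oneDsqr -set_itvcy => ->.
    by rewrite -EFinM ltry.
  - by move=> x; rewrite invr_ge0 ltW// one_sqr_gt0.
  - exact: continuous_oneDsqrV.
  - by move=> x /=; rewrite sqrrN.
elim: n => [|n IH].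
  rewrite -[lam 0]/(dirac [tuple]) integral_dirac//=; last first.
    by apply/measurable_EFinP; exact: measR_pw.
  by rewrite diracT mul1e ltry.
rewrite tonelli_cons; last 2 first.
- by apply/measurable_EFinP; exact: measR_pw.
- by move=> t; rewrite lee_fin pw_ge0.
under eq_integral => w _.
  under eq_integral do rewrite pw_cons EFinM.
  rewrite ge0_integralZr ?lee_fin ?pw_ge0//.
  over.
rewrite ge0_integralZl//.
- by rewrite lte_mul_pinfty// ?ge0_fin_numE// integral_ge0// => w _; rewrite lee_fin pw_ge0.
- by apply/measurable_EFinP; exact: measR_pw.
- by move=> w _; rewrite lee_fin pw_ge0.
- exact: integral_ge0.
Qed.

Lemma integrable_pw n : (lam n).-integrable setT (fun t => (pw (tuple_vec t))%:E).
Proof.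
apply/integrableP; split; first by apply/measurable_EFinP; exact: measR_pw.
under eq_integral do rewrite gee0_abs ?lee_fin ?pw_ge0//.
exact: pw_integral_lty.
Qed.

Definition ir n (h : E n -> R) : R := \int[lam n]_t h (tuple_vec t).

Definition pb n (K : R) (h : E n -> R) : Prop :=
  measR h /\ forall x, `|h x| <= K * pw x.

Definition pwI n : R := ir (@pw n).

Lemma pwI_ge0 n : 0 <= pwI n.
Proof. by apply: Rintegral_ge0 => t _; exact: pw_ge0. Qed.

Lemma pb_ge0 n K (h : E n -> R) : pb K h -> 0 <= K.
Proof.
move=> [_ /(_ 0) H]; rewrite -(pmulr_lge0 _ (pw_gt0 (0 : E n))).
exact: le_trans H.
Qed.

Lemma pb_integrable n K (h : E n -> R) : pb K h ->
  (lam n).-integrable setT (fun t => (h (tuple_vec t))%:E).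
Proof.
move=> [mh hK]; apply: (@le_integrable _ _ _ (lam n) _ measurableT _
  (fun t => (K * pw (tuple_vec t))%:E)).
- by apply/measurable_EFinP.
- move=> t _; rewrite !abse_EFin lee_fin (le_trans (hK _))// ler_norm//.
- under eq_fun do rewrite EFinM; apply: integrableZl => //; exact: integrable_pw.
Qed.

Lemma ir_le n K (h : E n -> R) : pb K h -> `|ir h| <= K * pwI n.
Proof.
move=> ph; rewrite (le_trans (le_normr_Rintegral _ (pb_integrable ph)))//.
rewrite -RintegralZl//; last exact: integrable_pw.
apply: le_Rintegral => //.
- apply: (@pb_integrable n K (fun x => `|h x|)); case: ph => mh hK; split.
    exact: measurableT_comp.
  by move=> x; rewrite normr_id.
- rewrite (_ : EFin \o _ = fun t => (K%:E * (pw (tuple_vec t))%:E)%E).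
    by apply: integrableZl => //; exact: integrable_pw.
  by apply/funext => t /=; rewrite EFinM.
- by move=> t _; case: ph.
Qed.

Lemma irD n K K' (h h' : E n -> R) : pb K h -> pb K' h' ->
  ir (fun x => h x + h' x) = ir h + ir h'.
Proof. by move=> p p'; apply: RintegralD => //; [exact: pb_integrable p|exact: pb_integrable p']. Qed.

Lemma irZ n K (c : R) (h : E n -> R) : pb K h -> ir (fun x => c * h x) = c * ir h.
Proof. by move=> p; apply: RintegralZl => //; exact: pb_integrable p. Qed.

Lemma pbD n K K' (h h' : E n -> R) : pb K h -> pb K' h' ->
  pb (K + K') (fun x => h x + h' x).
Proof.
move=> [m b] [m' b']; split; first exact: measurable_funD.
by move=> x; rewrite mulrDl (le_trans (ler_normD _ _))// lerD.
Qed.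

Lemma pbZ n K (c : R) (h : E n -> R) : pb K h -> pb (`|c| * K) (fun x => c * h x).
Proof.
move=> [m b]; split; first exact: measurable_funM.
by move=> x; rewrite normrM -mulrA ler_wpM2l.
Qed.

Lemma ir_cvg n K (h : nat -> E n -> R) (h0 : E n -> R) :
  (forall k, pb K (h k)) -> (forall x, h k x @[k --> \oo] --> h0 x) ->
  pb K h0 /\ ir (h k) @[k --> \oo] --> ir h0.
Proof.
move=> pk hc.
have p0 : pb K h0.
  split.
    apply: (@measurable_fun_cvg _ _ _ setT (fun k t => h k (tuple_vec t))) => //.
    - by move=> k; case: (pk k).
  move=> x; have H : `|h k x| @[k --> \oo] --> `|h0 x| by apply: cvg_norm; exact: hc.
  rewrite -(cvg_lim _ H)//; apply: limr_le; first by apply/cvg_ex; exists `|h0 x|.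
  by near=> k; case: (pk k).
split => //.
have a1 : {ae lam n, forall t, setT t ->
    (h k (tuple_vec t))%:E @[k --> \oo] --> (h0 (tuple_vec t))%:E}.
  by apply: aeW => t _; apply: cvg_EFin; [exact: nearW|exact: hc].
have a2 : {ae lam n, forall t k, setT t ->
    (`|(h k (tuple_vec t))%:E| <= (K * pw (tuple_vec t))%:E)%E}.
  by apply: aeW => t k _; rewrite abse_EFin lee_fin; case: (pk k).
have a3 : (lam n).-integrable setT (fun t => (K * pw (tuple_vec t))%:E).
  rewrite (_ : (fun t => _) = fun t => (K%:E * (pw (tuple_vec t))%:E)%E).
    by apply: integrableZl => //; exact: integrable_pw.
  by apply/funext => t /=; rewrite EFinM.
have [_ _ H] := @dominated_convergence _ _ _ (lam n) setT measurableT
  (fun k t => (h k (tuple_vec t))%:E) (fun t => (h0 (tuple_vec t))%:E)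
  (fun t => (K * pw (tuple_vec t))%:E)
  (fun k => measurable_int _ (pb_integrable (pk k)))
  (measurable_int _ (pb_integrable p0)) a1 a3 a2.
apply: fine_cvg; rewrite fineK; first exact: H.
by apply: integrable_fin_num => //; exact: pb_integrable p0.
Unshelve. all: by end_near. Qed.

Lemma measR_row m n (H : E (m + n) -> R) x : measR H -> measR (fun y : E n => H (row_mx x y)).
Proof.
move=> mH; have [t <-] := tuple_vecK x.
rewrite /measR; under eq_fun do rewrite -tuple_vec_cat.
apply: (measurableT_comp (f := (fun t => H (tuple_vec t)) \o @cat_pair R m n) (g := fun y => (t, y))).
  by apply: measurableT_comp => //; exact: measurable_cat_pair.
exact: measurable_pair1.
Qed.

Lemma measR_col m n (H : E (m + n) -> R) y : measR H -> measR (fun x : E m => H (row_mx x y)).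
Proof.
move=> mH; have [t <-] := tuple_vecK y.
rewrite /measR; under eq_fun do rewrite -tuple_vec_cat.
apply: (measurableT_comp (f := (fun t => H (tuple_vec t)) \o @cat_pair R m n) (g := fun x => (x, t))).
  by apply: measurableT_comp => //; exact: measurable_cat_pair.
exact: measurable_pair2.
Qed.

Lemma pb_row m n K (H : E (m + n) -> R) x : pb K H -> pb (K * pw x) (fun y : E n => H (row_mx x y)).
Proof.
move=> [mH bH]; split; first exact: measR_row.
by move=> y; rewrite -mulrA -pw_row.
Qed.

Lemma pb_col m n K (H : E (m + n) -> R) y : pb K H -> pb (K * pw y) (fun x : E m => H (row_mx x y)).
Proof.
move=> [mH bH]; split; first exact: measR_col.
by move=> x; rewrite -mulrA [pw y * _]mulrC -pw_row.
Qed.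

Lemma fubini_pb m n K (H : E (m + n) -> R) : pb K H ->
  [/\ pb (K * pwI n) (fun x => ir (fun y => H (row_mx x y))),
      pb (K * pwI m) (fun y => ir (fun x => H (row_mx x y))),
      ir H = ir (fun x => ir (fun y => H (row_mx x y))) &
      ir H = ir (fun y => ir (fun x => H (row_mx x y)))].
Proof.
move=> pH.
pose f (p : T m * T n) := (H (tuple_vec (cat_pair p)))%:E.
have iH := pb_integrable pH.
have mc := @measurable_cat_pair R m n.
have EI (g : T (m + n) -> \bar R) : (\int[lam (m + n)]_t g t =
    \int[pushforward (lam m \x lam n) (@cat_pair R m n)]_t g t)%E.
  by apply: eq_measure_integral => A mA _; exact: lam_cat.
have if_ : (lam m \x lam n)%E.-integrable setT f.
  apply/integrableP; split.
    apply/measurable_EFinP; apply: (measurableT_comp (f := fun t => H (tuple_vec t))) => //.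
    by case: pH.
  move/integrableP : iH => [mm]; rewrite EI ge0_integral_pushforward//.
  exact: measurableT_comp.
have EH : (\int[lam (m + n)]_t (H (tuple_vec t))%:E = \int[lam m \x lam n]_p f p)%E.
  rewrite EI integral_pushforward//.
  by apply/measurable_EFinP; case: pH.
have Fx x : (\int[lam n]_y f (x, y) = (ir (fun y => H (row_mx (tuple_vec x) y)))%:E)%E.
  rewrite /ir /Rintegral fineK.
    by apply: eq_integral => y _; rewrite /f tuple_vec_cat.
  apply: integrable_fin_num => //.
  exact: (pb_integrable (pb_row (tuple_vec x) pH)).
have Gy y : (\int[lam m]_x f (x, y) = (ir (fun x => H (row_mx x (tuple_vec y))))%:E)%E.
  rewrite /ir /Rintegral fineK.
    by apply: eq_integral => x _; rewrite /f tuple_vec_cat.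
  apply: integrable_fin_num => //.
  exact: (pb_integrable (pb_col (tuple_vec y) pH)).
split.
- split.
    apply/measurable_EFinP; have := measurable_fubini_F if_.
    by congr (measurable_fun _ _); apply/funext => x; rewrite /fubini_F Fx.
  move=> x; rewrite mulrAC; apply: ir_le.
  exact: pb_row.
- split.
    apply/measurable_EFinP; have := measurable_fubini_G if_.
    by congr (measurable_fun _ _); apply/funext => x; rewrite /fubini_G Gy.
  move=> y; rewrite mulrAC; apply: ir_le.
  exact: pb_col.
- rewrite {1}/ir {1}/Rintegral EH -integral12_prod_meas1//.
  by rewrite /fubini_F; congr fine; apply: eq_integral => x _; rewrite Fx.
- rewrite {1}/ir {1}/Rintegral EH -integral21_prod_meas1//.
  by rewrite /fubini_G; congr fine; apply: eq_integral => x _; rewrite Gy.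
Qed.

Lemma ir_affine n K (h : E n -> R) (a : R) (v : E n) : a != 0 -> pb K h ->
  ir h = `|a| ^+ n * ir (fun x => h (a *: x + v)).
Proof.
move=> a0 ph; have ma := @measurable_affine R n a (fun i => v 0 i).
have [mh _] := ph.
have mE : measurable_fun setT (fun t : T n => (h (tuple_vec t))%:E) by exact/measurable_EFinP.
rewrite /ir /Rintegral.
have a_pos : 0 < `|a| ^+ n by rewrite exprn_gt0 ?normr_gt0.
have step (g : T n -> \bar R) : measurable_fun setT g -> (forall t, 0 <= g t)%E ->
   (\int[lam n]_t g (affine a (fun i => v 0%R i) t) = ((`|a| ^+ n)^-1)%:E * \int[lam n]_t g t)%E.
  move=> mg g0; rewrite [in RHS](@ge0_integral_affine R n a (fun i => v 0 i))//.
  by rewrite muleA -EFinM mulVf ?mul1e// gt_eqF.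
have E1 : (\int[lam n]_t (h (a *: tuple_vec t + v))%:E =
    ((`|a| ^+ n)^-1)%:E * \int[lam n]_t (h (tuple_vec t))%:E)%E.
  under eq_integral do rewrite -tuple_vec_affine.
  pose g (t : T n) : \bar R := (h (tuple_vec t))%:E.
  rewrite -[LHS]/(\int[lam n]_t (g \o affine a (fun i => v 0%R i)) t)%E.
  rewrite -[X in (_ * X)%E]/(\int[lam n]_t g t)%E.
  rewrite integralE [in RHS]integralE funepos_comp funeneg_comp.
  rewrite !step//; [|exact: measurable_funeneg|exact: measurable_funepos].
  have fp := integrable_pos_fin_num measurableT (pb_integrable ph).
  by apply/esym; apply: muleBr => //; exact: (fin_num_adde_defr _ fp).
rewrite E1 fineM//=; last by apply: integrable_fin_num => //; exact: pb_integrable ph.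
by rewrite mulrA mulfV ?mul1r// gt_eqF.
Qed.

End RealIntegrals.

Section ContinuousReal.
Context {R : realType} {n : nat}.
Implicit Types f g : 'rV[R]_n -> R.

Lemma contRD f g : continuous f -> continuous g -> continuous (fun x => f x + g x).
Proof. by move=> cf cg x; exact: (cvgD (cf x) (cg x)). Qed.

Lemma contRM f g : continuous f -> continuous g -> continuous (fun x => f x * g x).
Proof. by move=> cf cg x; exact: (cvgM (cf x) (cg x)). Qed.

Lemma contR_cst (c : R) : continuous (fun _ : 'rV[R]_n => c).
Proof. by move=> x; exact: cst_continuous. Qed.

Lemma contRZ (c : R) f : continuous f -> continuous (fun x => c * f x).
Proof. by apply: contRM; exact: contR_cst. Qed.

Lemma contR_sum (I : Type) (r : seq I) (F : I -> 'rV[R]_n -> R) :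
  (forall i, continuous (F i)) -> continuous (fun x => \sum_(i <- r) F i x).
Proof.
move=> cF; elim: r => [|i r IH].
  by under eq_fun do rewrite big_nil; exact: contR_cst.
by under eq_fun do rewrite big_cons; exact: contRD.
Qed.

End ContinuousReal.

(** * Complex integrals and differentiation under the integral sign *)

Section ComplexIntegrals.
Context {R : realType}.
Local Notation C := R[i].
Local Notation E n := 'rV[R]_n.
Local Notation T n := (n.-tuple (measurableTypeR R)).

Definition measC n (f : E n -> C) : Prop := measR (re_part f) /\ measR (im_part f).

Definition cpb n (K : R) (f : E n -> C) : Prop :=
  measC f /\ forall x, cabs (f x) <= K * pw x.

Lemma cont_measC n (f : E n -> C) : cont f -> measC f.
Proof. by move=> [c1 c2]; split; exact: cont_measR. Qed.

Lemma measCM n (f g : E n -> C) : measC f -> measC g -> measC (fun x => f x * g x).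
Proof.
move=> [f1 f2] [g1 g2]; split.
- rewrite (_ : re_part _ = fun x => re_part f x * re_part g x - im_part f x * im_part g x).
    exact: measurable_funB (measurable_funM f1 g1) (measurable_funM f2 g2).
  by apply/funext => x; rewrite /re_part Re_mulc.
- rewrite (_ : im_part _ = fun x => re_part f x * im_part g x + im_part f x * re_part g x).
    exact: measurable_funD (measurable_funM f1 g2) (measurable_funM f2 g1).
  by apply/funext => x; rewrite /im_part Im_mulc.
Qed.

Lemma measC_row m n (F : E (m + n) -> C) x : measC F -> measC (fun y : E n => F (row_mx x y)).
Proof. by move=> [m1 m2]; split; [exact: measR_row m1|exact: measR_row m2]. Qed.

Lemma measC_col m n (F : E (m + n) -> C) y : measC F -> measC (fun x : E m => F (row_mx x y)).
Proof. by move=> [m1 m2]; split; [exact: measR_col m1|exact: measR_col m2]. Qed.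

Lemma cpb_re n K (f : E n -> C) : cpb K f -> pb K (re_part f).
Proof. by move=> [[m1 m2] b]; split => // x; rewrite (le_trans (norm_Re_le _)). Qed.

Lemma cpb_im n K (f : E n -> C) : cpb K f -> pb K (im_part f).
Proof. by move=> [[m1 m2] b]; split => // x; rewrite (le_trans (norm_Im_le _)). Qed.

Lemma cpb_ge0 n K (f : E n -> C) : cpb K f -> 0 <= K.
Proof. by move=> /cpb_re/pb_ge0. Qed.

Lemma integralCE n (f : E n -> C) : integralC f = ir (re_part f) +i* ir (im_part f).
Proof. by []. Qed.

Lemma cpb_integrableC n K (f : E n -> C) : cpb K f -> integrableC f.
Proof.
by move=> p; split; [exact: pb_integrable (cpb_re p)|exact: pb_integrable (cpb_im p)].
Qed.

(* The factor [2] comes from bounding the real and imaginary parts separately. *)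
Lemma integralC_le n K (f : E n -> C) : cpb K f ->
  cabs (integralC f) <= 2 * K * pwI n.
Proof.
move=> p; rewrite (le_trans (cabs_le _))// -mulrA mulr2n mulrDl mul1r lerD//.
  exact: (ir_le (cpb_re p)).
exact: (ir_le (cpb_im p)).
Qed.

Lemma cpbZ n K (c : C) (f : E n -> C) : cpb K f -> cpb (cabs c * K) (fun x => c * f x).
Proof.
move=> [m b]; split; first by apply: measCM => //; exact: cont_measC (cont_cst _).
by move=> x; rewrite cabsM -mulrA ler_wpM2l ?cabs_ge0.
Qed.

Lemma integralCD n K K' (f g : E n -> C) : cpb K f -> cpb K' g ->
  integralC (fun x => f x + g x) = integralC f + integralC g.
Proof.
move=> p p'; rewrite !integralCE; apply/eqP; rewrite eq_complex/=; apply/andP; split.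
- rewrite -(irD (cpb_re p) (cpb_re p')); apply/eqP; congr ir.
  by apply/funext => x; rewrite /re_part Re_addc.
- rewrite -(irD (cpb_im p) (cpb_im p')); apply/eqP; congr ir.
  by apply/funext => x; rewrite /im_part Im_addc.
Qed.

Lemma integralCZ n K (c : C) (f : E n -> C) : cpb K f ->
  integralC (fun x => c * f x) = c * integralC f.
Proof.
move=> p; case: c => a b.
have [pr pi] := (cpb_re p, cpb_im p).
rewrite !integralCE; apply: complex_eq => /=.
- rewrite -mulNr -(irZ a pr) -(irZ (- b) pi) -(irD (pbZ a pr) (pbZ (- b) pi)).
  by congr ir; apply/funext => x; rewrite /re_part Re_mulc/= mulNr.
- rewrite -(irZ a pi) -(irZ b pr) -(irD (pbZ a pi) (pbZ b pr)).
  by congr ir; apply/funext => x; rewrite /im_part Im_mulc.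
Qed.

Lemma fubiniC m n K (F : E (m + n) -> C) : cpb K F ->
  [/\ cpb (2 * K * pwI n) (fun x => integralC (fun y => F (row_mx x y))),
      cpb (2 * K * pwI m) (fun y => integralC (fun x => F (row_mx x y))),
      integralC F = integralC (fun x => integralC (fun y => F (row_mx x y))) &
      integralC F = integralC (fun y => integralC (fun x => F (row_mx x y)))].
Proof.
move=> pF; have [pr pi] := (cpb_re pF, cpb_im pF).
have [r1 r2 r3 r4] := fubini_pb pr.
have [i1 i2 i3 i4] := fubini_pb pi.
have row x : cpb (K * pw x) (fun y : E n => F (row_mx x y)).
  case: pF => mF bF; split; first exact: measC_row.
  by move=> y; rewrite -mulrA -pw_row.
have col y : cpb (K * pw y) (fun x : E m => F (row_mx x y)).
  case: pF => mF bF; split; first exact: measC_col.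
  by move=> x; rewrite -mulrA [pw y * _]mulrC -pw_row.
split.
- split; first by split; [case: r1|case: i1].
  by move=> x; rewrite (le_trans (integralC_le (row x)))// le_eqVlt; apply/orP; left; apply/eqP; ring.
- split; first by split; [case: r2|case: i2].
  by move=> y; rewrite (le_trans (integralC_le (col y)))// le_eqVlt; apply/orP; left; apply/eqP; ring.
- by rewrite !integralCE r3 i3.
- by rewrite !integralCE r4 i4.
Qed.

Lemma integralC_affine n K (f : E n -> C) (a : R) (v : E n) : a != 0 -> cpb K f ->
  integralC f = (`|a| ^+ n)%:C * integralC (fun x => f (a *: x + v)).
Proof.
move=> a0 p; rewrite !integralCE; apply: complex_eq => /=; rewrite mul0r ?subr0 ?addr0.
- exact: (ir_affine v a0 (cpb_re p)).
- exact: (ir_affine v a0 (cpb_im p)).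
Qed.

Lemma integralC_cvg n K (h : nat -> E n -> C) (h0 : E n -> C) :
  (forall k, cpb K (h k)) ->
  (forall x, re_part (h k) x @[k --> \oo] --> re_part h0 x) ->
  (forall x, im_part (h k) x @[k --> \oo] --> im_part h0 x) ->
  complex.Re (integralC (h k)) @[k --> \oo] --> complex.Re (integralC h0) /\
  complex.Im (integralC (h k)) @[k --> \oo] --> complex.Im (integralC h0).
Proof.
move=> p hr hi; split.
- exact: (ir_cvg (fun k => cpb_re (p k)) hr).2.
- exact: (ir_cvg (fun k => cpb_im (p k)) hi).2.
Qed.

(* Telescoping along the coordinate axes. *)
Lemma lipschitz_of_partial n (F : E n -> R) (dF : 'I_n -> E n -> R) (M : R) (x y : E n) :
  (forall i (z : E n), is_derive z (unit_vec i) F (dF i z)) ->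
  (forall i (z : E n), (forall j, `|z 0 j - x 0 j| <= `|y 0 j - x 0 j|) -> `|dF i z| <= M) ->
  `|F y - F x| <= M * \sum_(i < n) `|y 0 i - x 0 i|.
Proof.
move=> HF HM.
pose z (k : nat) : E n := \row_i (if (i < k)%N then y 0 i else x 0 i).
have z0 : z 0%N = x by apply/rowP => i; rewrite mxE ltn0.
have zn : z n = y by apply/rowP => i; rewrite mxE ltn_ord.
have zS (i : 'I_n) : z i.+1 = (y 0 i - x 0 i) *: unit_vec i + z i.
  apply/rowP => j; rewrite !mxE eqxx/= ltnS leq_eqVlt -(inj_eq val_inj)/=.
  case: ltngtP => //= ji; rewrite ?mulr0 ?add0r//.
  by rewrite (val_inj ji : j = i) mulr1 subrK.
have step (i : 'I_n) : `|F (z i.+1) - F (z i)| <= M * `|y 0 i - x 0 i|.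
  rewrite zS; have [th tht ->] := mvt_line (HF i) (z i) (y 0 i - x 0 i).
  rewrite normrM mulrC ler_wpM2r//; apply: HM => j.
  rewrite !mxE eqxx/=; case: ltngtP => /= ji.
  - by rewrite -(inj_eq val_inj)/= (ltn_eqF ji) mulr0 add0r.
  - by rewrite -(inj_eq val_inj)/= (gtn_eqF ji) mulr0 add0r subrr normr0.
  - by rewrite (val_inj ji : j = i) eqxx mulr1 addrK.
have E1 : F y - F x = \sum_(i < n) (F (z i.+1) - F (z i)).
  rewrite -{1}zn -z0 -(big_mkord xpredT (fun i => F (z i.+1) - F (z i))).
  by rewrite telescope_sumr.
rewrite E1 mulr_sumr (le_trans (ler_norm_sum _ _ _))//.
by apply: ler_sum => i _; exact: step.
Qed.

Lemma continuous_of_lipschitz n (F : E n -> R) : (forall x : E n, exists2 M : R, 0 <= M &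
    forall y : E n, (forall i, `|y 0 i - x 0 i| <= 1) ->
      `|F y - F x| <= M * \sum_(i < n) `|y 0 i - x 0 i|) ->
  continuous F.
Proof.
move=> H x P /nbhs_ballP[e /= e0 eP]; have [M M0 HM] := H x.
pose r : R := Num.min 1 (e / (M * n%:R + 1)).
have Mn : 0 < M * n%:R + 1 by rewrite ltr_wpDl// mulr_ge0.
have r0 : 0 < r by rewrite lt_min ltr01 divr_gt0.
apply: (@filterS _ (nbhs x) (nbhs_filter x) (ball (x : E n) r)); last first.
  exact: nbhsx_ballx.
move=> y [_ xy]; apply: eP; rewrite -ball_normE/=.
have yi i : `|y 0 i - x 0 i| < r by rewrite distrC; exact: xy.
rewrite distrC (le_lt_trans (HM y _))//.
  by move=> i; rewrite (le_trans (ltW (yi i)))// ge_min lexx.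
apply: (@le_lt_trans _ _ (M * (n%:R * r))).
  rewrite ler_wpM2l// (_ : n%:R * r = \sum_(i < n) r).
    by apply: ler_sum => i _; exact: ltW.
  by rewrite sumr_const card_ord mulr_natl.
rewrite mulrA (@lt_le_trans _ _ ((M * n%:R + 1) * r))//.
  by rewrite mulrDl mul1r ltrDl.
by rewrite mulrC -ler_pdivlMr// ge_min lexx orbT.
Qed.

(** Only the parameter z of the line z v + y varies, over ]-1, 1[, so the one-variable theorem
    applies with [K * pw] as dominating function. *)
Lemma ir_is_derive n m (h dh : E n -> E m -> R) (v y : E n) (K : R) :
  (forall z : R, -1 < z < 1 -> pb K (h (z *: v + y))) ->
  (forall (z : E n) xi, is_derive z v (h^~ xi) (dh z xi)) ->
  (forall (z : R) xi, -1 < z < 1 -> `|dh (z *: v + y) xi| <= K * pw xi) ->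
  is_derive y v (fun y => ir (h y)) (ir (dh y)).
Proof.
move=> H1 H2 H3.
pose f (z : R) (t : T m) : R := h (z *: v + y) (tuple_vec t).
have df z t : is_derive (z : R) (1 : R) (f^~ t) (dh (z *: v + y) (tuple_vec t)).
  apply: (is_derive_line (F := h^~ (tuple_vec t)) (x := z *: v + y) (v := v)) => //.
  by move=> r; rewrite /f [r *: 1]mulr1 scalerDl addrA.
have d1f z t : partial1of2 f z t = dh (z *: v + y) (tuple_vec t).
  by rewrite partial1of2E derive_val.
have I0 : (`]-1, 1[%classic : set R) 0 by rewrite /= in_itv/= ltrN10 ltr01.
have intf z : (`]-1, 1[%classic : set R) z -> (lam m).-integrable setT (EFin \o f z).
  by rewrite /= in_itv/= => /H1/pb_integrable.
have derf z t : (`]-1, 1[%classic : set R) z -> setT t -> derivable (f^~ t) z 1.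
  by move=> _ _; have [] := df z t.
have K0 : 0 <= K by apply: (@pb_ge0 R m K (h (0 *: v + y))); apply: H1; rewrite ltrN10 ltr01.
have G0 t : 0 <= K * pw (tuple_vec t : E m) by rewrite mulr_ge0 ?pw_ge0.
have intG : (lam m).-integrable setT (EFin \o (fun t : T m => K * pw (tuple_vec t))).
  rewrite (_ : EFin \o _ = fun t => (K%:E * (pw (tuple_vec t))%:E)%E).
    by apply: integrableZl => //; exact: integrable_pw.
  by apply/funext => t /=; rewrite EFinM.
have Gub z t : (`]-1, 1[%classic : set R) z -> setT t ->
    `|partial1of2 f z t| <= K * pw (tuple_vec t : E m).
  by rewrite /= in_itv/= d1f => zI _; exact: H3.
have D := derivable_under_integral measurableT I0 intf derf G0 intG Gub.
have V := differentiation_under_integral measurableT I0 intf derf G0 intG Gub.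
apply: (is_derive_line (F := fun z : R => ir (h (z *: v + y))) (x := 0) (v := 1)).
  by move=> t; rewrite addr0 [t *: 1]mulr1.
apply: DeriveDef; first exact: D.
rewrite -derive1E V; apply: eq_Rintegral => t _.
by rewrite d1f scale0r add0r.
Qed.

Definition near1 n (y y0 : E n) : Prop := forall i, `|y 0 i - y0 0 i| <= 1.

Lemma ir_continuous n m (h : E n -> E m -> R) (dh : 'I_n -> E n -> E m -> R) :
  (forall y, measR (h y)) ->
  (forall i (z : E n) xi, is_derive z (unit_vec i) (h^~ xi) (dh i z xi)) ->
  (forall y0, exists K, forall y xi, near1 y y0 ->
     `|h y xi| <= K * pw xi /\ forall i, `|dh i y xi| <= K * pw xi) ->
  continuous (fun y => ir (h y)).
Proof.
move=> mh dhE H; apply: continuous_of_lipschitz => x; have [K HK] := H x.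
have pbh y : near1 y x -> pb K (h y).
  by move=> yx; split => // xi; exact: (HK y xi yx).1.
have nx : near1 x x by move=> i; rewrite subrr normr0.
have K0 : 0 <= K by exact: pb_ge0 (pbh x nx).
exists (K * pwI m); first by rewrite mulr_ge0 ?pwI_ge0.
move=> y yx; rewrite -mulN1r -(irZ (-1) (pbh x nx)) -(irD (pbh y yx) (pbZ (-1) (pbh x nx))).
rewrite mulrAC; apply: ir_le; split.
  exact: (pbD (pbh y yx) (pbZ (-1) (pbh x nx))).1.
move=> xi; rewrite mulN1r -mulrA [_ * pw xi]mulrC mulrA.
apply: (lipschitz_of_partial (fun i z => dhE i z xi)) => i z zx.
by apply: (HK z xi _).2 => j; rewrite (le_trans (zx j)).
Qed.

Lemma near1_scale n (y : E n) i (z : R) : -1 < z < 1 -> near1 (z *: unit_vec i + y) y.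
Proof.
move=> /andP[z1 z2] j; rewrite !mxE eqxx/= addrK normrM.
by case: (j == i); rewrite ?normr1 ?mulr1 ?normr0 ?mulr0// ler_norml (ltW z1) (ltW z2).
Qed.

(** Domination is asked only near each point, since integrands may grow with the parameter or be
    translated by it. The unit box of [near1] matches the interval ]-1, 1[ of [ir_is_derive]. *)
Lemma int_pdiff n m (h : E n -> E m -> C) :
  (forall y, measC (h y)) ->
  (forall xi, pdiff (h^~ xi)) ->
  (forall y0, exists K, forall y xi, near1 y y0 ->
     cabs (h y xi) <= K * pw xi /\ forall i, cabs (partial i (h^~ xi) y) <= K * pw xi) ->
  pdiff (fun y => integralC (h y)) /\
  forall i, partial i (fun y => integralC (h y)) =
    fun y => integralC (fun xi => partial i (h^~ xi) y).
Proof.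
move=> mh dh H.
have dre i z xi := (pdiff_isd i z (dh xi)).1.
have dim i z xi := (pdiff_isd i z (dh xi)).2.
apply: pdiff_of_isd.
  split.
  - apply: (ir_continuous (h := fun y => re_part (h y))
      (dh := fun i z xi => complex.Re (partial i (h^~ xi) z))) => //.
      by move=> y; case: (mh y).
    move=> y0; have [K HK] := H y0; exists K => y xi yy; have [h1 h2] := HK y xi yy.
    split=> [|i]; first exact: le_trans (norm_Re_le _) h1.
    exact: le_trans (norm_Re_le _) (h2 i).
  - apply: (ir_continuous (h := fun y => im_part (h y))
      (dh := fun i z xi => complex.Im (partial i (h^~ xi) z))) => //.
      by move=> y; case: (mh y).
    move=> y0; have [K HK] := H y0; exists K => y xi yy; have [h1 h2] := HK y xi yy.
    split=> [|i]; first exact: le_trans (norm_Im_le _) h1.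
    exact: le_trans (norm_Im_le _) (h2 i).
move=> i y; have [K HK] := H y; split.
- apply: (ir_is_derive (h := fun y => re_part (h y))
    (dh := fun z xi => complex.Re (partial i (h^~ xi) z)) (K := K)) => //.
  + move=> z /(near1_scale y i) zy; split; first by case: (mh (z *: unit_vec i + y)).
    by move=> xi; apply: le_trans (norm_Re_le _) (HK _ xi zy).1.
  + move=> z xi /(near1_scale y i) zy.
    by apply: le_trans (norm_Re_le _) ((HK _ xi zy).2 i).
- apply: (ir_is_derive (h := fun y => im_part (h y))
    (dh := fun z xi => complex.Im (partial i (h^~ xi) z)) (K := K)) => //.
  + move=> z /(near1_scale y i) zy; split; first by case: (mh (z *: unit_vec i + y)).
    by move=> xi; apply: le_trans (norm_Im_le _) (HK _ xi zy).1.
  + move=> z xi /(near1_scale y i) zy.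
    by apply: le_trans (norm_Im_le _) ((HK _ xi zy).2 i).
Qed.

(** The reciprocal of [pw y] up to the factor 2^n: the constant in the Peetre-type inequality
    [pw_shift], which rests on 1 + a^2 <= 2 (1 + b^2) (1 + (a + b)^2). *)
Definition pwinv n (y : E n) : R := \prod_(i < n) (2 * (1 + y 0 i ^+ 2)).

Lemma pwinv_gt0 n (y : E n) : 0 < pwinv y.
Proof. by apply: prodr_gt0 => i _; rewrite mulr_gt0// one_sqr_gt0. Qed.

Lemma pw_shift n (x y : E n) : pw (x + y) <= pwinv y * pw x.
Proof.
rewrite /pw /pwinv -big_split/=; apply: ler_prod => i _.
rewrite invr_ge0 ltW ?one_sqr_gt0//= mxE ler_pdivlMr ?one_sqr_gt0//.
rewrite mulrC ler_pdivrMr ?one_sqr_gt0//.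
move: (x 0 i) (y 0 i) => a b; have := sqr_ge0 (a + 2 * b); have := sqr_ge0 (b * (a + b)).
by nra.
Qed.

Lemma near1_pwinv n (y : E n) : near1 y 0 -> pwinv y <= 4 ^+ n.
Proof.
move=> y1; rewrite /pwinv -[n in leRHS]card_ord -prodr_const.
apply: ler_prod => i _; rewrite mulr_ge0 ?(ltW (one_sqr_gt0 _))//=.
have := y1 i; rewrite mxE subr0 => yi.
have : y 0 i ^+ 2 <= 1 by rewrite -real_normK ?num_real// expr_le1.
by lra.
Qed.

(** The integral of the translate f(xi + y) over xi does not depend on y; differentiating it at y =
    0 under the integral sign gives the claim, with no boundary terms to estimate. *)
Lemma integral_partial_eq0 n K (f : E n -> C) (j : 'I_n) : pdiff f ->
  cpb K f -> (forall i x, cabs (partial i f x) <= K * pw x) ->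
  integralC (partial j f) = 0.
Proof.
move=> pf pK dK.
pose h (y xi : E n) := f (xi + y).
have shift_isd i y xi : isd (h^~ xi) y (unit_vec i) (partial i f (xi + y)).
  apply: (isd_line (f := f) (x := xi + y) (v := unit_vec i)); last exact: pdiff_isd.
  by move=> t; rewrite /h addrCA.
have cadd (xi : E n) : continuous (fun y : E n => xi + y).
  apply: cont_rV => i y.
  rewrite (_ : (fun x => _) = (fun y : E n => xi 0 i + y 0 i)); last first.
    by apply/funext => z; rewrite mxE.
  exact: (contRD (@contR_cst _ _ _) (@coord_cont _ _ i)).
have ph xi := pdiff_of_isd (cont_comp (cadd xi) (pdiff_cont pf))
  (fun i y => shift_isd i y xi).
have [|xi|y0|_ /(_ j)] := @int_pdiff n n h; first 3 last.
- move=> /(congr1 (fun F => F 0)).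
  have -> : (fun y => integralC (h y)) = fun=> integralC f.
    apply/funext => y; rewrite (integralC_affine y (oner_neq0 R) pK) normr1 expr1n mul1r.
    by congr integralC; apply/funext => xi; rewrite scale1r.
  rewrite (pdiff_cst _).2 => /esym <-; congr integralC; apply/funext => xi.
  by rewrite (ph xi).2 addr0.
- move=> y; apply: cont_measC; apply: (cont_comp (A := fun x => x + y)) (pdiff_cont pf).
  by under eq_fun do rewrite addrC; exact: cadd.
- exact: (ph xi).1.
- have K0 := cpb_ge0 pK.
  (* The weight is shifted twice: by y0, and by y - y0, which lies in the unit box and costs at most
     4^n. *)
  exists (K * (pwinv y0 * 4 ^+ n)) => y xi yy0.
  have pwxi : K * pw (xi + y) <= K * (pwinv y0 * 4 ^+ n) * pw xi.
    rewrite -!mulrA ler_wpM2l// (_ : xi + y = xi + (y - y0) + y0); last by rewrite addrA subrK.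
    rewrite (le_trans (pw_shift _ _))// ler_wpM2l ?(ltW (pwinv_gt0 _))//.
    rewrite (le_trans (pw_shift _ _))// ler_wpM2r ?pw_ge0// near1_pwinv//.
    by move=> i; rewrite !mxE subr0; exact: yy0.
  split; first exact: le_trans (pK.2 _) pwxi.
  by move=> i; rewrite (ph xi).2; apply: le_trans (dK i _) pwxi.
Qed.

End ComplexIntegrals.

(** * Partial Fourier transform *)

Section WordFamilies.
Context {R : realType} {n : nat}.
Local Notation C := R[i].
Local Notation E := 'rV[R]_n.

Lemma word_rcons W a (f : E -> C) : word (rcons W a) f = word W (letter a f).
Proof. exact: foldr_rcons. Qed.

Lemma letterD a (f g : E -> C) : smooth f -> smooth g ->
  letter a (fun x => f x + g x) = fun x => letter a f x + letter a g x.
Proof.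
case: a => i sf sg /=; last exact: (pdiffD (smooth_pdiff sf) (smooth_pdiff sg)).2.
by apply/funext => x; rewrite mulrDr.
Qed.

Lemma wordD W (f g : E -> C) : smooth f -> smooth g ->
  word W (fun x => f x + g x) = fun x => word W f x + word W g x.
Proof.
move=> sf sg; elim: W => [//|a W IH].
rewrite -[LHS]/(letter a (word W _)) IH.
exact: letterD (smooth_word W sf) (smooth_word W sg).
Qed.

(* [Q N] collects the functions reached after [N] letters. Each letter yields two
   terms, hence the factor [2 ^+ size W]; [P] allows to restrict to derivatives. *)
Lemma words_of_family (P : pred ('I_n + 'I_n)) (Q : nat -> (E -> C) -> Prop)
    (beta : nat -> E -> R) :
  (forall i, P (inr i)) ->
  (forall N g, Q N g -> pdiff g) ->
  (forall N g x, Q N g -> cabs (g x) <= beta N x) ->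
  (forall N g a, Q N g -> P a -> exists g1 g2, [/\ Q N.+1 g1, Q N.+1 g2 &
     letter a g = fun x => g1 x + g2 x]) ->
  forall N g, Q N g -> smooth g /\ forall W x, all P W ->
    cabs (word W g x) <= 2 ^+ size W * beta (N + size W)%N x.
Proof.
move=> Pinr Qd Qb Ql.
have Qs N g : Q N g -> smooth g.
  move=> Qg; apply/smoothP => k; elim: k N g Qg => [|k IH] N g Qg.
    by split=> //; exact: Qd Qg.
  split=> [|i]; first exact: Qd Qg.
  have [g1 [g2 [Q1 Q2 E12]]] := Ql N g (inr i) Qg (Pinr i).
  rewrite -[partial i g]/(letter (inr i) g) E12.
  by apply: CkD; [exact: (IH _ _ Q1)|exact: (IH _ _ Q2)].
move=> N g Qg; split; first exact: Qs Qg.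
move=> W x; elim/last_ind: W N g Qg => [|W a IH] N g Qg.
  by move=> _; rewrite expr0 mul1r addn0; exact: Qb.
rewrite all_rcons => /andP[Pa PW]; rewrite word_rcons.
have [g1 [g2 [Q1 Q2 ->]]] := Ql N g a Qg Pa.
rewrite wordD; [|exact: Qs Q1|exact: Qs Q2].
rewrite (le_trans (cabsD _ _))// size_rcons exprS -mulrA mulr2n mulrDl mul1r.
by rewrite lerD// -addSnnS; exact: IH.
Qed.

(** A qualitative form of [wordb], stable under words; differentiation under the integral and
    integration by parts require no more. *)
Definition rapid (f : E -> C) : Prop := smooth f /\
  forall W, exists2 B, 0 <= B & forall x, cabs (word W f x) <= B * pw x.

Lemma rapid_word W f : rapid f -> rapid (word W f).
Proof.
move=> [sf rf]; split; first exact: smooth_word.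
by move=> W'; have [B B0 HB] := rf (W' ++ W); exists B => // x; rewrite -word_cat.
Qed.

Lemma rapid_smooth f : rapid f -> smooth f. Proof. by case. Qed.

Lemma rapid_bound f : rapid f -> exists2 B, 0 <= B & forall x, cabs (f x) <= B * pw x.
Proof. by move=> [_ /(_ [::])]. Qed.

(** Each factor 1 + x_i^2 of the inverse weight is the identity plus two multiplications by x_i. The
    resulting 2 n additional letters are separated from the factorial by [factpD]. *)
Lemma wordb_pw s K H f : 0 <= s -> 0 < K -> 1 <= H -> wordb s K H f ->
  exists K' H', [/\ 0 < K', 1 <= H' & forall W (x : E),
    cabs (word W f x) <= K' * H' ^+ size W * factp s (size W) * pw x].
Proof.
move=> s0 K0 H1 [sf wf]; have H0 : 0 <= H by lra.
have main (r : seq 'I_n) W (x : E) : (\prod_(i <- r) (1 + x 0 i ^+ 2)) * cabs (word W f x) <=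
    2 ^+ size r * (K * H ^+ (size W + 2 * size r) * factp s (size W + 2 * size r)).
  elim: r W => [|i r IH] W; first by rewrite big_nil expr0 !mul1r muln0 addn0.
  rewrite big_cons; set Pi := \prod_(j <- r) _; set c := cabs _.
  have -> : (1 + x 0 i ^+ 2) * Pi * c = Pi * c + Pi * (x 0 i ^+ 2 * c) by ring.
  have sE : (size W + 2 * size (i :: r) = (size W).+2 + 2 * size r)%N.
    by rewrite /= mulnS addnA addn2.
  set X := K * _ * _; have -> : 2 ^+ size (i :: r) * X = 2 ^+ size r * X + 2 ^+ size r * X.
    by rewrite /= exprS; ring.
  rewrite /X sE; apply: lerD.
  - rewrite (le_trans (IH W))// ler_wpM2l ?exprn_ge0//.
    apply: ler_pM; rewrite ?mulr_ge0 ?exprn_ge0 ?factp_ge0 ?(ltW K0)//.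
      by rewrite ler_wpM2l ?(ltW K0)// ler_weXn2l// !addSn leqW// leqW.
    by rewrite le_factp// !addSn leqW// leqW.
  - have -> : x 0 i ^+ 2 * c = cabs (word [:: inl i, inl i & W] f x).
      by rewrite /= !cabsM !cabs_real mulrA -expr2 real_normK ?num_real.
    exact: IH.
pose p := 2 `^ s : R.
have p1 : 1 <= p by rewrite /p -[leLHS](powRr0 2) ler_powR// ler1n.
exists (2 ^+ n * K * H ^+ (2 * n) * p ^+ (2 * n) * factp s (2 * n)), (H * p).
have p0 : 0 < p by lra.
have Hp : 0 < H by lra.
split; first by rewrite !mulr_gt0 ?exprn_gt0 ?factp_gt0.
  by rewrite (le_trans H1)// ler_peMr.
move=> W x; rewrite -ler_pdivrMr ?pw_gt0//.
have -> : (pw x)^-1 = \prod_(i <- index_enum 'I_n) (1 + x 0 i ^+ 2).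
  by rewrite /pw prodfV invrK.
rewrite mulrC (le_trans (main _ _ _))//.
have -> : size (index_enum 'I_n) = n by rewrite -[RHS](card_ord n) cardE enumT.
have b0 : 0 <= 2 ^+ n * (K * H ^+ (size W + 2 * n)).
  by rewrite !mulr_ge0 ?exprn_ge0 ?(ltW K0).
rewrite mulrA (le_trans (ler_wpM2l b0 (factpD _ _ s0)))// -/p.
by rewrite le_eqVlt; apply/orP; left; apply/eqP; rewrite !exprD exprMn; ring.
Qed.

Lemma rapid_of_wordb s K H f : 0 <= s -> 0 < K -> 1 <= H -> wordb s K H f -> rapid f.
Proof.
move=> s0 K0 H1 wf; have [K' [H' [K'0 H'1 HW]]] := wordb_pw s0 K0 H1 wf.
split; first by case: wf.
move=> W; exists (K' * H' ^+ size W * factp s (size W)) => //.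
by rewrite !mulr_ge0 ?exprn_ge0 ?factp_ge0 ?(ltW K'0)//; lra.
Qed.

End WordFamilies.

Section ContinuousMaps.
Context {R : realType}.
Local Notation E n := 'rV[R]_n.

Lemma continuous_compose (T U V : topologicalType) (f : T -> U) (g : U -> V) :
  continuous f -> continuous g -> continuous (fun x => g (f x)).
Proof. by move=> cf cg x; apply: continuous_comp; [exact: cf|exact: cg]. Qed.

Lemma cont_add_const n (v : E n) : continuous (fun x : E n => x + v).
Proof.
apply: cont_rV => i; under eq_fun do rewrite mxE.
exact: (contRD (@coord_cont _ _ i) (@contR_cst _ _ _)).
Qed.

Lemma cont_sub_from n (v : E n) : continuous (fun x : E n => v - x).
Proof.
apply: cont_rV => i; rewrite (_ : (fun x => _) = fun x : E n => v 0 i + -1 * x 0 i).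
  exact: (contRD (@contR_cst _ _ _) (@contRZ R n (-1) _ (@coord_cont R n i))).
by apply/funext => x; rewrite !mxE mulN1r.
Qed.

Lemma cont_scale n (a : R) : continuous (fun x : E n => a *: x).
Proof.
apply: cont_rV => i; under eq_fun do rewrite mxE.
exact: (@contRZ R n a _ (@coord_cont R n i)).
Qed.

Lemma cont_row_l m n (y : E n) : continuous (fun x : E m => row_mx x y).
Proof.
apply: cont_rV => i; case: (split_ordP i) => j ->.
  by under eq_fun do rewrite row_mxEl; exact: coord_cont.
by under eq_fun do rewrite row_mxEr; exact: contR_cst.
Qed.

Lemma cont_row_r m n (x : E m) : continuous (fun y : E n => row_mx x y).
Proof.
apply: cont_rV => i; case: (split_ordP i) => j ->.
  by under eq_fun do rewrite row_mxEl; exact: contR_cst.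
by under eq_fun do rewrite row_mxEr; exact: coord_cont.
Qed.

Lemma cont_lsub m n : continuous (@lsubmx R 1 m n).
Proof. by apply: cont_rV => i; under eq_fun do rewrite mxE; exact: coord_cont. Qed.

Lemma cont_rsub m n : continuous (@rsubmx R 1 m n).
Proof. by apply: cont_rV => i; under eq_fun do rewrite mxE; exact: coord_cont. Qed.

Lemma cont_dot n (x : E n) : continuous (fun y : E n => dot x y).
Proof. by apply: contR_sum => i; apply: contRZ; exact: coord_cont. Qed.

Lemma dotC n (x y : E n) : dot x y = dot y x.
Proof. by apply: eq_bigr => i _; rewrite mulrC. Qed.

Lemma dotDl n (x y z : E n) : dot (x + y) z = dot x z + dot y z.
Proof. by rewrite -big_split/=; apply: eq_bigr => i _; rewrite mxE mulrDl. Qed.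

Lemma dotZl n a (x y : E n) : dot (a *: x) y = a * dot x y.
Proof. by rewrite mulr_sumr; apply: eq_bigr => i _; rewrite mxE mulrA. Qed.

Lemma dot_unit n (j : 'I_n) (x : E n) : dot (unit_vec j) x = x 0 j.
Proof.
rewrite /dot (bigD1 j)//= big1 ?addr0 ?mxE ?eqxx ?mul1r// => i ij.
by rewrite mxE (negbTE ij) andbF mul0r.
Qed.

Lemma is_derive_dot n (x y v : E n) : is_derive x v (fun x => dot x y) (dot v y).
Proof.
apply: (@is_derive_line R R^o _ id _ (dot x y) (dot v y)) => t.
by rewrite dotDl dotZl.
Qed.

Lemma is_derive_dotr n (x y v : E n) : is_derive x v (fun x => dot y x) (dot y v).
Proof.
rewrite (_ : (fun x => _) = fun x => dot x y); last by apply/funext => z; exact: dotC.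
by rewrite dotC; exact: is_derive_dot.
Qed.

Lemma isd_cis n (h : E n -> R) x v (dh : R) : is_derive x v h dh ->
  isd (fun x => cis (h x)) x v ((0 +i* dh) * cis (h x)).
Proof.
move=> H; pose G (t : R) := h (t *: v + x).
have G0 : G 0 = h x by rewrite /G scale0r add0r.
have H1 : is_derive (0 : R) (1 : R) G dh.
  apply: (is_derive_line (F := h) (x := x) (v := v)) => // t.
  by rewrite /G addr0 [t *: 1]mulr1.
have dc := is_derive1_comp (is_derive_cos (G 0)) H1.
have ds := is_derive1_comp (is_derive_sin (G 0)) H1.
have back (F : R -> R) d : is_derive (0 : R) (1 : R) (F \o G) d ->
    is_derive x v (fun x => F (h x)) d.
  move=> dF; apply: (is_derive_line (F := F \o G) (x := 0) (v := 1)) => // t.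
  by rewrite /G/= addr0 [t *: 1]mulr1.
split; [have := back _ _ dc|have := back _ _ ds]; rewrite G0 => /is_derive_eq; apply.
- by rewrite /= mul0r sub0r mulNr mulrC.
- by rewrite /= mul0r add0r mulrC.
Qed.

End ContinuousMaps.

(** * The Fourier transform in the second block of variables *)

Section PartialFourier.
Context {R : realType}.
Local Notation C := R[i].
Local Notation E n := 'rV[R]_n.

(** [sg] is the sign in the exponent, so the same results serve the transform and its inverse; the
    normalising factor is kept apart. *)
Definition FT n (sg : R) (u : E n -> C) (eta : E n) : C :=
  integralC (fun xi => u xi * cis (sg * dot eta xi)).

Definition FT2 m n (sg : R) (Psi : E (m + n) -> C) (z : E (m + n)) : C :=
  FT sg (fun xi => Psi (row_mx (lsubmx z) xi)) (rsubmx z).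

Definition fibre m n (Psi : E (m + n) -> C) (x : E m) : E n -> C :=
  fun xi => Psi (row_mx x xi).

Lemma fibre_pdiff m n (Psi : E (m + n) -> C) x : pdiff Psi ->
  pdiff (fibre Psi x) /\ forall j, partial j (fibre Psi x) = fibre (partial (rshift m j) Psi) x.
Proof.
move=> pP; apply: (pdiff_of_isd (df := fun j => fibre (partial (rshift m j) Psi) x)).
  exact: (cont_comp (A := fun y => row_mx x y) (@cont_row_r R m n x) (pdiff_cont pP)).
move=> j xi; apply: (isd_line (f := Psi) (x := row_mx x xi) (v := unit_vec (rshift m j))).
  move=> t; rewrite /fibre; congr Psi; apply/rowP => i; rewrite !mxE eqxx/=.
  case: split_ordP => k ->; rewrite ?mxE ?eqxx/= ?eq_lrshift ?mulr0 ?add0r//.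
  by rewrite eq_rshift.
exact: pdiff_isd.
Qed.

Lemma cis_pdiff n (sg : R) (eta : E n) : pdiff (fun xi => cis (sg * dot eta xi)) /\
  forall j, partial j (fun xi => cis (sg * dot eta xi)) =
    fun xi => (0 +i* (sg * eta 0 j)) * cis (sg * dot eta xi).
Proof.
apply: (pdiff_of_isd (df := fun j xi => (0 +i* (sg * eta 0 j)) * cis (sg * dot eta xi))).
  by apply: cont_cis; apply: contRZ; exact: cont_dot.
move=> j xi; apply: isd_cis.
by have := is_deriveZ sg (is_derive_dotr xi eta (unit_vec j)); rewrite [dot eta _]dotC dot_unit.
Qed.

Lemma cont_cis_dot n (sg : R) (eta : E n) : cont (fun xi => cis (sg * dot eta xi) : C).
Proof. by apply: cont_cis; apply: contRZ; exact: cont_dot. Qed.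

Lemma cpb_FT n (sg : R) (u : E n -> C) eta K : cont u ->
  (forall xi, cabs (u xi) <= K * pw xi) -> cpb K (fun xi => u xi * cis (sg * dot eta xi)).
Proof.
move=> cu uK; split; last by move=> xi; rewrite cabsM cabs_cis mulr1.
by apply: cont_measC; apply: contM => //; exact: cont_cis_dot.
Qed.

(** The integral of the j-th derivative of u times the exponential vanishes. Multiplying this
    identity by i sg isolates eta_j, because (i sg)^2 = -1. *)
Lemma FT_parts n (sg : R) (u : E n -> C) (eta : E n) (j : 'I_n) K :
  pdiff u -> (forall i, cont (partial i u)) -> sg ^+ 2 = 1 ->
  (forall xi, cabs (u xi) <= K * pw xi) ->
  (forall i xi, cabs (partial i u xi) <= K * pw xi) ->
  (eta 0 j)%:C * FT sg u eta = (0 +i* sg) * FT sg (partial j u) eta.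
Proof.
move=> pu cdu sg2 uK duK.
pose e xi : C := cis (sg * dot eta xi).
have [pe de] := cis_pdiff sg eta; rewrite -/e in pe de.
have [pue due] := pdiffM pu pe.
have c1 : cpb K (fun xi => u xi * e xi) := cpb_FT sg eta (pdiff_cont pu) uK.
have c2 i : cpb K (fun xi => partial i u xi * e xi) := cpb_FT sg eta (cdu i) (duK i).
have K0 := cpb_ge0 c1.
pose M := \sum_(i < n) `|sg * eta 0 i|.
have M0 : 0 <= M by rewrite sumr_ge0.
have MI i : `|sg * eta 0 i| <= M by rewrite /M (bigD1 i)//= lerDl sumr_ge0.
have cabsI (a : R) : cabs (0 +i* a : C) = `|a|.
  by rewrite /cabs/= expr0n add0r sqrtr_sqr.
have E1 i : partial i (fun xi => u xi * e xi) =
    fun xi => partial i u xi * e xi + (0 +i* (sg * eta 0 i)) * (u xi * e xi).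
  by rewrite due de; apply/funext => xi; congr (_ + _); rewrite mulrCA.
have := @integral_partial_eq0 R n (K + M * K) (fun xi => u xi * e xi) j pue.
rewrite E1 (integralCD (c2 j) (cpbZ _ c1)) (integralCZ _ c1) => H.
have {}H := H _ _.
have H0 : FT sg (partial j u) eta + (0 +i* (sg * eta 0 j)) * FT sg u eta = 0.
  apply: H.
  - split=> [|x]; first by case: c1.
    by rewrite (le_trans (c1.2 x))// ler_wpM2r ?pw_ge0// lerDl mulr_ge0.
  - move=> i x; rewrite E1 (le_trans (cabsD _ _))// mulrDl lerD ?(c2 i).2//.
    rewrite cabsM cabsI -mulrA; apply: ler_pM => //; first exact: cabs_ge0.
    exact: c1.2.
have /(congr1 (fun z => (0 +i* sg) * z)) := H0; rewrite mulr0 mulrDr mulrA.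
have -> : (0 +i* sg) * (0 +i* (sg * eta 0 j)) = - (eta 0 j)%:C :> C.
  apply: complex_eq => /=; last by ring.
  by rewrite mul0r sub0r mulrA -expr2 sg2 mul1r.
by rewrite mulNr => /subr0_eq <-.
Qed.

Lemma FT2_pdiff m n (sg : R) (Psi : E (m + n) -> C) : rapid Psi ->
  [/\ pdiff (FT2 sg Psi),
      forall i, partial (lshift n i) (FT2 sg Psi) = FT2 sg (partial (lshift n i) Psi) &
      forall j, partial (rshift m j) (FT2 sg Psi) =
        fun z => (0 +i* sg) * FT2 sg (letter (inl (rshift m j)) Psi) z].
Proof.
move=> rP; have sP := rapid_smooth rP; have pP := smooth_pdiff sP.
pose h (z : E (m + n)) (xi : E n) : C :=
  Psi (row_mx (lsubmx z) xi) * cis (sg * dot (rsubmx z) xi).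
(* A derivative in the first block acts on [Psi] only, one in the second block on the exponential
   only. *)
pose dh (k : 'I_(m + n)) (xi : E n) (z : E (m + n)) : C :=
  match fintype.split k with
  | inl i => partial (lshift n i) Psi (row_mx (lsubmx z) xi) * cis (sg * dot (rsubmx z) xi)
  | inr j => Psi (row_mx (lsubmx z) xi) *
      ((0 +i* (sg * xi 0 j)) * cis (sg * dot (rsubmx z) xi))
  end.
have cl (xi : E n) : continuous (fun z : E (m + n) => row_mx (lsubmx z) xi).
  exact: (continuous_compose (@cont_lsub R m n) (@cont_row_l R m n xi)).
have cr (xi : E n) : continuous (fun z : E (m + n) => sg * dot (rsubmx z) xi).
  apply: contRZ; rewrite (_ : (fun z => _) = fun z : E (m + n) => dot xi (rsubmx z)).
    exact: (continuous_compose (@cont_rsub R m n) (@cont_dot R n xi)).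
  by apply/funext => z; exact: dotC.
have ph xi : pdiff (h^~ xi) /\ forall k, partial k (h^~ xi) = dh k xi.
  apply: (pdiff_of_isd (df := fun k => dh k xi)).
    apply: contM; first exact: (cont_comp (cl xi) (smooth_cont sP)).
    exact: cont_cis.
  move=> k z; rewrite /dh.
  have dl_ i : isd (fun z => Psi (row_mx (lsubmx z) xi)) z (unit_vec (lshift n i))
      (partial (lshift n i) Psi (row_mx (lsubmx z) xi)).
    apply: (isd_line (f := Psi) (x := row_mx (lsubmx z) xi) (v := unit_vec (lshift n i))).
      move=> t; congr Psi; apply/rowP => k'; rewrite !mxE eqxx/=.
      case: split_ordP => k0 ->; rewrite ?mxE ?eqxx/= ?eq_rlshift ?mulr0 ?add0r//.
    exact: pdiff_isd.
  case: split_ordP => [i ->|j ->].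
  - apply: isd_eq; first apply: isdM (dl_ i) (isd_cis _).
      apply: is_deriveZ.
      apply: (is_derive_line (F := fun=> dot (rsubmx z) xi) (x := rsubmx z) (v := 0)).
        move=> t; congr dot; apply/rowP => k'; rewrite !mxE eqxx/=.
        by rewrite eq_rlshift/= mulr0 add0r.
    rewrite [sg *: _]mulr0 (_ : 0 +i* 0 = 0 :> C)// mul0r mulr0 addr0//.
  - have dr : isd (fun z : E (m + n) => Psi (row_mx (lsubmx z) xi)) z (unit_vec (rshift m j)) 0.
      apply: (isd_line (f := fun=> Psi (row_mx (lsubmx z) xi)) (x := z) (v := 0)).
        move=> t; congr (Psi (row_mx _ _)); apply/rowP => k'; rewrite !mxE eqxx/=.
        by rewrite eq_lrshift/= mulr0 add0r.
      exact: isd_cst.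
    apply: isd_eq; first apply: isdM dr (isd_cis _).
      apply: is_deriveZ.
      apply: (is_derive_line (F := fun x => dot x xi) (x := rsubmx z) (v := unit_vec j)).
        move=> t; congr dot; apply/rowP => k'; rewrite !mxE eqxx/=.
        by rewrite eq_rshift.
      exact: is_derive_dot.
    by rewrite mul0r add0r dot_unit.
have row_pw x (xi : E n) : pw (row_mx x xi : E (m + n)) <= pw xi.
  by rewrite pw_row ler_piMl ?pw_ge0// pw_le1.
have bound W : exists2 B, 0 <= B & forall x xi, cabs (word W Psi (row_mx x xi)) <= B * pw xi.
  have [_ /(_ W)[B B0 HB]] := rP; exists B => // x xi.
  by rewrite (le_trans (HB _))// ler_wpM2l.
have [B B0 HB] := bound [::].
have Bk (k : 'I_(m + n)) : exists2 B', 0 <= B' & forall z xi, cabs (dh k xi z) <= B' * pw xi.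
  rewrite /dh; case: split_ordP => [i _|j _].
  - have [B' B'0 HB'] := bound [:: inr (lshift n i)]; exists B' => // z xi.
    by rewrite cabsM cabs_cis mulr1; exact: HB'.
  - have [B' B'0 HB'] := bound [:: inl (rshift m j)]; exists (`|sg| * B').
      by rewrite mulr_ge0.
    move=> z xi; have := HB' (lsubmx z) xi; rewrite /= row_mxEr !cabsM cabs_cis mulr1 cabs_real => Hb.
    have -> : cabs (0 +i* (sg * xi 0 j) : C) = `|sg| * `|xi 0 j|.
      by rewrite /cabs/= expr0n add0r sqrtr_sqr normrM.
    by rewrite mulrCA -mulrA ler_wpM2l// mulrC.
have /choice[Bf HBf] : forall k, exists B', 0 <= B' /\ forall z xi, cabs (dh k xi z) <= B' * pw xi.
  by move=> k; have [B' ? ?] := Bk k; exists B'.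
have [p H] : pdiff (fun z => integralC (h z)) /\ forall k,
    partial k (fun z => integralC (h z)) = fun z => integralC (fun xi => partial k (h^~ xi) z).
  apply: int_pdiff.
  - move=> z; apply: cont_measC; apply: contM; last exact: cont_cis_dot.
    exact: (cont_comp (@cont_row_r R m n (lsubmx z)) (smooth_cont sP)).
  - by move=> xi; exact: (ph xi).1.
  - move=> y0; exists (B + \sum_k Bf k) => y xi _; split.
      rewrite cabsM cabs_cis mulr1 (le_trans (HB _ _))// ler_wpM2r ?pw_ge0//.
      by rewrite lerDl sumr_ge0// => k _; exact: (HBf k).1.
    move=> k; rewrite (ph xi).2 (le_trans ((HBf k).2 _ _))// ler_wpM2r ?pw_ge0//.
    rewrite (bigD1 k)//= addrCA lerDl addr_ge0// sumr_ge0// => k' _; exact: (HBf k').1.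
split=> //.
- move=> i; rewrite -[FT2 sg Psi]/(fun z => integralC (h z)) H.
  apply/funext => z; congr integralC; apply/funext => xi; rewrite (ph xi).2 /dh.
  by case: split_ordP => [i' /lshift_inj ->//|j /eqP]; rewrite eq_lrshift.
- move=> j; rewrite -[FT2 sg Psi]/(fun z => integralC (h z)) H.
  apply/funext => z.
  have [B' B'0 HB'] := bound [:: inl (rshift m j)].
  have cP := smooth_cont (smooth_letter (inl (rshift m j)) sP).
  rewrite -(integralCZ _ (K := B')); last first.
    apply: cpb_FT; last by move=> xi; exact: HB'.
    exact: (cont_comp (@cont_row_r R m n (lsubmx z)) cP).
  congr integralC; apply/funext => xi; rewrite (ph xi).2 /dh.
  case: split_ordP => [i /eqP|j' /rshift_inj <-]; first by rewrite eq_rlshift.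
  rewrite /= row_mxEr !mulrA; congr (_ * _).
  by rewrite mulrC; congr (_ * _); apply: complex_eq => /=; ring.
Qed.

Lemma FT2_coord m n (sg : R) (Psi : E (m + n) -> C) (k : 'I_(m + n)) :
  sg ^+ 2 = 1 -> rapid Psi ->
  letter (inl k) (FT2 sg Psi) = match fintype.split k with
  | inl i => FT2 sg (letter (inl k) Psi)
  | inr j => fun z => (0 +i* sg) * FT2 sg (partial k Psi) z
  end.
Proof.
move=> sg2 rP; have sP := rapid_smooth rP.
have row_pw x (xi : E n) : pw (row_mx x xi : E (m + n)) <= pw xi.
  by rewrite pw_row ler_piMl ?pw_ge0// pw_le1.
have bound W : exists2 B, 0 <= B & forall x xi, cabs (word W Psi (row_mx x xi)) <= B * pw xi.
  have [_ /(_ W)[B B0 HB]] := rP; exists B => // x xi.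
  by rewrite (le_trans (HB _))// ler_wpM2l.
have [B B0 HB] := bound [::].
apply/funext => z /=; case: split_ordP => [i ->|j ->].
- rewrite /FT2 /FT -(integralCZ _ (K := B)); last first.
    apply: cpb_FT; last by move=> xi; exact: HB.
    exact: (cont_comp (@cont_row_r R m n (lsubmx z)) (smooth_cont sP)).
  by congr integralC; apply/funext => xi; rewrite row_mxEl mulrA mxE.
- have /choice[Bf HBf] : forall j, exists B', 0 <= B' /\ forall xi,
      cabs (partial (rshift m j) Psi (row_mx (lsubmx z) xi)) <= B' * pw xi.
    by move=> j'; have [B' ? H] := bound [:: inr (rshift m j')]; exists B'; split => // xi; exact: H.
  have [pf df] := fibre_pdiff (lsubmx z) (smooth_pdiff sP).
  have := @FT_parts n sg (fibre Psi (lsubmx z)) (rsubmx z) j (B + \sum_j Bf j) pf _ sg2.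
  rewrite mxE df; apply.
  + move=> i; rewrite df.
    exact: (cont_comp (@cont_row_r R m n (lsubmx z)) (smooth_cont (smooth_partial _ sP))).
  + move=> xi; rewrite (le_trans (HB _ _))// ler_wpM2r ?pw_ge0//.
    by rewrite lerDl sumr_ge0// => k' _; exact: (HBf k').1.
  + move=> i xi; rewrite df (le_trans ((HBf i).2 _))// ler_wpM2r ?pw_ge0//.
    rewrite (bigD1 i)//= addrCA lerDl addr_ge0// sumr_ge0// => k' _; exact: (HBf k').1.
Qed.

(** The transform carries letters to letters: in the second block multiplications and derivatives
    are exchanged, up to a factor of modulus 1, and letters of the first block pass through. *)
Lemma wordb_FT2 m n (sg s K H : R) (Psi : E (m + n) -> C) : sg ^+ 2 = 1 ->
  0 <= s -> 0 < K -> 1 <= H -> wordb s K H Psi ->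
  exists K' H', [/\ 0 < K', 1 <= H' & wordb s K' H' (FT2 sg Psi)].
Proof.
move=> sg2 s0 K0 H1 wP.
have rP := rapid_of_wordb s0 K0 H1 wP.
have [K1 [H2 [K10 H21 HW]]] := wordb_pw s0 K0 H1 wP.
have H20 : 0 <= H2 by lra.
pose Q N (g : E (m + n) -> C) := exists W (c : C), [/\ size W = N, cabs c <= 1 &
  g = fun z => c * FT2 sg (word W Psi) z].
pose K2 := 2 * K1 * pwI n.
pose beta N (x : E (m + n)) := K2 * H2 ^+ N * factp s N.
have cabsI : cabs (0 +i* sg : C) = 1.
  by rewrite /cabs/= expr0n add0r sg2 sqrtr1.
have K20 : 0 <= K2 by rewrite /K2 !mulr_ge0 ?pwI_ge0// ltW.
have [||||//|sm] := @words_of_family R (m + n) predT Q beta _ _ _ _ 0%N (FT2 sg Psi).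
- by [].
- move=> N g [W [c [_ _ ->]]]; apply: (pdiffZ c _).1.
  by have [] := FT2_pdiff sg (rapid_word W rP).
- move=> N g x [W [c [<- c1 ->]]]; rewrite cabsM.
  apply: (@le_trans _ _ (1 * cabs (FT2 sg (word W Psi) x))).
    by rewrite ler_wpM2r ?cabs_ge0.
  rewrite mul1r /beta /K2; set B := K1 * H2 ^+ size W * factp s (size W).
  apply: (@le_trans _ _ (2 * B * pwI n)); last first.
    by rewrite le_eqVlt; apply/orP; left; apply/eqP; rewrite /B; ring.
  apply: integralC_le; apply: cpb_FT.
    exact: (cont_comp (@cont_row_r R m n (lsubmx x)) (smooth_cont (smooth_word W wP.1))).
  move=> xi; rewrite (le_trans (HW _ _))// -/B ler_wpM2l//.
    by rewrite /B !mulr_ge0 ?exprn_ge0 ?factp_ge0// ltW.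
  by rewrite pw_row ler_piMl ?pw_ge0// pw_le1.
- move=> N g a [W [c [sW c1 ->]]] _.
  have rW := rapid_word W rP.
  have [pW dl_ dr] := FT2_pdiff sg rW.
  suff [W' [c' [sW' c'1 E1]]] : exists W' (c' : C), [/\ size W' = N.+1, cabs c' <= 1 &
      letter a (fun z => c * FT2 sg (word W Psi) z) = fun z => c' * FT2 sg (word W' Psi) z].
    (* One term is enough; the second one expected by [words_of_family] is a zero multiple. *)
    exists (fun z => c' * FT2 sg (word W' Psi) z), (fun z => 0 * FT2 sg (word W' Psi) z).
    split; [by exists W', c'|by exists W', 0; rewrite cabs0|].
    by rewrite E1; apply/funext => z; rewrite mul0r addr0.
  have la : letter a (fun z => c * FT2 sg (word W Psi) z) =
      fun z => c * letter a (FT2 sg (word W Psi)) z.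
    by case: a => k /=; [apply/funext => z; rewrite mulrCA|exact: (pdiffZ c pW).2].
  rewrite la; case: a la => k _.
  + rewrite FT2_coord//; case: (split_ordP k) => [i ->|j ->].
    * by exists (inl (lshift n i) :: W), c; rewrite /= sW.
    * exists (inr (rshift m j) :: W), (c * (0 +i* sg)); rewrite /= sW cabsM cabsI mulr1.
      by split => //; apply/funext => z; rewrite mulrA.
  + case: (split_ordP k) => [i ->|j ->].
    * by exists (inr (lshift n i) :: W), c; rewrite /= sW dl_.
    * exists (inl (rshift m j) :: W), (c * (0 +i* sg)); rewrite /= sW cabsM cabsI mulr1.
      by split => //; rewrite dr; apply/funext => z; rewrite mulrA.
- exists [::], 1; rewrite cabs1; split => //.
  by apply/funext => z; rewrite mul1r.
move=> bnd; exists (K2 + 1), (2 * H2); split; [by lra|by lra|].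
split=> // W x; rewrite (le_trans (bnd W x _)) ?all_predT// add0n /beta exprMn.
rewrite [leRHS](_ : _ = 2 ^+ size W * ((K2 + 1) * H2 ^+ size W * factp s (size W))); last by ring.
rewrite ler_wpM2l ?exprn_ge0// ler_wpM2r ?factp_ge0// ler_wpM2r ?exprn_ge0//.
by lra.
Qed.

End PartialFourier.

(** * Twisted convolution and Gaussians *)

Section Tensor.
Context {R : realType} {n : nat}.
Local Notation C := R[i].
Local Notation E n := 'rV[R]_n.
Implicit Types psi chi phi : E n -> C.

Definition tensor psi chi (z : E (n + n)) : C :=
  psi (rsubmx z) * chi (rsubmx z - lsubmx z).

Lemma isd_rsub_l psi z i : isd (fun z : E (n + n) => psi (rsubmx z)) z (unit_vec (lshift n i)) 0.
Proof.
apply: (isd_line (f := fun=> psi (rsubmx z)) (x := z) (v := 0)); last exact: isd_cst.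
move=> t; congr psi; apply/rowP => k; rewrite !mxE eqxx/=.
by rewrite eq_rlshift/= mulr0 add0r.
Qed.

Lemma isd_rsub_r psi z j : pdiff psi ->
  isd (fun z : E (n + n) => psi (rsubmx z)) z (unit_vec (rshift n j)) (partial j psi (rsubmx z)).
Proof.
move=> pp; apply: (isd_line (f := psi) (x := rsubmx z) (v := unit_vec j)).
  move=> t; congr psi; apply/rowP => k; rewrite !mxE eqxx/=.
  by rewrite eq_rshift.
exact: pdiff_isd.
Qed.

Lemma isd_diff_l chi z i : pdiff chi ->
  isd (fun z : E (n + n) => chi (rsubmx z - lsubmx z)) z (unit_vec (lshift n i))
    (- partial i chi (rsubmx z - lsubmx z)).
Proof.
move=> pc; apply: (isd_line (f := chi) (x := rsubmx z - lsubmx z) (v := - unit_vec i)).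
  move=> t; congr chi; apply/rowP => k; rewrite !mxE eqxx/=.
  by rewrite eq_rlshift eq_lshift/=; ring.
by apply: isd_opp; exact: pdiff_isd.
Qed.

Lemma isd_diff_r chi z j : pdiff chi ->
  isd (fun z : E (n + n) => chi (rsubmx z - lsubmx z)) z (unit_vec (rshift n j))
    (partial j chi (rsubmx z - lsubmx z)).
Proof.
move=> pc; apply: (isd_line (f := chi) (x := rsubmx z - lsubmx z) (v := unit_vec j)).
  move=> t; congr chi; apply/rowP => k; rewrite !mxE eqxx/=.
  by rewrite eq_lrshift eq_rshift/=; ring.
exact: pdiff_isd.
Qed.

Lemma cont_diff : continuous (fun z : E (n + n) => rsubmx z - lsubmx z).
Proof.
apply: cont_rV => i.
rewrite (_ : (fun z => _) = fun z : E (n + n) => z 0 (rshift n i) + -1 * z 0 (lshift n i)).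
  exact: (contRD (@coord_cont R _ (rshift n i)) (@contRZ R _ (-1) _ (@coord_cont R _ (lshift n i)))).
by apply/funext => z; rewrite !mxE mulN1r.
Qed.

Lemma tensor_pdiff psi chi : pdiff psi -> pdiff chi ->
  [/\ pdiff (tensor psi chi),
    forall i, partial (lshift n i) (tensor psi chi) =
      fun z => -1 * tensor psi (partial i chi) z &
    forall j, partial (rshift n j) (tensor psi chi) =
      fun z => tensor (partial j psi) chi z + tensor psi (partial j chi) z].
Proof.
move=> pp pc.
pose df (k : 'I_(n + n)) z := match fintype.split k with
  | inl i => -1 * tensor psi (partial i chi) z
  | inr j => tensor (partial j psi) chi z + tensor psi (partial j chi) z
  end.
have [|k z|p H] := @pdiff_of_isd R (n + n) (tensor psi chi) df.
- apply: contM; first exact: (cont_comp (@cont_rsub R n n) (pdiff_cont pp)).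
  exact: (cont_comp cont_diff (pdiff_cont pc)).
- rewrite /df; case: split_ordP => [i ->|j ->].
  + apply: isd_eq (isdM (isd_rsub_l psi z i) (isd_diff_l z i pc)) _.
    by rewrite mul0r add0r /tensor mulN1r mulrN.
  + exact: (isdM (isd_rsub_r z j pp) (isd_diff_r z j pc)).
split=> // k; rewrite H /df; apply/funext => z.
  by case: split_ordP => [i /lshift_inj ->//|j /eqP]; rewrite eq_lrshift.
by case: split_ordP => [i /eqP|j /rshift_inj ->//]; rewrite eq_rlshift.
Qed.

Lemma wordb_tensor s K1 H1 K2 H2 psi chi : 0 <= s ->
  0 < K1 -> 1 <= H1 -> 0 < K2 -> 1 <= H2 ->
  wordb s K1 H1 psi -> wordb s K2 H2 chi ->
  exists K H, [/\ 0 < K, 1 <= H & wordb s K H (tensor psi chi)].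
Proof.
move=> s0 K10 H11 K20 H21 [sp wp] [sc wc].
have [H10 H20] : 0 <= H1 /\ 0 <= H2 by split; lra.
pose Q N (g : E (n + n) -> C) := exists W1 W2 (c : C),
  [/\ (size W1 + size W2)%N = N, cabs c <= 1 &
      g = fun z => c * tensor (word W1 psi) (word W2 chi) z].
pose H := H1 * H2.
have H_1 : 1 <= H by rewrite /H (le_trans H11)// ler_peMr.
pose beta N (z : E (n + n)) := K1 * K2 * H ^+ N * factp s N.
have pW W := smooth_pdiff (smooth_word W sp).
have cW W := smooth_pdiff (smooth_word W sc).
have [||||//|sm] := @words_of_family R (n + n) predT Q beta _ _ _ _ 0%N (tensor psi chi).
- by [].
- move=> N g [W1 [W2 [c [_ _ ->]]]]; apply: (pdiffZ c _).1.
  by have [] := tensor_pdiff (pW W1) (cW W2).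
- move=> N g z [W1 [W2 [c [<- c1 ->]]]].
  rewrite /tensor !cabsM.
  apply: (@le_trans _ _ (1 * ((K1 * H1 ^+ size W1 * factp s (size W1)) *
      (K2 * H2 ^+ size W2 * factp s (size W2))))).
    by apply: ler_pM => //; rewrite ?mulr_ge0 ?cabs_ge0//; apply: ler_pM; rewrite ?cabs_ge0.
  rewrite mul1r /beta /H exprMn.
  rewrite [leLHS](_ : _ = K1 * K2 * (H1 ^+ size W1 * H2 ^+ size W2) *
    (factp s (size W1) * factp s (size W2))); last by ring.
  apply: ler_pM; rewrite ?mulr_ge0 ?exprn_ge0 ?factp_ge0 ?(ltW K10) ?(ltW K20)//.
    rewrite ler_wpM2l ?mulr_ge0 ?(ltW K10) ?(ltW K20)//.
    by apply: ler_pM; rewrite ?exprn_ge0// ler_weXn2l// ?leq_addr ?leq_addl.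
  exact: factpM.
- move=> N g a [W1 [W2 [c [sW c1 ->]]]] _.
  have [pT dl_ dr] := tensor_pdiff (pW W1) (cW W2).
  have la : letter a (fun z => c * tensor (word W1 psi) (word W2 chi) z) =
      fun z => c * letter a (tensor (word W1 psi) (word W2 chi)) z.
    by case: a => k /=; [apply/funext => z; rewrite mulrCA|exact: (pdiffZ c pT).2].
  rewrite la; case: a la => k _; case: (split_ordP k) => [i ->|j ->] /=.
  (* By x_i = y_i - (y_i - x_i), multiplication by a coordinate of the first block acts on [psi]
     minus on [chi]. *)
  + exists (fun z => c * tensor (word (inl i :: W1) psi) (word W2 chi) z),
      (fun z => (- c) * tensor (word W1 psi) (word (inl i :: W2) chi) z); split.
    * by exists (inl i :: W1), W2, c; split => //=; rewrite addSn sW.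
    * by exists W1, (inl i :: W2), (- c); split => //=; rewrite ?cabsN// addnS sW.
    * apply/funext => z; rewrite /tensor /= !mxE raddfB/=; ring.
  + exists (fun z => c * tensor (word (inl j :: W1) psi) (word W2 chi) z),
      (fun z => 0 * tensor (word (inl j :: W1) psi) (word W2 chi) z); split.
    * by exists (inl j :: W1), W2, c; split => //=; rewrite addSn sW.
    * by exists (inl j :: W1), W2, 0; split; [rewrite /= addSn sW|rewrite cabs0|].
    * by apply/funext => z; rewrite /tensor /= !mxE; ring.
  + exists (fun z => (- c) * tensor (word W1 psi) (word (inr i :: W2) chi) z),
      (fun z => 0 * tensor (word W1 psi) (word (inr i :: W2) chi) z); split.
    * by exists W1, (inr i :: W2), (- c); split => //=; rewrite ?cabsN// addnS sW.
    * by exists W1, (inr i :: W2), 0; split; [rewrite /= addnS sW|rewrite cabs0|].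
    * by rewrite dl_; apply/funext => z /=; ring.
  + exists (fun z => c * tensor (word (inr j :: W1) psi) (word W2 chi) z),
      (fun z => c * tensor (word W1 psi) (word (inr j :: W2) chi) z); split.
    * by exists (inr j :: W1), W2, c; split => //=; rewrite addSn sW.
    * by exists W1, (inr j :: W2), c; split => //=; rewrite addnS sW.
    * by rewrite dr; apply/funext => z /=; rewrite mulrDr.
- by exists [::], [::], 1; rewrite cabs1; split => //; apply/funext => z; rewrite mul1r.
move=> bnd; exists (K1 * K2), (2 * H); split; [exact: mulr_gt0|lra|].
split=> // W x; rewrite (le_trans (bnd W x _)) ?all_predT// add0n /beta.
by rewrite le_eqVlt [X in _ == X](_ : _ = 2 ^+ size W * (K1 * K2 * H ^+ size W * factp s (size W))) ?eqxx// exprMn; ring.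
Qed.

(** The integral in [twist] after the substitution x -> y - x. Now y occurs in [Theta] only, so
    derivatives in y never reach [phi], and the result keeps the order of [Theta] even if the window
    has a larger one. *)
Definition twisted phi (Theta : E (n + n) -> C) (y : E n) : C :=
  integralC (fun x => conjc (phi x) * Theta (row_mx (y - x) y)).

Lemma cont_twist_x (y : E n) : continuous (fun x : E n => row_mx (y - x) y : E (n + n)).
Proof. exact: (continuous_compose (@cont_sub_from R n y) (@cont_row_l R n n y)). Qed.

Lemma cont_twist_y (x : E n) : continuous (fun y : E n => row_mx (y - x) y : E (n + n)).
Proof.
apply: cont_rV => i; case: (split_ordP i) => j ->.
  under eq_fun do rewrite row_mxEl !mxE.
  exact: (contRD (@coord_cont R n j) (@contR_cst R n _)).
by under eq_fun do rewrite row_mxEr; exact: coord_cont.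
Qed.

Lemma cpb_twisted phi Kp (Theta : E (n + n) -> C) B y : cont phi ->
  (forall x, cabs (phi x) <= Kp * pw x) -> cont Theta ->
  (forall z, cabs (Theta z) <= B) ->
  cpb (B * Kp) (fun x => conjc (phi x) * Theta (row_mx (y - x) y)).
Proof.
move=> cp bp cT bT; split.
  apply: cont_measC; apply: contM; first exact: cont_conj.
  exact: (cont_comp (@cont_twist_x y) cT).
move=> x; rewrite cabsM cabs_conj mulrC -mulrA.
by apply: ler_pM; rewrite ?cabs_ge0.
Qed.

Lemma twisted_pdiff phi Kp (Theta : E (n + n) -> C) : cont phi ->
  (forall x, cabs (phi x) <= Kp * pw x) -> rapid Theta ->
  pdiff (twisted phi Theta) /\ forall j, partial j (twisted phi Theta) =
    fun y => twisted phi (partial (lshift n j) Theta) y +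
             twisted phi (partial (rshift n j) Theta) y.
Proof.
move=> cp bp rT; have sT := rapid_smooth rT.
have bound W : exists2 B, 0 <= B & forall z, cabs (word W Theta z) <= B.
  have [_ /(_ W)[B B0 HB]] := rT; exists B => // z.
  by rewrite (le_trans (HB _))// ler_piMr// pw_le1.
have Kp0 : 0 <= Kp by exact: (@cpb_ge0 R n Kp phi (conj (cont_measC cp) bp)).
pose h (y x : E n) := conjc (phi x) * Theta (row_mx (y - x) y).
pose dT j z := partial (lshift n j) Theta z + partial (rshift n j) Theta z.
have ph x : pdiff (h^~ x) /\ forall j, partial j (h^~ x) =
    fun y => conjc (phi x) * dT j (row_mx (y - x) y).
  apply: (pdiff_of_isd (df := fun j y => conjc (phi x) * dT j (row_mx (y - x) y))).
    apply: contM; first exact: cont_cst.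
    exact: (cont_comp (@cont_twist_y x) (smooth_cont sT)).
  move=> j y; apply: isdZ.
  (* Moving y_j moves both blocks of (y - x, y) at once, hence a sum of two unit vectors as
     direction. *)
  apply: (isd_line (f := Theta) (x := row_mx (y - x) y)
    (v := unit_vec (lshift n j) + unit_vec (rshift n j))).
    move=> t; congr Theta; apply/rowP => k; rewrite !mxE eqxx/=.
    case: split_ordP => i ->; rewrite ?mxE eqxx/=.
      by rewrite eq_lshift eq_lrshift addr0 addrA.
    by rewrite eq_rlshift eq_rshift add0r.
  apply: (isd_dirD (dw := partial (rshift n j) Theta)).
  - by move=> z; apply: pdiff_isd; exact: smooth_pdiff.
  - exact: smooth_cont (smooth_partial _ sT).
  - by apply: pdiff_isd; exact: smooth_pdiff.
have [B B0 HB] := bound [::].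
have /choice[Bf HBf] : forall k, exists B', 0 <= B' /\ forall z, cabs (partial k Theta z) <= B'.
  by move=> k; have [B' ? H] := bound [:: inr k]; exists B'; split => // z; exact: H.
pose S := \sum_(k < n + n) Bf k.
have BS k : Bf k <= S.
  rewrite /S (bigD1 k)//= lerDl sumr_ge0// => k' _; exact: (HBf k').1.
have S0 : 0 <= S by rewrite sumr_ge0// => k' _; exact: (HBf k').1.
have [p H] : pdiff (fun y => integralC (h y)) /\ forall k,
    partial k (fun y => integralC (h y)) = fun y => integralC (fun xi => partial k (h^~ xi) y).
  apply: int_pdiff.
  - by move=> y; have [] := cpb_twisted y cp bp (smooth_cont sT) HB.
  - by move=> x; exact: (ph x).1.
  - move=> y0; exists ((B + 2 * S) * Kp) => y x _; split.
      rewrite (le_trans ((cpb_twisted y cp bp (smooth_cont sT) HB).2 x))//.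
      by rewrite ler_wpM2r ?pw_ge0// ler_wpM2r// lerDl mulr_ge0.
    move=> j; rewrite (ph x).2 cabsM cabs_conj mulrC -mulrA; apply: ler_pM; rewrite ?cabs_ge0//.
    rewrite (le_trans (cabsD _ _))//.
    rewrite (le_trans (lerD ((HBf _).2 _) ((HBf _).2 _)))//.
    have := BS (lshift n j); have := BS (rshift n j); lra.
split=> // j; rewrite -[twisted phi Theta]/(fun y => integralC (h y)) H.
apply/funext => y.
have c k := cpb_twisted y cp bp (smooth_cont (smooth_partial k sT)) (HBf k).2.
rewrite /twisted -(integralCD (c _) (c _)); congr integralC; apply/funext => x.
by rewrite (ph x).2 /dT mulrDr.
Qed.

Lemma wordb_twisted s phi Kp K H (Theta : E (n + n) -> C) : cont phi ->
  (forall x, cabs (phi x) <= Kp * pw x) -> 0 <= s -> 0 < K -> 1 <= H ->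
  wordb s K H Theta ->
  exists K' H', [/\ 0 < K', 1 <= H' & wordb s K' H' (twisted phi Theta)].
Proof.
move=> cp bp s0 K0 H1 wT; have rT := rapid_of_wordb s0 K0 H1 wT.
have H0 : 0 <= H by lra.
have Kp0 : 0 <= Kp by exact: (@cpb_ge0 R n Kp phi (conj (cont_measC cp) bp)).
pose Q N (g : E n -> C) := exists W (c : C), [/\ size W = N, cabs c <= 1 &
  g = fun y => c * twisted phi (word W Theta) y].
pose K2 := 2 * (K * Kp) * pwI n.
have K20 : 0 <= K2 by rewrite /K2 !mulr_ge0 ?pwI_ge0// ltW.
pose beta N (x : E n) := K2 * H ^+ N * factp s N.
have bW W z : cabs (word W Theta z) <= K * H ^+ size W * factp s (size W) by case: wT.
have cW W := smooth_cont (smooth_word W wT.1).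
have [||||//|sm] := @words_of_family R n predT Q beta _ _ _ _ 0%N (twisted phi Theta).
- by [].
- move=> N g [W [c [_ _ ->]]]; apply: (pdiffZ c _).1.
  by have [] := twisted_pdiff cp bp (rapid_word W rT).
- move=> N g y [W [c [<- c1 ->]]]; rewrite cabsM.
  apply: (@le_trans _ _ (1 * cabs (twisted phi (word W Theta) y))).
    by rewrite ler_wpM2r ?cabs_ge0.
  rewrite mul1r (le_trans (integralC_le (cpb_twisted y cp bp (cW W) (bW W))))//.
  by rewrite /beta /K2 le_eqVlt; apply/orP; left; apply/eqP; ring.
- move=> N g a [W [c [sW c1 ->]]] _.
  have [pT dT] := twisted_pdiff cp bp (rapid_word W rT).
  case: a => j.
  + exists (fun y => c * twisted phi (word (inl (rshift n j) :: W) Theta) y),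
      (fun y => 0 * twisted phi (word (inl (rshift n j) :: W) Theta) y); split.
    * by exists (inl (rshift n j) :: W), c; rewrite /= sW.
    * by exists (inl (rshift n j) :: W), 0; split; [rewrite /= sW|rewrite cabs0|].
    * apply/funext => y; rewrite mul0r addr0 /= mulrCA; congr (c * _).
      rewrite /twisted -(integralCZ _ (cpb_twisted y cp bp (cW W) (bW W))).
      congr integralC; apply/funext => x /=.
      by rewrite row_mxEr mulrCA.
  + exists (fun y => c * twisted phi (word (inr (lshift n j) :: W) Theta) y),
      (fun y => c * twisted phi (word (inr (rshift n j) :: W) Theta) y); split.
    * by exists (inr (lshift n j) :: W), c; rewrite /= sW.
    * by exists (inr (rshift n j) :: W), c; rewrite /= sW.
    * rewrite -[letter _ _]/(partial j _) (pdiffZ c pT).2 dT.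
      by apply/funext => y; rewrite mulrDr.
- by exists [::], 1; rewrite cabs1; split => //; apply/funext => z; rewrite mul1r.
move=> bnd; exists (K2 + 1), (2 * H); split; [by lra|by lra|].
split=> // W x; rewrite (le_trans (bnd W x _)) ?all_predT// add0n /beta exprMn.
rewrite [leRHS](_ : _ = 2 ^+ size W * ((K2 + 1) * H ^+ size W * factp s (size W))); last by ring.
rewrite ler_wpM2l ?exprn_ge0// ler_wpM2r ?factp_ge0// ler_wpM2r ?exprn_ge0//.
by lra.
Qed.

End Tensor.

(** * Gaussians as functions of order 1/2 *)

Section Gaussian.
Context {R : realType} {n : nat}.
Local Notation C := R[i].
Local Notation E := 'rV[R]_n.
Implicit Types (a : R) (p x : E).

Definition sqdist p x : R := \sum_(i < n) (x 0 i - p 0 i) ^+ 2.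

(** A negative [a] is allowed: [gauss (- a) p] is the reciprocal of [gauss a p] and serves to cancel
    it. *)
Definition gauss a p x : C := (expR (- (a * sqdist p x)))%:C.

Lemma sqdist_ge0 p x : 0 <= sqdist p x.
Proof. by rewrite sumr_ge0// => i _; rewrite sqr_ge0. Qed.

Lemma cabs_gauss a p x : cabs (gauss a p x) = expR (- (a * sqdist p x)).
Proof. by rewrite cabs_real ger0_norm ?expR_ge0. Qed.

Lemma cont_sqdist p : continuous (sqdist p).
Proof.
apply: contR_sum => i; have c := contRD (@coord_cont R n i) (@contR_cst R n (- p 0 i)).
by under eq_fun do rewrite expr2; exact: contRM.
Qed.

(** The derivative is written as a combination of x_j g and g, that is, of words applied to g, so
    that the formula can be iterated. *)
Lemma gauss_pdiff a p : pdiff (gauss a p) /\ forall j, partial j (gauss a p) =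
  fun x => (- 2 * a)%:C * ((x 0 j)%:C * gauss a p x) + (2 * a * p 0 j)%:C * gauss a p x.
Proof.
apply: pdiff_of_isd.
  apply: cont_real; apply: (continuous_compose (g := expR)); last exact: continuous_expR.
  under eq_fun do rewrite -mulNr; exact: (@contRZ R n (- a) _ (@cont_sqdist p)).
move=> j x.
(* The exponent along the line x + t e_j, a polynomial in t. *)
pose q (t : R) : R := - (a * (sqdist p x + (2 * (x 0 j - p 0 j)) * t + t ^+ 2)).
have dq : is_derive (0 : R) (1 : R) (expR \o q)
    (expR (q 0) * - (a * (2 * (x 0 j - p 0 j)))).
  apply: is_derive1_comp.
  rewrite /q; apply: is_derive_eq.
  by rewrite /GRing.scale /=; ring.
have -> : (- 2 * a)%:C * ((x 0 j)%:C * gauss a p x) + (2 * a * p 0 j)%:C * gauss a p x =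
    (expR (q 0) * - (a * (2 * (x 0 j - p 0 j))))%:C :> C.
  rewrite /gauss /q mulr0 expr0n/= !addr0.
  by apply: complex_eq => /=; ring.
apply: isd_real; apply: (is_derive_line (F := expR \o q) (x := 0) (v := 1)) dq => t.
rewrite /q /= addr0 [t *: 1]mulr1; congr (expR (- (a * _))).
rewrite /sqdist (bigD1 j)//= [in RHS](bigD1 j)//= !mxE !eqxx/=.
rewrite (eq_bigr (fun i => (x 0 i - p 0 i) ^+ 2)); last first.
  by move=> i ij; rewrite !mxE eqxx/= (negbTE ij) mulr0 add0r.
by rewrite mulr1; ring.
Qed.

Lemma smooth_gauss a p : smooth (gauss a p).
Proof.
have [pg dg] := gauss_pdiff a p.
apply/smoothP; elim=> [|k IH]; split => // j; rewrite dg.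
apply: CkD; apply: CkM => //; try by move: k {IH}; apply/smoothP; exact: smooth_cst.
by apply: CkM => //; move: k {IH}; apply/smoothP; exact: smooth_coord.
Qed.

(** Cauchy-Schwarz, obtained term by term from 2 |u_i| |u_j| <= u_i^2 + u_j^2. *)
Lemma sqr_sum_le (u : 'I_n -> R) :
  (\sum_(i < n) `|u i|) ^+ 2 <= n%:R * \sum_(i < n) u i ^+ 2.
Proof.
have -> : (\sum_(i < n) `|u i|) ^+ 2 = \sum_(i < n) \sum_(j < n) `|u i| * `|u j|.
  by rewrite expr2 big_distrlr.
apply: (@le_trans _ _ (\sum_(i < n) \sum_(j < n) (u i ^+ 2 / 2 + u j ^+ 2 / 2))).
  apply: ler_sum => i _; apply: ler_sum => j _.
  rewrite -(real_normK (num_real (u i))) -(real_normK (num_real (u j))).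
  by have := sqr_ge0 (`|u i| - `|u j|); nra.
rewrite (eq_bigr (fun i => n%:R * (u i ^+ 2 / 2) + \sum_(j < n) u j ^+ 2 / 2)); last first.
  by move=> i _; rewrite big_split/= sumr_const card_ord mulr_natl.
rewrite big_split/= -mulr_sumr sumr_const card_ord -[X in _ + X]mulr_natl -mulrDr.
by rewrite ler_wpM2l// -!mulr_suml; lra.
Qed.

(** Without derivatives, [powX_le_expR] at s = 1/2 compares rho^k with exp(c rho^2), which the
    Gaussian absorbs. A derivative is then traded for x_j g and g, and commuting x_j out is paid by
    [factpSS]. *)
Lemma gauss_decay a p : 0 < a -> exists K H, [/\ 0 < K, 1 <= H & decay 2^-1 K H (gauss a p)].
Proof.
move=> a0.
pose P := \sum_(i < n) `|p 0 i|.
have P0 : 0 <= P by rewrite sumr_ge0.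
have Pi i : `|p 0 i| <= P by rewrite /P (bigD1 i)//= lerDl sumr_ge0.
(* Chosen so that c rho(x)^2 is at most a times the squared distance plus a constant; rho^2 brings
   the coefficient 2 n. *)
pose c := a / (2 * n%:R + 1).
have n20 : 0 < 2 * n%:R + 1 :> R by rewrite ltr_wpDl// mulr_ge0.
have c0 : 0 < c by rewrite divr_gt0.
have s0 : 0 < 2^-1 :> R by rewrite invr_gt0.
have [h h0 Hh] := powX_le_expR s0 c0.
pose K := expR (c * (2 * (1 + P) ^+ 2)).
pose H1 := Num.max 1 h.
have H11 : 1 <= H1 by rewrite le_max lexx.
have base k x : rho x ^+ k * cabs (gauss a p x) <= K * H1 ^+ k * factp 2^-1 k.
  rewrite cabs_gauss.
  have rx : rho x <= (1 + P) + \sum_(i < n) `|x 0 i - p 0 i|.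
    rewrite /rho -addrA lerD2l /P -big_split/=; apply: ler_sum => i _.
    by rewrite -[X in `|X| <= _](subrK (p 0 i)) addrC ler_normD.
  have r2 : rho x ^+ 2 <= 2 * (1 + P) ^+ 2 + 2 * n%:R * sqdist p x.
    have := sqr_sum_le (fun i => x 0 i - p 0 i); rewrite -/(sqdist p x).
    have S0 : 0 <= \sum_(i < n) `|x 0 i - p 0 i| by rewrite sumr_ge0.
    move: rx S0; set S := \sum_(i < n) _ => rx S0 S2.
    have : rho x ^+ 2 <= (1 + P + S) ^+ 2.
      by rewrite lerXn2r ?nnegrE ?rho_ge0//; lra.
    by have := sqr_ge0 (1 + P - S); nra.
  have Hk := Hh (rho x) k (rho_ge0 x).
  apply: (le_trans (ler_wpM2r (expR_ge0 _) Hk)); rewrite -[leLHS]mulrA -expRD.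
  rewrite invrK (_ : rho x `^ 2 = rho x ^+ 2); last by rewrite powR_mulrn ?rho_ge0.
  rewrite [leRHS](_ : _ = H1 ^+ k * factp 2^-1 k * K); last by ring.
  apply: ler_pM; rewrite ?mulr_ge0 ?exprn_ge0 ?factp_ge0 ?expR_ge0 ?(ltW h0)//.
    by rewrite ler_wpM2r ?factp_ge0// lerXn2r ?nnegrE ?(ltW h0)// ?le_max ?lexx ?orbT//; lra.
  rewrite /K ler_expR.
  have : c * rho x ^+ 2 <= c * (2 * (1 + P) ^+ 2 + 2 * n%:R * sqdist p x).
    by rewrite ler_wpM2l ?(ltW c0).
  have cn : c * (2 * n%:R) <= a.
    by rewrite /c mulrAC ler_pdivrMr// ler_wpM2l ?(ltW a0)//; lra.
  by have := ler_wpM2r (sqdist_ge0 p x) cn; lra.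
(* The cost of one derivative: 2 a times the bound 2 for x_j g, plus 2 a |p_j| <= 2 a P for g. The 1
   makes A at least 1, so that powers for shorter lists are smaller. *)
pose A := 2 * a * (2 + P) + 1.
have A1 : 1 <= A by rewrite /A lerDr mulr_ge0//; lra.
have sg := smooth_gauss a p.
have [_ dg] := gauss_pdiff a p.
have K0 : 0 < K by exact: expR_gt0.
(* Strong induction, because the commutators involve lists shorter by two. *)
have main m : forall l k x, size l = m -> rho x ^+ k * cabs (dl l (gauss a p) x) <=
    A ^+ m * (K * H1 ^+ (k + m) * factp 2^-1 (k + m)).
  elim/ltn_ind: m => m IH l k x; case/lastP: l => [|l j] lm.
    by rewrite -lm expr0 mul1r addn0; exact: base.
  move: lm; rewrite size_rcons => lm.
  have sml : (size l < m)%N by rewrite -lm.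
  have scg := smooth_letter (inl j) sg.
  rewrite dl_rcons dg dlD; [|exact: smoothZ|exact: smoothZ].
  rewrite (dlZ l _ scg) (dlZ l _ sg).
  set M := (k + m)%N; pose U := A ^+ size l * (K * H1 ^+ M * factp 2^-1 M).
  have rk0 : 0 < rho x ^+ k by rewrite exprn_gt0 ?rho_gt0.
  have U0 : 0 <= U by rewrite !mulr_ge0 ?exprn_ge0 ?factp_ge0//; lra.
  have t1 : rho x ^+ k * (rho x * cabs (dl l (gauss a p) x)) <= U.
    have := IH _ sml l k.+1 x erefl; rewrite exprSr -mulrA addSnnS lm.
    exact.
  have t2 l' : (size l').+1 = size l ->
      rho x ^+ k * ((size l)%:R * cabs (dl l' (gauss a p) x)) <= U.
    move=> ll'; rewrite mulrCA.
    have sml' : (size l' < m)%N by rewrite (leq_trans _ sml)// -ll'.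
    have ME : M = (k + size l').+2 by rewrite /M -lm -ll' !addnS.
    apply: (@le_trans _ _ ((size l)%:R * (A ^+ size l' * (K * H1 ^+ (k + size l') *
        factp 2^-1 (k + size l'))))).
      by rewrite ler_wpM2l//; exact: IH _ sml' l' k x erefl.
    rewrite /U ME [leLHS](_ : _ = A ^+ size l' * (K * (H1 ^+ (k + size l') *
      ((size l)%:R * factp 2^-1 (k + size l'))))); last by ring.
    rewrite -[X in A ^+ size l * X]mulrA.
    apply: ler_pM; rewrite ?mulr_ge0 ?exprn_ge0 ?factp_ge0//; [lra|lra|lra| |].
      by rewrite ler_weXn2l// -ll'.
    rewrite ler_wpM2l ?(ltW K0)//; apply: ler_pM.
    - by rewrite exprn_ge0//; lra.
    - by rewrite mulr_ge0// factp_ge0.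
    - by rewrite ler_weXn2l// leqW// leqW.
    - rewrite (le_trans _ (factpSS (k + size l') (lexx _)))// ler_wpM2r ?factp_ge0//.
      by rewrite ler_nat -ll' ltnS leq_addl.
  have Bk l' : (size l').+1 = size l ->
      cabs (dl l' (gauss a p) x) <= U / rho x ^+ k / (size l)%:R.
    move=> ll'; have l0 : (0 : R) < (size l)%:R by rewrite -ll'.
    rewrite !ler_pdivlMr// (_ : _ * _ * _ =
      rho x ^+ k * ((size l)%:R * cabs (dl l' (gauss a p) x))) ?t2//; ring.
  have t3 : rho x ^+ k * cabs (dl l (fun x => (x 0 j)%:C * gauss a p x) x) <= 2 * U.
    have := ler_wpM2l (ltW rk0) (dl_mul_coord_le j sg Bk).
    move=> /le_trans; apply; rewrite mulrDr mulr2n mulrDl mul1r lerD//.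
      rewrite (le_trans _ t1)// ler_wpM2l ?(ltW rk0)// ler_wpM2r ?cabs_ge0//.
      exact: coord_le_rho.
    have [->|l0] := eqVneq (size l) 0%N; first by rewrite mul0r mulr0.
    have ln0 : (size l)%:R != 0 :> R by rewrite pnatr_eq0.
    rewrite le_eqVlt; apply/orP; left; apply/eqP.
    by field; rewrite ln0 /= expf_neq0// gt_eqF// rho_gt0.
  have t4 : rho x ^+ k * cabs (dl l (gauss a p) x) <= U.
    rewrite (le_trans _ t1)// ler_wpM2l ?(ltW rk0)// ler_peMl ?cabs_ge0//.
    exact: rho_ge1.
  apply: (@le_trans _ _ (2 * a * (2 * U) + 2 * a * P * U)).
    rewrite (le_trans (ler_wpM2l (ltW rk0) (cabsD _ _)))// mulrDr !cabsM !cabs_real.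
    rewrite lerD//.
      rewrite mulNr normrN ger0_norm ?mulr_ge0 ?(ltW a0)// mulrCA ler_wpM2l//.
      by rewrite mulr_ge0 ?(ltW a0).
    rewrite mulrCA; apply: ler_pM => //; first by rewrite mulr_ge0 ?cabs_ge0 ?(ltW rk0).
    by rewrite normrM ger0_norm ?mulr_ge0 ?(ltW a0)// ler_wpM2l// mulr_ge0 ?(ltW a0).
  rewrite -lm exprS -[leRHS]mulrA -/M -/U /A.
  rewrite [leRHS](_ : _ = 2 * a * (2 * U) + 2 * a * P * U + U); last by ring.
  by rewrite lerDl.
exists K, (A * H1); split=> //; first by rewrite (le_trans A1)// ler_peMr//; lra.
split=> // k l x; rewrite (le_trans (main _ l k x erefl))//.
rewrite mulrA mulrCA -!mulrA ler_wpM2l ?(ltW K0)// exprMn !mulrA.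
rewrite ler_wpM2r ?factp_ge0// ler_wpM2r ?exprn_ge0//; first by lra.
by rewrite ler_weXn2l// leq_addl.
Qed.

Lemma wordb_gauss a p : 0 < a ->
  exists K H, [/\ 0 < K, 1 <= H & wordb 2^-1 K H (gauss a p)].
Proof.
move=> a0; have [K [H [K0 H1 dg]]] := gauss_decay p a0.
exists K, (2 * H); split => //; first by lra.
exact: (wordb_of_decay (lexx _) (ltW K0) H1 dg).
Qed.

End Gaussian.

(** * Fourier inversion up to a constant *)

Section Inversion.
Context {R : realType}.
Local Notation C := R[i].
Local Notation E n := 'rV[R]_n.
Local Notation mR := (measurableTypeR R).
Local Notation T n := (n.-tuple mR).

Local Notation cube1 n := (@cube R n 1).

Lemma lam_cube_gt0 n : (0 < @lam R n (cube1 n))%E.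
Proof.
elim: n => [|n IH].
  rewrite /lam/= /dirac/= indicE mem_set ?lte_fin//.
  by move=> i; case: i.
rewrite -[lam n.+1 (cube1 n.+1)]/((lam n \x @lebesgue_measure R)%E (@cons_pair R n @^-1` cube1 n.+1)).
rewrite cube_succ product_measure1E//=; last exact: measurable_cube.
rewrite mule_gt0// lebesgue_measure_itv/= lte_fin ifT ?lte_fin; last by lra.
by lra.
Qed.

Lemma ir_gt0 n K (h : E n -> R) (c : R) : pb K h -> (forall x, 0 <= h x) -> 0 < c ->
  (forall x : E n, (forall i : 'I_n, `|x 0 i| <= 1) -> c <= h x) -> 0 < ir h.
Proof.
move=> ph h0 c0 hc; have mc := @measurable_cube R n 1.
have mh : measurable_fun setT (fun t : T n => (h (tuple_vec t))%:E).
  by apply/measurable_EFinP; case: ph.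
have : (0 < \int[lam n]_t (h (tuple_vec t))%:E)%E.
  apply: (@lt_le_trans _ _ (c%:E * lam n (cube1 n))%E).
    by rewrite mule_gt0// lam_cube_gt0.
  rewrite -integral_cst//.
  apply: (@le_trans _ _ (\int[lam n]_(t in cube1 n) (h (tuple_vec t))%:E)%E).
    apply: ge0_le_integral => //.
    - by move=> t _; rewrite lee_fin ltW.
    - exact: measurable_funTS.
    move=> t Ht; rewrite lee_fin; apply: hc => i; rewrite mxE.
    by have := Ht i; rewrite /= in_itv/= => /andP[/ltW ? ?]; rewrite ler_norml; apply/andP.
  apply: ge0_subset_integral => //.
  by move=> t _; rewrite lee_fin.
rewrite /ir /Rintegral => I0; rewrite fine_gt0// I0/=.
have /integrable_lty := pb_integrable ph.
by apply.
Qed.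

Lemma cpb_gauss n a (p : E n) : 0 < a -> exists2 B, 0 <= B & cpb B (gauss a p).
Proof.
move=> a0; have [K [H [K0 H1 w]]] := wordb_gauss p a0.
have s0 : 0 <= 2^-1 :> R by rewrite invr_ge0.
have [B B0 HB] := rapid_bound (rapid_of_wordb s0 K0 H1 w).
exists B => //; split=> //; apply: cont_measC.
by apply: smooth_cont; exact: smooth_gauss.
Qed.

Lemma cont_gauss n a (p : E n) : cont (gauss a p).
Proof. by apply: smooth_cont; exact: smooth_gauss. Qed.

Lemma gauss_le1 n a (p x : E n) : 0 <= a -> cabs (gauss a p x) <= 1.
Proof.
by move=> a0; rewrite cabs_gauss -expR0 ler_expR oppr_le0 mulr_ge0// sqdist_ge0.
Qed.

Local Notation k0 n := (gauss 2^-1 (0 : E n)).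
Local Notation A n := (integralC (k0 n)).

Lemma cpb_mul n a b (f g : E n -> C) : cont f -> cont g ->
  (forall x, cabs (f x) <= a) -> (forall x, cabs (g x) <= b * pw x) ->
  cpb (a * b) (fun x => f x * g x).
Proof.
move=> cf cg bf bg; split; first exact: cont_measC (contM cf cg).
by move=> x; rewrite cabsM -mulrA; apply: ler_pM; rewrite ?cabs_ge0.
Qed.

Lemma half_gt0 : 0 < 2^-1 :> R. Proof. by rewrite invr_gt0. Qed.

Lemma integral_gauss_neq0 n : A n != 0.
Proof.
have [B B0 cb] := cpb_gauss (0 : E n) half_gt0.
have : 0 < ir (re_part (k0 n)).
  apply: (@ir_gt0 n B _ (expR (- (2^-1 * n%:R)))).
  - exact: cpb_re.
  - by move=> x; exact: expR_ge0.
  - exact: expR_gt0.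
  move=> x hx; rewrite ler_expR lerN2 ler_wpM2l ?(ltW half_gt0)//.
  rewrite /sqdist -[X in X%:R]card_ord -sumr_const ler_sum// => i _.
  rewrite mxE subr0 -(real_normK (num_real _)).
  by rewrite expr_le1.
by rewrite integralCE => I0; rewrite eq_complex /= gt_eqF.
Qed.

Lemma pdiff_const n (G : E n -> C) : pdiff G -> (forall j, partial j G = fun=> 0) ->
  forall x y, G x = G y.
Proof.
move=> pG dG.
have key (F : E n -> R) : (forall i z, is_derive z (unit_vec i) F 0) -> forall x y, F x = F y.
  move=> dF x y; apply/eqP; rewrite -subr_eq0 -normr_le0.
  have := @lipschitz_of_partial R n F (fun _ _ => 0) 0 y x dF.
  by rewrite mul0r; apply => i z _; rewrite normr0.
move=> x y; apply: complex_eq.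
  by apply: (key (re_part G)) => i z; have [+ _] := pdiff_isd i z pG; rewrite dG.
by apply: (key (im_part G)) => i z; have [_ +] := pdiff_isd i z pG; rewrite dG.
Qed.

Lemma sqdist0_row m n (x : E m) (y : E n) :
  sqdist 0 (row_mx x y) = sqdist 0 x + sqdist 0 y.
Proof.
rewrite /sqdist big_split_ord/=; congr (_ + _); apply: eq_bigr => i _.
  by rewrite row_mxEl !mxE.
by rewrite row_mxEr !mxE.
Qed.

Lemma sqdist00 n : sqdist (0 : E n) 0 = 0.
Proof. by rewrite /sqdist big1// => i _; rewrite subrr expr0n. Qed.

(* Both sides solve [partial j u = - eta_j u]. *)
Lemma FT_gauss n sg (eta : E n) : sg ^+ 2 = 1 -> FT sg (k0 n) eta = A n * k0 n eta.
Proof.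
move=> sg1.
(* The derivative formulas concern partial transforms, so the transform on one block is read off as
   the fibre over 0 of a transform on the doubled space. *)
pose Psi : E (n + n) -> C := k0 (n + n).
have fE : fibre (FT2 sg Psi) 0 = FT sg (k0 n).
  have PE : (fun xi => Psi (row_mx 0 xi)) = k0 n.
    by apply/funext => xi; rewrite /Psi /gauss sqdist0_row sqdist00 add0r.
  by apply/funext => e; rewrite /fibre /FT2 row_mxKl row_mxKr PE.
have [K [H [K0 H1 w]]] := wordb_gauss (0 : E (n + n)) half_gt0.
have rP : rapid Psi by apply: rapid_of_wordb K0 H1 w; rewrite ltW ?half_gt0.
have [pF _ dF] := FT2_pdiff sg rP.
have [pf df] := fibre_pdiff 0 pF.
have dk j : partial j (FT sg (k0 n)) = fun e => - ((e 0 j)%:C * FT sg (k0 n) e).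
  rewrite -fE df; apply/funext => e; rewrite {1}/fibre dF.
  have := FT2_coord (rshift n j) sg1 rP; rewrite (unsplitK (inr j)) => /(congr1 (@^~ (row_mx 0 e))).
  rewrite {1}/letter row_mxEr => ->.
  rewrite -mulrN; congr (_ * _).
  have [_ ->] := gauss_pdiff 2^-1 (0 : E (n + n)).
  rewrite /FT2 /FT -mulN1r.
  set z := row_mx 0 e.
  have [B B0 HB] := rapid_bound (rapid_word [:: inl (rshift n j)] rP).
  have c : cpb (B * pw (lsubmx z)) (fun xi => letter (inl (rshift n j)) Psi (row_mx (lsubmx z) xi)).
    split; last by move=> xi; rewrite -mulrA -pw_row; exact: HB.
    apply: cont_measC; apply: (cont_comp (@cont_row_r R n n (lsubmx z))).
    exact: smooth_cont (smooth_letter _ (rapid_smooth rP)).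
  have c' : cpb (B * pw (lsubmx z)) (fun xi => letter (inl (rshift n j)) Psi (row_mx (lsubmx z) xi)
      * cis (sg * dot (rsubmx z) xi)).
    apply: cpb_FT; last by case: c.
    apply: (cont_comp (@cont_row_r R n n (lsubmx z))).
    exact: smooth_cont (smooth_letter _ (rapid_smooth rP)).
  set LI := (LHS).
  have -> : LI = -1 * integralC (fun xi => -1 * (letter (inl (rshift n j)) Psi (row_mx (lsubmx z) xi)
      * cis (sg * dot (rsubmx z) xi))).
    by rewrite (integralCZ (-1) c') mulrA mulrNN !mul1r.
  congr (_ * integralC _).
  have z0 : (0 : E (n + n)) 0 (rshift n j) = 0 by rewrite mxE.
  apply/funext => xi; rewrite z0 mulr0 (_ : - 2 * 2^-1 = -1); last by lra.
  by rewrite rmorph0 mul0r addr0 -!mulrA rmorphN1.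
have [pg dg] := gauss_pdiff (- 2^-1) (0 : E n).
have pft : pdiff (FT sg (k0 n)) by rewrite -fE.
have [pG dG] := pdiffM pft pg.
(* Dividing by the Gaussian, through its reciprocal, leaves a function with vanishing
   derivatives. *)
have dG0 j : partial j (fun x => FT sg (k0 n) x * gauss (- 2^-1) 0 x) = fun=> 0.
  rewrite dG dk dg; apply/funext => e; rewrite !mxE mulr0.
  rewrite (_ : - 2 * - 2^-1 = 1); last by lra.
  by rewrite rmorph0 mul0r addr0 mul1r; ring.
have := pdiff_const pG dG0 eta 0.
have -> : gauss (- 2^-1) (0 : E n) 0 = 1 by rewrite /gauss sqdist00 mulr0 oppr0 expR0.
have -> : FT sg (k0 n) 0 = A n.
  congr integralC; apply/funext => xi.
  by rewrite -(scale0r (0 : E n)) dotZl mul0r mulr0 cis0 mulr1.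
rewrite mulr1 => <-.
rewrite -mulrA (_ : gauss _ _ _ * gauss _ _ _ = 1) ?mulr1//.
rewrite /gauss -rmorphM/= -expRD (_ : _ + _ = 0) ?expR0//; ring.
Qed.

Lemma cvg_harmonic_line n (y w : E n) (h : E n -> R) : continuous h ->
  h (y + (k.+1%:R : R)^-1 *: w) @[k --> \oo] --> h y.
Proof.
move=> ch; have -> : h y = (fun t : R => h (t *: w + y)) 0 by rewrite scale0r add0r.
under eq_fun do rewrite addrC.
apply: (cvg_comp (fun k : nat => (k.+1%:R : R)^-1) (fun t : R => h (t *: w + y))).
  exact: cvg_harmonic.
apply: (cvg_comp (fun t : R => t *: w + y) h); last exact: ch.
by apply: cvgD; [apply: cvgZr_tmp; exact: cvg_id|exact: cvg_cst].
Qed.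

(** The scale 1/(k + 1) sits in the argument of [u] and not in the Gaussian, so one dominating
    function serves for all k. *)
Lemma approx_identity n (u : E n -> C) B y : cont u -> (forall x, cabs (u x) <= B) ->
  let I k := integralC (fun w => u (y + (k.+1%:R : R)^-1 *: w) * k0 n w) in
  complex.Re (I k) @[k --> \oo] --> complex.Re (u y * A n) /\
  complex.Im (I k) @[k --> \oo] --> complex.Im (u y * A n).
Proof.
move=> cu bu I.
have [Bk Bk0 cb] := cpb_gauss (0 : E n) half_gt0.
rewrite -(integralCZ _ cb).
have cR w := @cvg_harmonic_line n y w _ cu.1.
have cI w := @cvg_harmonic_line n y w _ cu.2.
have B0 : 0 <= B by apply: le_trans (bu 0); exact: cabs_ge0.
apply: (@integralC_cvg R n (B * Bk)).
- move=> k; split; last first.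
    by move=> w; rewrite cabsM -mulrA; apply: ler_pM; rewrite ?cabs_ge0//; case: cb.
  apply: cont_measC; apply: contM; last exact: cont_gauss.
  have c : continuous (fun w : E n => y + (k.+1%:R : R)^-1 *: w).
    under eq_fun do rewrite addrC.
    exact: (continuous_compose (@cont_scale R n _) (@cont_add_const R n y)).
  exact: (cont_comp c cu).
- move=> w; rewrite /re_part Re_mulc; under eq_fun do rewrite Re_mulc.
  by apply: cvgB; apply: cvgM; first [exact: cvg_cst|exact: cR|exact: cI].
- move=> w; rewrite /im_part Im_mulc; under eq_fun do rewrite Im_mulc.
  by apply: cvgD; apply: cvgM; first [exact: cvg_cst|exact: cR|exact: cI].
Qed.

Lemma cont_dot_rl n : continuous (fun z : E (n + n) => dot (rsubmx z) (lsubmx z)).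
Proof.
apply: contR_sum => i; apply: contRM.
  by under eq_fun do rewrite mxE; exact: coord_cont.
by under eq_fun do rewrite mxE; exact: coord_cont.
Qed.

Lemma FT_gauss_scale n sg (eta : E n) (N : R) : 0 < N -> sg ^+ 2 = 1 ->
  FT sg (gauss (2^-1 * N^-2) (0 : E n)) eta = (N ^+ n)%:C * (A n * k0 n (N *: eta)).
Proof.
move=> N0 sg1; have Nn0 : N != 0 by rewrite gt_eqF.
have aN0 : 0 < 2^-1 * N^-2 by rewrite mulr_gt0 ?half_gt0// invr_gt0 exprn_gt0.
have [BN BN0 [_ bN]] := cpb_gauss (0 : E n) aN0.
rewrite /FT (integralC_affine 0 Nn0 (cpb_FT sg eta (@cont_gauss n _ 0) bN)).
rewrite gtr0_norm//; congr (_ * _); rewrite -(FT_gauss (N *: eta) sg1); congr integralC.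
apply/funext => xi; rewrite addr0; congr (_ * cis (sg * _)); last first.
  by rewrite dotC !dotZl dotC.
rewrite /gauss; congr ((expR (- _))%:C); rewrite -mulrA; congr (_ * _).
rewrite /sqdist mulr_sumr; apply: eq_bigr => i _; rewrite !mxE !subr0.
by rewrite exprMn mulrA mulVf ?mul1r// expf_neq0.
Qed.

(* The approximate identity is a rescaled Gaussian, inserted as a convergence
   factor in the outer integral; it contributes both factors [A n]. *)
Theorem FT_inversion n sg (u : E n -> C) K K' y : sg ^+ 2 = 1 -> cont u ->
  (forall x, cabs (u x) <= K * pw x) -> cont (FT sg u) ->
  (forall x, cabs (FT sg u x) <= K' * pw x) ->
  FT (- sg) (FT sg u) y = A n ^+ 2 * u y.
Proof.
move=> sg1 cu bu cU bU.
have cpu : cpb K u by split => //; exact: cont_measC.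
have K_0 := cpb_ge0 cpu.
have buK x : cabs (u x) <= K by rewrite (le_trans (bu x))// ler_piMr// pw_le1.
(* The inversion integral damped by a Gaussian of width k + 1; the damping makes the double integral
   over x and xi absolutely convergent. *)
pose J (k : nat) := integralC (fun xi => (FT sg u xi * cis (- sg * dot y xi)) *
  k0 n ((k.+1%:R : R)^-1 *: xi)).
have JE k : J k = A n * integralC (fun w => u (y + (k.+1%:R : R)^-1 *: w) * k0 n w).
  set N : R := k.+1%:R; have N0 : 0 < N by rewrite /N.
  have Nn0 : N != 0 by rewrite gt_eqF.
  have gN (xi : E n) : k0 n (N^-1 *: xi) = gauss (2^-1 * N^-2) 0 xi.
    rewrite /gauss; congr ((expR (- _))%:C); rewrite -mulrA; congr (_ * _).
    rewrite /sqdist mulr_sumr; apply: eq_bigr => i _; rewrite !mxE !subr0.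
    by rewrite exprMn exprVn.
  have NE (w : E n) : N *: (N^-1 *: w + y - y) = w by rewrite addrK scalerA (divff Nn0) scale1r.
  have cN : (`|N^-1| ^+ n)%:C * (N ^+ n)%:C = 1 :> C.
    by rewrite -rmorphM/= ger0_norm ?invr_ge0 ?ltW// -exprMn mulVf// expr1n.
  have Nv0 : N^-1 != 0 by rewrite invr_eq0.
  have aN0 : 0 < 2^-1 * N^-2 by rewrite mulr_gt0 ?half_gt0// invr_gt0 exprn_gt0.
  have [BN BN0 [_ bN]] := cpb_gauss (0 : E n) aN0.
  pose G (z : E (n + n)) := (u (lsubmx z) * cis (sg * dot (rsubmx z) (lsubmx z))) *
    (cis (- sg * dot y (rsubmx z)) * gauss (2^-1 * N^-2) 0 (rsubmx z)).
  have cG : cpb (K * BN) G.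
    split.
      apply: cont_measC; apply: contM; apply: contM.
      - exact: (cont_comp (@cont_lsub R n n) cu).
      - exact: (cont_cis (@contRZ R _ sg _ (@cont_dot_rl n))).
      - exact: (cont_comp (@cont_rsub R n n) (@cont_cis_dot R n (- sg) y)).
      - exact: (cont_comp (@cont_rsub R n n) (@cont_gauss n _ 0)).
    move=> z; rewrite -[z]hsubmxK /G !row_mxKl !row_mxKr pw_row !cabsM !cabs_cis mulr1 mul1r.
    rewrite mulrACA; apply: ler_pM; rewrite ?cabs_ge0//; exact: bu.
  have [_ _ H1 H2] := fubiniC cG; move: H1; rewrite H2 => /esym JH.
  have -> : J k = integralC (fun xi => integralC (fun x => G (row_mx x xi))).
    congr integralC; apply/funext => xi.
    rewrite gN -mulrA mulrC -(integralCZ _ (cpb_FT sg xi cu bu)); congr integralC.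
    by apply/funext => x; rewrite /G row_mxKl row_mxKr mulrC.
  rewrite -JH.
  (* The inner integral over xi is the transform of the damping Gaussian at x - y. *)
  have -> : (fun x => integralC (fun xi => G (row_mx x xi))) =
      fun x => u x * ((N ^+ n)%:C * (A n * k0 n (N *: (x - y)))).
    apply/funext => x; rewrite -(FT_gauss_scale _ N0 sg1).
    rewrite -(integralCZ _ (cpb_FT sg (x - y) (@cont_gauss n _ 0) bN)); congr integralC.
    apply/funext => xi; rewrite /G row_mxKl row_mxKr dotDl mulrDr cisD.
    rewrite -[- y]scaleN1r dotZl mulN1r mulrN mulNr [dot x xi]dotC; ring.
  clear J JH H2 cG G gN; have cu' : cont (fun w => u (N^-1 *: w + y)).
    exact: (cont_comp (continuous_compose (@cont_scale R n N^-1) (@cont_add_const R n y)) cu).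
  have [Bk Bk0 cb] := cpb_gauss (0 : E n) half_gt0.
  have cb' : cpb (K * Bk) (fun w => u (N^-1 *: w + y) * k0 n w).
    by apply: cpb_mul; [|exact: cont_gauss| |case: cb].
  under [in RHS]eq_fun do rewrite addrC.
  rewrite -(integralCZ _ cb').
  pose f x := u x * ((N ^+ n)%:C * (A n * k0 n (N *: (x - y)))).
  have cf : cpb (K * cabs ((N ^+ n)%:C * A n)) f.
    rewrite mulrC /f (_ : (fun x => _) = fun x => ((N ^+ n)%:C * (A n * k0 n (N *: (x - y)))) * u x);
      last by apply/funext => x; rewrite mulrC.
    apply: cpb_mul; [|exact: cu| |exact: bu].
      apply: contM; first exact: cont_cst.
      apply: contM; first exact: cont_cst.
      exact: (cont_comp (continuous_compose (@cont_add_const R n (- y)) (@cont_scale R n N))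
        (@cont_gauss n _ 0)).
    move=> x; rewrite mulrA cabsM; apply: ler_piMr; first exact: cabs_ge0.
    by apply: gauss_le1; exact: ltW half_gt0.
  (* The substitution x = w / N + y contributes N^-n, which cancels the N^n of the transformed
     Gaussian. *)
  rewrite -[fun x => _]/f (integralC_affine y Nv0 cf).
  have -> : (fun w => f (N^-1 *: w + y)) =
      fun w => ((N ^+ n)%:C * A n) * (u (N^-1 *: w + y) * k0 n w).
    by apply/funext => w; rewrite /f NE; ring.
  rewrite (integralCZ ((N ^+ n)%:C * A n) cb') (integralCZ (A n) cb').
  by rewrite -mulrA mulrA cN mul1r.
have [c1 c2] := approx_identity y cu buK.
have Jc k : cpb K' (fun xi => (FT sg u xi * cis (- sg * dot y xi)) *
    k0 n ((k.+1%:R : R)^-1 *: xi)).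
  split; last first.
    move=> xi; rewrite !cabsM cabs_cis mulr1 -[leRHS]mulr1.
    apply: ler_pM; rewrite ?cabs_ge0//; apply: gauss_le1; exact: ltW half_gt0.
  apply: cont_measC; apply: contM; first exact: contM cU (@cont_cis_dot R n _ y).
  exact: (cont_comp (@cont_scale R n _) (@cont_gauss n _ 0)).
have k01 : k0 n 0 = 1 by rewrite /gauss sqdist00 mulr0 oppr0 expR0.
have [g1 g2] := @cont_gauss n 2^-1 0.
have h1 xi := @cvg_harmonic_line n 0 xi _ g1.
have h2 xi := @cvg_harmonic_line n 0 xi _ g2.
(* The other evaluation of the limit: the damping factor tends to its value 1 at the origin. *)
have [J1 J2] : complex.Re (J k) @[k --> \oo] --> complex.Re (FT (- sg) (FT sg u) y) /\
    complex.Im (J k) @[k --> \oo] --> complex.Im (FT (- sg) (FT sg u) y).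
  have -> : FT (- sg) (FT sg u) y =
      integralC (fun xi => (FT sg u xi * cis (- sg * dot y xi)) * k0 n 0).
    by congr integralC; apply/funext => xi; rewrite k01 mulr1.
  apply: (integralC_cvg Jc) => xi.
    rewrite /re_part Re_mulc; under eq_fun do rewrite Re_mulc -[_ *: xi]add0r.
    by apply: cvgB; apply: cvgM; first [exact: cvg_cst|exact: h1|exact: h2].
  rewrite /im_part Im_mulc; under eq_fun do rewrite Im_mulc -[_ *: xi]add0r.
  by apply: cvgD; apply: cvgM; first [exact: cvg_cst|exact: h1|exact: h2].
rewrite expr2 -mulrA [A n * u y]mulrC.
apply: complex_eq.
  have J3 : complex.Re (J k) @[k --> \oo] --> complex.Re (A n * (u y * A n)).
    rewrite Re_mulc; under eq_fun do rewrite JE Re_mulc.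
    by apply: cvgB; apply: cvgM; first [exact: cvg_cst|exact: c1|exact: c2].
  exact: (cvg_unique _ J1 J3).
have J3 : complex.Im (J k) @[k --> \oo] --> complex.Im (A n * (u y * A n)).
  rewrite Im_mulc; under eq_fun do rewrite JE Im_mulc.
  by apply: cvgD; apply: cvgM; first [exact: cvg_cst|exact: c1|exact: c2].
exact: (cvg_unique _ J2 J3).
Qed.

End Inversion.

(** * Weights *)

Section Weights.
Context {R : realType}.
Local Notation C := R[i].
Local Notation E n := 'rV[R]_n.
Implicit Types s a b c : R.

(** Stands for |x|^(1/s). By [enorm_le_wt] and [wt_le_enorm] the two agree up to a factor, absorbed
    in h or eps, and an additive constant, absorbed in the leading constant. *)
Definition wt n s (x : E n) : R := rho x `^ s^-1.

(** The sum is at most twice the larger term, and 2^(1/s) <= 4 because s >= 1/2. *)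
Lemma powR_addn_le s a b : 2^-1 <= s -> 0 <= a -> 0 <= b ->
  (a + b) `^ s^-1 <= 4 * (a `^ s^-1 + b `^ s^-1).
Proof.
move=> s2.
have s0 : 0 < s by lra.
have p0 : 0 <= s^-1 by rewrite invr_ge0 ltW.
have p2 : s^-1 <= 2 by rewrite -[leRHS]invrK lef_pV2 ?posrE ?invr_gt0.
have main u v : 0 <= u -> u <= v -> (u + v) `^ s^-1 <= 4 * (u `^ s^-1 + v `^ s^-1).
  move=> u0 uv; have v0 := le_trans u0 uv.
  apply: (@le_trans _ _ ((2 * v) `^ s^-1)).
    by rewrite ge0_ler_powR ?nnegrE ?addr_ge0// ?mulr_ge0//; lra.
  rewrite powRM//; apply: (@le_trans _ _ (4 * v `^ s^-1)).
    rewrite ler_wpM2r ?powR_ge0// (le_trans (ler_powR _ p2)) ?ler1n//.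
    by rewrite powR_mulrn//; lra.
  by rewrite ler_wpM2l// lerDr powR_ge0.
move=> a0 b0; have [ab|/ltW ba] := leP a b; first exact: main.
by rewrite addrC [X in _ * X]addrC; exact: main.
Qed.

Lemma wt_ge0 n s (x : E n) : 0 <= wt s x. Proof. exact: powR_ge0. Qed.

Lemma wtN n s (x : E n) : wt s (- x) = wt s x. Proof. by rewrite /wt rhoN. Qed.

Lemma wtD n s (x y : E n) : 2^-1 <= s -> wt s (x + y) <= 4 * (wt s x + wt s y).
Proof.
move=> s2; have s0 : 0 <= s^-1 by rewrite invr_ge0; lra.
apply: le_trans (powR_addn_le s2 (rho_ge0 x) (rho_ge0 y)).
apply: ge0_ler_powR; rewrite ?nnegrE ?rho_ge0//; [by rewrite addr_ge0 ?rho_ge0|exact: rhoD].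
Qed.

Lemma wt_le_sub n s (x y : E n) : 2^-1 <= s -> wt s x / 4 - wt s y <= wt s (y - x).
Proof.
move=> s2; have := wtD (x - y) y s2; rewrite subrK -(opprB y x) wtN; lra.
Qed.

(** The reason why test functions of order 1/2 absorb a growth exp(eps wt s x) for small eps. *)
Lemma wt_half n s (x : E n) : 2^-1 <= s -> wt s x <= wt 2^-1 x.
Proof.
move=> s2; rewrite /wt ler_powR ?rho_ge1// lef_pV2 ?posrE ?invr_gt0//; lra.
Qed.

Lemma enorm_ge0 n (x : E n) : 0 <= enorm x. Proof. exact: sqrtr_ge0. Qed.

Lemma coord_le_enorm n (x : E n) i : `|x 0 i| <= enorm x.
Proof.
rewrite -sqrtr_sqr /enorm ler_sqrt ?expr2; last first.
  by rewrite /dot sumr_ge0// => j _; rewrite -expr2 sqr_ge0.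
by rewrite /dot (bigD1 i)//= lerDl sumr_ge0// => j _; rewrite -expr2 sqr_ge0.
Qed.

Lemma enorm_le_rho n (x : E n) : enorm x <= rho x.
Proof.
have S0 : 0 <= \sum_(i < n) `|x 0 i| by rewrite sumr_ge0.
rewrite -[leRHS]ger0_norm ?rho_ge0// -sqrtr_sqr /enorm ler_sqrt ?sqr_ge0//.
apply: (@le_trans _ _ ((\sum_(i < n) `|x 0 i|) ^+ 2)); last first.
  by rewrite lerXn2r ?nnegrE ?rho_ge0// /rho lerDr.
rewrite expr2 mulr_suml /dot ler_sum// => i _.
rewrite -expr2 -real_normK ?num_real// expr2 ler_wpM2l//.
by rewrite (bigD1 i)//= lerDl sumr_ge0.
Qed.

Lemma enorm_le_wt n s (x : E n) : 0 < s -> enorm x `^ s^-1 <= wt s x.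
Proof.
move=> s0; rewrite /wt ge0_ler_powR ?nnegrE ?rho_ge0 ?enorm_ge0 ?enorm_le_rho//.
by rewrite invr_ge0 ltW.
Qed.

Lemma wt_le_enorm n s (x : E n) : 2^-1 <= s ->
  wt s x <= 4 * (1 + n.+1%:R `^ s^-1 * enorm x `^ s^-1).
Proof.
move=> s2; have s0 : 0 <= s^-1 by rewrite invr_ge0; lra.
have e0 := enorm_ge0 x.
have ne0 : 0 <= n.+1%:R * enorm x by rewrite mulr_ge0.
have := powR_addn_le s2 ler01 ne0; rewrite powR1 powRM// => /(le_trans _); apply.
rewrite /wt ge0_ler_powR ?nnegrE ?rho_ge0 ?addr_ge0// /rho lerD2l.
apply: (@le_trans _ _ (\sum_(i < n) enorm x)).
  by apply: ler_sum => i _; exact: coord_le_enorm.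
by rewrite sumr_const card_ord -[leLHS]mulr_natl ler_wpM2r// ler_nat.
Qed.

(** The power 2 n of [rho] dominates the product of the 1 + x_i^2, and [powX_le_expR] bounds it by
    an exponential. *)
Lemma pw_of_exp n s c : 0 < s -> 0 < c -> exists2 K, 0 < K &
  forall x : E n, expR (- (c * wt s x)) <= K * pw x.
Proof.
move=> s0 c0; have [h h0 H] := powX_le_expR s0 c0.
exists (h ^+ (2 * n) * factp s (2 * n)).
  by rewrite mulr_gt0 ?exprn_gt0 ?factp_gt0.
move=> x; have r0 := rho_gt0 x.
have pr : (rho x ^+ (2 * n))^-1 <= pw x.
  have -> : rho x ^+ (2 * n) = \prod_(i < n) rho x ^+ 2 by rewrite prodr_const card_ord exprM.
  rewrite /pw prodfV.
  rewrite lef_pV2 ?posrE; [|by apply: prodr_gt0 => i _; rewrite exprn_gt0|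
    by apply: prodr_gt0 => i _; exact: one_sqr_gt0].
  apply: ler_prod => i _; rewrite ltW ?one_sqr_gt0//= -real_normK ?num_real//.
  have xi : 1 + `|x 0 i| <= rho x by rewrite /rho lerD2l (bigD1 i)//= lerDl sumr_ge0.
  have : (1 + `|x 0 i|) ^+ 2 <= rho x ^+ 2 by have := normr_ge0 (x 0 i); nra.
  by apply: le_trans; have := normr_ge0 (x 0 i); nra.
have := H (rho x) (2 * n)%N (ltW r0); rewrite -/(wt s x) => Hx.
have kf0 : 0 < h ^+ (2 * n) * factp s (2 * n) by rewrite mulr_gt0 ?exprn_gt0 ?factp_gt0.
apply: le_trans (ler_wpM2l (ltW kf0) pr).
by rewrite expRN ler_pdivlMr ?exprn_gt0// mulrC ler_pdivrMr ?expR_gt0.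
Qed.

(** Some coordinate carries a fixed fraction of [rho], and decay in it is decay in [wt], unless
    [rho] is at most n + 1, where the hypothesis A <= r takes over. *)
Lemma exp_of_coords n s h : 0 < s -> 0 < h -> exists K c, [/\ 0 < K, 0 < c &
  forall A r (x : E n), 0 <= A -> 0 <= r -> A <= r ->
    (forall j m, A * `|x 0 j| ^+ m <= r * h ^+ m * factp s m) ->
    A <= K * r * expR (- (c * wt s x))].
Proof.
move=> s0 h0; have [c c0 H] := le_expR_of_powX s0 h0.
have p0 : 0 <= s^-1 by rewrite invr_ge0 ltW.
pose D : R := n.+1%:R `^ s^-1; have D0 : 0 < D by rewrite powR_gt0.
have cD0 : 0 < c / D by rewrite divr_gt0.
(* The term 2^s comes from [le_expR_of_powX]; [expR c] compensates the decay factor where [rho] is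
   at most n + 1. *)
exists (2 `^ s + expR c), (c / D).
have t0 : 0 < 2 `^ s :> R by rewrite powR_gt0.
split; [by rewrite addr_gt0// expR_gt0|by []|].
move=> A r x A0 r0 Ar Hx.
have wD (t : R) : 0 <= t -> rho x <= n.+1%:R * t -> c / D * wt s x <= c * t `^ s^-1.
  move=> t0' rt; rewrite mulrAC ler_pdivrMr// -mulrA ler_wpM2l ?(ltW c0)//.
  rewrite mulrC -powRM// /wt ge0_ler_powR ?nnegrE ?mulr_ge0 ?rho_ge0//.
have [rx|[i ri]] := rho_max x.
  have := wD 1 ler01; rewrite mulr1 => /(_ rx); rewrite powR1 mulr1 => wc.
  have e1 : 1 <= expR c * expR (- (c / D * wt s x)).
    by rewrite -expRD -expR0 ler_expR subr_ge0.
  rewrite mulrAC mulrC mulrDl (le_trans Ar)// -[leLHS]mulr1 ler_wpM2l//.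
  by rewrite (le_trans e1)// lerDr mulr_ge0 ?expR_ge0// ltW.
have := H A r _ A0 r0 (normr_ge0 (x 0 i)) (Hx i) => /le_trans; apply.
apply: ler_pM; rewrite ?mulr_ge0 ?expR_ge0 ?(ltW t0)//.
  by rewrite ler_wpM2r// lerDl expR_ge0.
by rewrite ler_expR lerN2 wD.
Qed.

End Weights.

(** * From the symbol to its short-time Fourier transform *)

Section GammaWords.
Context {R : realType} {n : nat}.
Local Notation C := R[i].
Local Notation E := 'rV[R]_n.
Implicit Types (s : R) (f g u phi : E -> C) (x y : E).

Lemma Gamma_dl s g : 2^-1 <= s -> Gamma n s g -> smooth g /\
  exists2 e, 1 <= e & forall h, 0 < h -> exists2 K, 0 < K &
    forall l x, cabs (dl l g x) <= K * e ^+ size l * factp s (size l) * expR (h * wt s x).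
Proof.
move=> s2 [sg [e e0 He]]; have s0 : 0 < s by lra.
split=> //; exists (Num.max 1 e); first by rewrite le_max lexx.
move=> h h0; have [K K0 HK] := He h h0; exists K => // l x.
rewrite dl_mpartial// (le_trans (HK _ _))// mlen_count -!mulrA ler_wpM2l ?(ltW K0)//.
apply: ler_pM; rewrite ?mulr_ge0 ?powR_ge0 ?expR_ge0 ?exprn_ge0 ?(ltW e0)//.
  by rewrite lerXn2r ?nnegrE ?le_max ?lexx ?orbT ?(ltW e0)// ltW.
apply: ler_pM; rewrite ?powR_ge0 ?expR_ge0//.
  rewrite /factp ge0_ler_powR ?nnegrE ?(ltW s0)// ler_nat.
  by rewrite (leq_trans (mfact_le _))// mlen_count.
by rewrite ler_expR ler_wpM2l ?(ltW h0)// enorm_le_wt.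
Qed.

Lemma Gamma_of_dl s g e : 2^-1 <= s -> smooth g -> 0 < e ->
  (forall h, 0 < h -> exists2 K, 0 < K &
    forall l x, cabs (dl l g x) <= K * e ^+ size l * factp s (size l) * expR (h * wt s x)) ->
  Gamma n s g.
Proof.
move=> s2 sg e0 He; have s0 : 0 < s by lra.
split=> //; exists (e * (2 ^+ n) `^ s); first by rewrite mulr_gt0 ?powR_gt0 ?exprn_gt0.
move=> h h0; pose D : R := n.+1%:R `^ s^-1; have D0 : 0 < D by rewrite powR_gt0.
(* [wt_le_enorm] loses a factor 4 D and an additive 4: h' undoes the former, exp(4 h') pays for the
   latter. *)
pose h' := h / (4 * D); have h'0 : 0 < h' by rewrite divr_gt0 ?mulr_gt0.
have [K K0 HK] := He _ h'0; exists (K * expR (4 * h')); first by rewrite mulr_gt0 ?expR_gt0.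
move=> a x; rewrite mpartialE (le_trans (HK _ _))// size_mword.
set m := mlen a.
have E1 : expR (h' * wt s x) <= expR (4 * h') * expR (h * enorm x `^ s^-1).
  rewrite -expRD ler_expR (le_trans (ler_wpM2l (ltW h'0) (wt_le_enorm x s2)))//.
  rewrite -/D mulrDr mulr1 mulrDr [h' * 4]mulrC lerD2l.
  by rewrite /h' le_eqVlt; apply/orP; left; apply/eqP; field; rewrite gt_eqF.
have E2 : factp s m <= ((2 ^+ n) `^ s) ^+ m * (mfact a)%:R `^ s.
  rewrite /factp powRX ?exprn_ge0// -powRM ?exprn_ge0//.
  rewrite ge0_ler_powR ?nnegrE ?mulr_ge0 ?exprn_ge0 ?(ltW s0)//.
  by rewrite -exprM -natrX -natrM ler_nat mlen_fact_le.
rewrite exprMn.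
have -> : K * expR (4 * h') * (e ^+ m * ((2 ^+ n) `^ s) ^+ m * (mfact a)%:R `^ s *
    expR (h * enorm x `^ s^-1)) = K * e ^+ m * (((2 ^+ n) `^ s) ^+ m * (mfact a)%:R `^ s) *
    (expR (4 * h') * expR (h * enorm x `^ s^-1)) by ring.
apply: ler_pM; rewrite ?mulr_ge0 ?exprn_ge0 ?factp_ge0 ?expR_ge0 ?(ltW K0) ?(ltW e0)//.
by rewrite ler_wpM2l ?mulr_ge0 ?exprn_ge0 ?(ltW K0) ?(ltW e0).
Qed.

Lemma shift_pdiff v f : pdiff f -> pdiff (fun y => f (y + v)) /\
  forall j, partial j (fun y => f (y + v)) = fun y => partial j f (y + v).
Proof.
move=> pf; apply: (pdiff_of_isd (df := fun j y => partial j f (y + v))).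
  exact: (cont_comp (@cont_add_const R n v) (pdiff_cont pf)).
move=> j y; apply: (isd_line (f := f) (x := y + v) (v := unit_vec j)); last exact: pdiff_isd.
by move=> t; rewrite addrA.
Qed.

Lemma smooth_shift v f : smooth f -> smooth (fun y => f (y + v)).
Proof.
move=> sf; apply: (smooth_coind
  (P := fun h => exists2 f, smooth f & h = fun y => f (y + v))); last by exists f.
move=> _ [g sg ->]; have [p H] := shift_pdiff v (smooth_pdiff sg); split; first exact: p.
by move=> i; rewrite H; exists (partial i g); [exact: smooth_partial|].
Qed.

Lemma dl_shift v l f : smooth f -> dl l (fun y => f (y + v)) = fun y => dl l f (y + v).
Proof.
elim/last_ind: l f => // l i IH f sf; rewrite !dl_rcons.
by rewrite (shift_pdiff v (smooth_pdiff sf)).2 IH; [|exact: smooth_partial].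
Qed.

Lemma pw_sub_le x y : pw (y - x) <= pwinv (- x) * pw y.
Proof. exact: pw_shift. Qed.

(** The bound is uniform in x because the integral is translated back before it is estimated; the
    constant [pwinv (- x)] only secures integrability. *)
Lemma integralC_le_shift M f x : cont f -> (forall y, cabs (f y) <= M * pw (y - x)) ->
  cabs (integralC f) <= 2 * M * pwI n.
Proof.
move=> cf bf.
have M0 : 0 <= M.
  rewrite -(pmulr_lge0 _ (pw_gt0 (0 - x))); apply: le_trans (bf 0); exact: cabs_ge0.
have c1 : cpb (M * pwinv (- x)) f.
  split; first exact: cont_measC.
  by move=> y; rewrite (le_trans (bf y))// -mulrA ler_wpM2l// pw_sub_le.
rewrite (integralC_affine x (oner_neq0 R) c1) normr1 expr1n mul1r.
apply: integralC_le; split.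
  apply: cont_measC.
  exact: (cont_comp (continuous_compose (@cont_scale R n 1) (@cont_add_const R n x)) cf).
by move=> y; rewrite (le_trans (bf _))// addrK scale1r.
Qed.

Lemma FT_parts_iter sg u (eta : E) j m : sg ^+ 2 = 1 -> smooth u ->
  (forall l, exists B, forall y, cabs (dl l u y) <= B * pw y) ->
  `|eta 0 j| ^+ m * cabs (FT sg u eta) = cabs (FT sg (dl (nseq m j) u) eta).
Proof.
move=> sg1 su bu; elim: m => [|m IH]; first by rewrite expr0 mul1r.
rewrite exprS -mulrA IH -cabs_real -cabsM.
set v := dl (nseq m j) u.
have sv : smooth v by exact: smooth_dl.
have [B0 HB0] := bu (nseq m j).
have /choice[B HB] : forall i, exists B, forall y, cabs (partial i v y) <= B * pw y.
  by move=> i; exact: bu (i :: nseq m j).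
have B0_0 : 0 <= B0 by rewrite -(pmulr_lge0 _ (pw_gt0 (0 : E))); apply: le_trans (HB0 0); exact: cabs_ge0.
have B_0 i : 0 <= B i by rewrite -(pmulr_lge0 _ (pw_gt0 (0 : E))); apply: le_trans (HB i 0); exact: cabs_ge0.
rewrite (@FT_parts R n sg v eta j (B0 + \sum_(i < n) B i)).
- rewrite cabsM (_ : cabs _ = 1) ?mul1r//.
  by rewrite /cabs/= expr0n add0r sg1 sqrtr1.
- exact: smooth_pdiff.
- by move=> i; exact: smooth_cont (smooth_partial i sv).
- exact: sg1.
- move=> y; rewrite (le_trans (HB0 y))// ler_wpM2r ?pw_ge0// lerDl sumr_ge0//.
- move=> i y; rewrite (le_trans (HB i y))// ler_wpM2r ?pw_ge0// (bigD1 i)//= addrCA lerDl.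
  by rewrite addr_ge0// sumr_ge0.
Qed.

Definition windowed g phi x : E -> C := fun y => g y * conjc (phi (y - x)).

Lemma smooth_windowed g phi x : smooth g -> smooth phi -> smooth (windowed g phi x).
Proof.
by move=> sg sp; exact: (smoothM sg (smooth_conj (smooth_shift (- x) sp))).
Qed.

(** The growth of g at y is moved to x by wt y <= 4 (wt (y - x) + wt x). As 8 h <= c, the part in y
    - x uses at most half of the decay of [phi], and the other half yields [pw (y - x)]. The 2 in
    the base counts Leibniz terms. *)
Lemma windowed_dl_le s g phi e Kp Hp c : 2^-1 <= s -> smooth g -> 1 <= e ->
  (forall h, 0 < h -> exists2 K, 0 < K & forall l x,
     cabs (dl l g x) <= K * e ^+ size l * factp s (size l) * expR (h * wt s x)) ->
  smooth phi -> 0 < Kp -> 1 <= Hp -> 0 < c ->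
  (forall l x, cabs (dl l phi x) <=
     Kp * Hp ^+ size l * factp s (size l) * expR (- (c * wt s x))) ->
  forall h, 0 < h -> 8 * h <= c -> exists2 M, 0 < M & forall x l y,
    cabs (dl l (windowed g phi x) y) <= M * expR (4 * h * wt s x) *
      (2 * (e * Hp)) ^+ size l * factp s (size l) * pw (y - x).
Proof.
move=> s2 sg e1 bg sp Kp0 Hp1 c0 bp h h0 hc.
have s0 : 0 < s by lra.
have [Kg Kg0 HKg] := bg h h0.
have c2 : 0 < c / 2 by rewrite divr_gt0.
have [Kw Kw0 HKw] := @pw_of_exp R n s (c / 2) s0 c2.
exists (Kg * Kp * Kw); first by rewrite !mulr_gt0.
move=> x l y.
have sps : smooth (fun y => conjc (phi (y - x))).
  exact: (smooth_conj (smooth_shift (- x) sp)).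
pose B := Kg * Kp * (e * Hp) ^+ size l * factp s (size l) * (expR (4 * h * wt s x) * (Kw * pw (y - x))).
have -> : Kg * Kp * Kw * expR (4 * h * wt s x) * (2 * (e * Hp)) ^+ size l *
    factp s (size l) * pw (y - x) = 2 ^+ size l * B.
  by rewrite /B [(2 * _) ^+ _]exprMn; ring.
apply: dl_mul_le => // l1 l2 l12.
rewrite (dl_conj _ (smooth_shift (- x) sp)) cabs_conj (dl_shift _ _ sp).
apply: (le_trans (ler_pM (cabs_ge0 _) (cabs_ge0 _) (HKg l1 y) (bp l2 (y - x)))).
have e0 : 0 <= e by lra.
have Hp0 : 0 <= Hp by lra.
rewrite [leLHS](_ : _ = Kg * Kp * (e ^+ size l1 * Hp ^+ size l2) *
  (factp s (size l1) * factp s (size l2)) *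
  (expR (h * wt s y) * expR (- (c * wt s (y - x))))); last by ring.
apply: ler_pM; rewrite ?mulr_ge0 ?exprn_ge0 ?factp_ge0 ?expR_ge0 ?(ltW Kg0) ?(ltW Kp0)//.
  apply: ler_pM; rewrite ?mulr_ge0 ?exprn_ge0 ?factp_ge0 ?(ltW Kg0) ?(ltW Kp0)//.
    rewrite ler_wpM2l ?mulr_ge0 ?(ltW Kg0) ?(ltW Kp0)// exprMn -l12.
    by apply: ler_pM; rewrite ?exprn_ge0// ler_weXn2l// ?leq_addr ?leq_addl.
  by rewrite -l12; apply: factpM; exact: ltW.
apply: (@le_trans _ _ (expR (4 * h * wt s x) * expR (- (c / 2 * wt s (y - x))))); last first.
  by rewrite ler_wpM2l ?expR_ge0.
rewrite -!expRD ler_expR.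
have := wtD (y - x) x s2; rewrite subrK => w.
have := ler_wpM2l (ltW h0) w.
have := ler_wpM2r (wt_ge0 s (y - x)) hc.
by have := wt_ge0 s x; lra.
Qed.

End GammaWords.

(** * Decay of the transform in xi and its identification as a distribution *)

Section StftDecay.
Context {R : realType} {n : nat}.
Local Notation C := R[i].
Local Notation E := 'rV[R]_n.
Implicit Types (s : R) (f g u phi : E -> C) (x y : E).

(** The order of quantifiers matters: c' depends only on s, the dimension and the base 2 e Hp of the
    derivative bounds, which is the same for all h, so the decay rate in xi is fixed before the
    growth rate in x. *)
Lemma stft_decay s g phi e Kp Hp c : 2^-1 <= s -> smooth g -> 1 <= e ->
  (forall h, 0 < h -> exists2 K, 0 < K & forall l x,
     cabs (dl l g x) <= K * e ^+ size l * factp s (size l) * expR (h * wt s x)) ->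
  smooth phi -> 0 < Kp -> 1 <= Hp -> 0 < c ->
  (forall l x, cabs (dl l phi x) <=
     Kp * Hp ^+ size l * factp s (size l) * expR (- (c * wt s x))) ->
  exists2 c', 0 < c' & forall h, 0 < h -> 8 * h <= c -> exists2 M, 0 < M & forall x xi,
    cabs (FT (-1) (windowed g phi x) xi) <= M * expR (4 * h * wt s x - c' * wt s xi).
Proof.
move=> s2 sg e1 bg sp Kp0 Hp1 c0 bp.
have s0 : 0 < s by lra.
have H0 : 0 < 2 * (e * Hp) by rewrite mulr_gt0// mulr_gt0//; lra.
have [K [c' [K0 c'0 HK]]] := @exp_of_coords R n s _ s0 H0.
exists c' => // h h0 hc.
have [M M0 HM] := windowed_dl_le s2 sg e1 bg sp Kp0 Hp1 c0 bp h0 hc.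
have I0 := pwI_ge0 (R := R) n.
exists (K * (2 * M * pwI n) + 1) => [|x xi].
  by rewrite ltr_wpDl// !mulr_ge0// ltW.
pose u := windowed g phi x; have su : smooth u := smooth_windowed x sg sp.
pose r := 2 * (M * expR (4 * h * wt s x)) * pwI n.
have bu l : exists B, forall y, cabs (dl l u y) <= B * pw y.
  exists (M * expR (4 * h * wt s x) * (2 * (e * Hp)) ^+ size l * factp s (size l) * pwinv (- x)).
  move=> y; rewrite (le_trans (HM x l y))// -[leRHS]mulrA.
  rewrite ler_wpM2l ?pw_sub_le// !mulr_ge0 ?expR_ge0 ?factp_ge0 ?exprn_ge0 ?(ltW M0)//.
  exact: ltW.
have dlb l : cabs (FT (-1) (dl l u) xi) <=
    r * (2 * (e * Hp)) ^+ size l * factp s (size l).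
  pose Ml := M * expR (4 * h * wt s x) * (2 * (e * Hp)) ^+ size l * factp s (size l).
  have -> : r * (2 * (e * Hp)) ^+ size l * factp s (size l) = 2 * Ml * pwI n.
    by rewrite /r /Ml; ring.
  apply: (@integralC_le_shift R n Ml _ x).
    apply: contM; first exact: smooth_cont (smooth_dl l su).
    exact: cont_cis_dot.
  by move=> y; rewrite cabsM cabs_cis mulr1; exact: HM.
have r0 : 0 <= r by rewrite /r !mulr_ge0 ?expR_ge0// ltW.
have := HK (cabs (FT (-1) u xi)) r xi (cabs_ge0 _) r0.
have n1 : (-1 : R) ^+ 2 = 1 by rewrite sqrrN expr1n.
move=> /(_ _ _)/le_trans; apply.
- by have := dlb [::]; rewrite /= expr0 factp0 !mulr1.
- move=> j m; rewrite mulrC (FT_parts_iter xi j m n1 su bu).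
  by have := dlb (nseq m j); rewrite size_nseq.
rewrite expRD [leRHS]mulrA; apply: ler_wpM2r; first exact: expR_ge0.
rewrite [leRHS]mulrDl; apply: ler_wpDr; first by rewrite mul1r expR_ge0.
rewrite /r.
by rewrite le_eqVlt; apply/orP; left; apply/eqP; ring.
Qed.

Lemma wt_lsub s (z : 'rV[R]_(n + n)) : 0 < s -> wt s (lsubmx z) <= wt s z.
Proof.
move=> s0; rewrite /wt ge0_ler_powR ?nnegrE ?rho_ge0 ?invr_ge0 ?(ltW s0)//.
rewrite /rho lerD2l big_split_ord/= (eq_bigr (fun i => `|z 0 (lshift n i)|)).
  by rewrite lerDl sumr_ge0.
by move=> i _; rewrite mxE.
Qed.

Lemma cont_dot_maps m (A B : 'rV[R]_m -> E) : continuous A -> continuous B ->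
  continuous (fun z => dot (A z) (B z)).
Proof.
move=> cA cB; apply: contR_sum => i.
apply: contRM.
  exact: (continuous_compose cA (@coord_cont R n i)).
exact: (continuous_compose cB (@coord_cont R n i)).
Qed.

Lemma cont_sub_maps m (A B : 'rV[R]_m -> E) : continuous A -> continuous B ->
  continuous (fun z => A z - B z).
Proof.
move=> cA cB; apply: cont_rV => i.
have -> : (fun z => (A z - B z) 0 i) = fun z => A z 0 i + -1 * B z 0 i.
  by apply/funext => z; rewrite !mxE mulN1r.
apply: contRD; first exact: (continuous_compose cA (@coord_cont R n i)).
exact: (@contRZ R m (-1) _ (continuous_compose cB (@coord_cont R n i))).
Qed.

Lemma pwN x : pw (- x) = pw x.
Proof. by apply: eq_bigr => i _; rewrite mxE sqrrN. Qed.

Lemma conjc_real (a : R) (z : C) : conjc (a%:C * z) = a%:C * conjc z.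
Proof. by case: z => p q; apply: complex_eq => /=; ring. Qed.

Lemma fourier_sndE (Psi : 'rV[R]_(n + n) -> C) z :
  fourier_snd Psi z = ((2 * pi) `^ (- (n%:R / 2)))%:C * FT2 (-1) Psi z.
Proof.
rewrite /fourier_snd /FT2 /FT; congr (_ * integralC _); apply/funext => xi.
by rewrite mulN1r.
Qed.

(** The substitution x -> y - x gives the test function the form [twisted], whose order is known; a
    real factor passes through the conjugation into the window. *)
Lemma twist_testE phi Kp (Psi : 'rV[R]_(n + n) -> C) K H (a : R) : cont phi ->
  (forall x, cabs (phi x) <= Kp * pw x) -> 0 < K -> 1 <= H -> wordb 2^-1 K H Psi ->
  (fun y => integralC (fun x => conjc (phi (y - x)) * (a%:C * FT2 (-1) Psi (row_mx x y)))) =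
  twisted (fun x => a%:C * phi x) (FT2 (-1) Psi).
Proof.
move=> cp bp K0 H1 wP.
have n1 : (-1 : R) ^+ 2 = 1 by rewrite sqrrN expr1n.
have h0 : 0 <= 2^-1 :> R by rewrite invr_ge0.
have [K1 [H2 [K10 H21 w1]]] := wordb_FT2 n1 h0 K0 H1 wP.
have r1 := rapid_of_wordb h0 K10 H21 w1.
have [B B0 HB] := rapid_bound r1.
have bB z : cabs (FT2 (-1) Psi z) <= B by rewrite (le_trans (HB z))// ler_piMr// pw_le1.
have ba x : cabs (a%:C * phi x) <= (`|a| * Kp) * pw x.
  by rewrite cabsM cabs_real -mulrA ler_wpM2l.
apply/funext => y.
have ca := contM (@cont_cst R n a%:C) cp.
have c1 := cpb_twisted y ca ba (smooth_cont (rapid_smooth r1)) bB.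
have N0 : -1 != 0 :> R by rewrite oppr_eq0 oner_eq0.
rewrite /twisted (integralC_affine y N0 c1) normrN1 expr1n mul1r.
congr integralC; apply/funext => x.
rewrite scaleN1r [- x + y]addrC conjc_real subKr.
by rewrite mulrCA mulrA.
Qed.

(** From wt (y - x) >= wt y / 4 - wt x and c1 <= c, decay in y - x yields decay c1/4 in y at the
    price of growth c1 in x; half of that decay absorbs the first factor. *)
Lemma exp_wt_shift_le s c c1 x y : 2^-1 <= s -> 0 < c1 -> c1 <= c ->
  expR (c1 / 8 * wt s y) * expR (- (c * wt s (y - x))) <=
  expR (c1 * wt s x) * expR (- (c1 / 8 * wt s y)).
Proof.
move=> s2 c10 c1c; have w := wt_le_sub y x s2; have w0 := wt_ge0 s (y - x).
rewrite -(wtN s (y - x)) opprB in w0 *; have w1 := ler_wpM2r w0 c1c.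
have w2 := ler_wpM2l (ltW c10) w.
move: w1 w2; clear; move: (wt s (x - y)) (wt s x) (wt s y) => t u v w1 w2.
by rewrite -!expRD ler_expR; lra.
Qed.

(** Both pairings are iterated integrals of one function of (y, x, xi), and its domination by [pw]
    on the triple product justifies every exchange. *)
Lemma is_function_stft s (T : functional R n) g phi Kp c : 2^-1 <= s -> cont g ->
  (forall h, 0 < h -> exists2 K, 0 < K & forall x, cabs (g x) <= K * expR (h * wt s x)) ->
  cont phi -> 0 < c -> (forall x, cabs (phi x) <= Kp * expR (- (c * wt s x))) ->
  is_function T g ->
  is_function (STFT phi T) (fun z => ((2 * pi) `^ (- (n%:R / 2)))%:C *
    FT (-1) (windowed g phi (lsubmx z)) (rsubmx z)).
Proof.
move=> s2 cg bg cp c0 bp fg Psi GPsi.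
set a : R := (2 * pi) `^ _.
have s0 : 0 < s by lra.
have hf0 : 0 < 2^-1 :> R by rewrite invr_gt0.
have n1 : (-1 : R) ^+ 2 = 1 by rewrite sqrrN expr1n.
have Kp0 : 0 <= Kp.
  by rewrite -(pmulr_lge0 _ (expR_gt0 (- (c * wt s (0 : E))))) (le_trans _ (bp 0)) ?cabs_ge0.
have [Kw Kw0 HKw] := @pw_of_exp R n s c s0 c0.
have bpw x : cabs (phi x) <= (Kp * Kw) * pw x.
  by rewrite (le_trans (bp x))// -mulrA ler_wpM2l.
have [K0 [H0 [K00 H01 dP]]] := decay_of_GS (ltW hf0) GPsi.
have sP : smooth Psi by case: dP.
have [K2 [H2 [c2 [K20 H21 c20 bP]]]] := decay_exp hf0 (ltW K00) H01 dP.
have {}bP z : cabs (Psi z) <= K2 * expR (- (c2 * wt 2^-1 z)).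
  by have := bP [::] z; rewrite expr0 factp0 !mulr1.
have wP := wordb_of_decay (lexx _) (ltW K00) H01 dP.
have H0_1 : 1 <= 2 * H0 by lra.
have [K1 [H1 [K10 H11 w1]]] := wordb_FT2 n1 (ltW hf0) K00 H0_1 wP.
have r1 := rapid_of_wordb (ltW hf0) K10 H11 w1.
pose zeta := twisted (fun x => a%:C * phi x) (FT2 (-1) Psi).
have ca := contM (@cont_cst R n a%:C) cp.
have ba x : cabs (a%:C * phi x) <= (`|a| * (Kp * Kw)) * pw x.
  by rewrite cabsM cabs_real -mulrA ler_wpM2l.
have Gz : GS n 2^-1 zeta.
  have [K3 [H3 [K30 H31 w3]]] := wordb_twisted ca ba (ltW hf0) K10 H11 w1.
  exact: GS_of_wordb (ltW hf0) K30 (lt_le_trans ltr01 H31) w3.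
have zE := twist_testE a cp bpw K00 H0_1 wP.
have SE : STFT phi T Psi = T zeta.
  have fE : fourier_snd Psi = fun z => a%:C * FT2 (-1) Psi z.
    by apply/funext => z; rewrite fourier_sndE.
  by rewrite /STFT /fourier_snd_dual /twist fE zE.
have [_ fz] := fg _ Gz.
(* Small enough for [exp_wt_shift_le], and for the remaining growth c1 wt x to use at most half of
   the decay of [Psi]. *)
pose c1 := Num.min c (c2 / 2).
have c10 : 0 < c1 by rewrite lt_min c0 divr_gt0.
have c1c : c1 <= c by rewrite ge_min lexx.
have c1c2 : c1 <= c2 / 2 by rewrite ge_min lexx orbT.
have h0 : 0 < c1 / 8 by rewrite divr_gt0.
have [Kg Kg0 HKg] := bg _ h0.
have [Ky Ky0 HKy] := @pw_of_exp R n s (c1 / 8) s0 h0.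
have c22 : 0 < c2 / 2 by rewrite divr_gt0.
have [Kz Kz0 HKz] := @pw_of_exp R (n + n) 2^-1 (c2 / 2) hf0 c22.
have bw x y : cabs (windowed g phi x y) <=
    (Kg * Kp) * (expR (c1 * wt s x) * expR (- (c1 / 8 * wt s y))).
  rewrite /windowed cabsM cabs_conj.
  apply: (le_trans (ler_pM (cabs_ge0 _) (cabs_ge0 _) (HKg y) (bp (y - x)))).
  rewrite mulrACA; apply: ler_wpM2l; first by rewrite mulr_ge0// ltW.
  exact: exp_wt_shift_le.
have bwx x : exists B, forall y, cabs (windowed g phi x y) <= B * pw y.
  exists ((Kg * Kp) * (expR (c1 * wt s x) * Ky)) => y.
  rewrite (le_trans (bw x y))// -[leRHS]mulrA.
  apply: ler_wpM2l; first by rewrite mulr_ge0// ltW.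
  by rewrite -[leRHS]mulrA; apply: ler_wpM2l; [exact: expR_ge0|exact: HKy].
have cw x : cont (windowed g phi x).
  by apply: contM => //; apply: cont_conj; exact: (cont_comp (@cont_add_const R n (- x)) cp).
pose G (Z : 'rV[R]_(n + (n + n))) := (a%:C * Psi (rsubmx Z)) *
  (windowed g phi (lsubmx (rsubmx Z)) (lsubmx Z) *
   cis (-1 * dot (rsubmx (rsubmx Z)) (lsubmx Z))).
have cx : continuous (fun Z : 'rV[R]_(n + (n + n)) => lsubmx (rsubmx Z)).
  exact: (continuous_compose (@cont_rsub R n (n + n)) (@cont_lsub R n n)).
have cxi : continuous (fun Z : 'rV[R]_(n + (n + n)) => rsubmx (rsubmx Z)).
  exact: (continuous_compose (@cont_rsub R n (n + n)) (@cont_rsub R n n)).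
have cG : cont G.
  apply: contM; apply: contM.
  - exact: cont_cst.
  - exact: (cont_comp (@cont_rsub R n (n + n)) (smooth_cont sP)).
  - apply: contM; first exact: (cont_comp (@cont_lsub R n (n + n)) cg).
    apply: cont_conj.
    exact: (cont_comp (cont_sub_maps (@cont_lsub R n (n + n)) cx) cp).
  - apply: cont_cis; apply: (@contRZ R _ (-1)).
    exact: (cont_dot_maps cxi (@cont_lsub R n (n + n))).
have cpG : cpb (`|a| * K2 * (Kg * Kp) * Ky * Kz) G.
  split; first exact: cont_measC.
  move=> Z; rewrite -[Z]hsubmxK /G !row_mxKl !row_mxKr pw_row.
  set y := lsubmx Z; set z := rsubmx Z.
  rewrite !cabsM cabs_cis mulr1 cabs_real -cabsM.
  apply: (@le_trans _ _ ((`|a| * (K2 * expR (- (c2 * wt 2^-1 z)))) *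
      ((Kg * Kp) * (expR (c1 * wt s (lsubmx z)) * expR (- (c1 / 8 * wt s y)))))).
    apply: ler_pM; rewrite ?mulr_ge0 ?cabs_ge0//; first by apply: ler_wpM2l.
    exact: bw.
  have E1 : expR (- (c2 * wt 2^-1 z)) * expR (c1 * wt s (lsubmx z)) <= Kz * pw z.
    apply: le_trans (HKz z); rewrite -expRD ler_expR.
    have w1' : wt s (lsubmx z) <= wt 2^-1 z.
      by apply: le_trans (wt_half _ s2) _; exact: wt_lsub.
    have := ler_pM (ltW c10) (wt_ge0 s (lsubmx z)) c1c2 w1'; lra.
  rewrite [leLHS](_ : _ = (`|a| * K2 * (Kg * Kp)) *
    ((expR (- (c2 * wt 2^-1 z)) * expR (c1 * wt s (lsubmx z))) *
     expR (- (c1 / 8 * wt s y)))); last by ring.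
  rewrite [leRHS](_ : _ = (`|a| * K2 * (Kg * Kp)) * ((Kz * pw z) * (Ky * pw y))); last by ring.
  apply: ler_wpM2l; first by rewrite !mulr_ge0// ltW.
  by apply: ler_pM; rewrite ?mulr_ge0 ?expR_ge0.
have [I1 I2 E1 E2] := fubiniC cpG.
pose F z := a%:C * FT (-1) (windowed g phi (lsubmx z)) (rsubmx z).
have inner_y : (fun z => integralC (fun y => G (row_mx y z))) = fun z => F z * Psi z.
  apply/funext => z; rewrite /G.
  have [B HB] := bwx (lsubmx z).
  have cc := cpb_FT (-1) (rsubmx z) (cw (lsubmx z)) HB.
  transitivity ((a%:C * Psi z) * FT (-1) (windowed g phi (lsubmx z)) (rsubmx z)).
    rewrite /FT -(integralCZ (a%:C * Psi z) cc); congr integralC; apply/funext => y.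
    by rewrite row_mxKl !row_mxKr.
  by rewrite /F mulrAC.
have inner_z : (fun y => integralC (fun z => G (row_mx y z))) = fun y => g y * zeta y.
  apply/funext => y.
  have cs : cpb (`|a| * K2 * (Kg * Kp) * Ky * Kz * pw y) (fun z => G (row_mx y z)).
    split; first by apply: measC_row; case: cpG.
    by move=> z; rewrite -[leRHS]mulrA -pw_row; case: cpG.
  have [_ _ -> _] := fubiniC cs.
  rewrite /zeta -zE.
  have [B B0 HB] := rapid_bound r1.
  have cpx : cont (fun x => conjc (phi (y - x))).
    by apply: cont_conj; exact: (cont_comp (@cont_sub_from R n y) cp).
  have bpx x : cabs (conjc (phi (y - x))) <= Kp * Kw.
    by rewrite cabs_conj (le_trans (bpw _))// ler_piMr ?pw_le1// mulr_ge0// ltW.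
  have cth : cont (fun x => a%:C * FT2 (-1) Psi (row_mx x y)).
    apply: contM; first exact: cont_cst.
    exact: (cont_comp (@cont_row_l R n n y) (smooth_cont (rapid_smooth r1))).
  have bth x : cabs (a%:C * FT2 (-1) Psi (row_mx x y)) <= `|a| * (B * pw y) * pw x.
    rewrite cabsM cabs_real -mulrA ler_wpM2l// -mulrA [pw y * _]mulrC -pw_row; exact: HB.
  rewrite -(integralCZ (g y) (cpb_mul cpx cth bpx bth)); congr integralC.
  apply/funext => x.
  have cP : cont (fun xi => Psi (row_mx x xi)).
    exact: (cont_comp (@cont_row_r R n n x) (smooth_cont sP)).
  have bPx xi : cabs (Psi (row_mx x xi)) <= (K2 * Kz * pw x) * pw xi.
    apply: (le_trans (bP _)); rewrite -!mulrA -pw_row; apply: ler_wpM2l; first exact: ltW.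
    apply: le_trans (HKz _); rewrite ler_expR lerN2.
    apply: ler_wpM2r; [exact: wt_ge0|lra].
  have cc := cpb_FT (-1) y cP bPx.
  rewrite /FT2 row_mxKl row_mxKr /FT.
  rewrite mulrA mulrA -(integralCZ (g y * conjc (phi (y - x)) * a%:C) cc).
  congr integralC; apply/funext => xi; rewrite /G !row_mxKr !row_mxKl.
  by rewrite [dot y xi]dotC /windowed; ring.
rewrite inner_y in I2 E2; rewrite inner_z in E1.
split; first exact: cpb_integrableC I2.
by rewrite SE fz -E1 E2.
Qed.

End StftDecay.

(** * From the short-time Fourier transform to the symbol *)

Section Measurability.
Context {R : realType}.
Local Notation C := R[i].
Local Notation E n := 'rV[R]_n.
Local Notation mR := (measurableTypeR R).
Local Notation T n := (n.-tuple mR).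

Lemma GS_gauss n a (p : E n) : 0 < a -> GS n 2^-1 (gauss a p).
Proof.
move=> a0; have [K [H [K0 H1 w]]] := wordb_gauss p a0.
by apply: (GS_of_wordb _ K0 _ w); rewrite ?invr_ge0//; lra.
Qed.

(** [is_function] yields measurability only of products with test functions, so F is multiplied by a
    Gaussian and by its reciprocal. *)
Lemma measC_of_is_function n (u : functional R n) F : is_function u F -> measC F.
Proof.
move=> /(_ _ (GS_gauss (0 : E n) ltr01))[[i1 i2] _].
have m1 : measC (fun x => F x * gauss 1 (0 : E n) x).
  by split; apply/measurable_EFinP; [case/integrableP : i1|case/integrableP : i2].
have -> : F = fun x => (F x * gauss 1 (0 : E n) x) * gauss (-1) (0 : E n) x.
  apply/funext => x; rewrite -mulrA (_ : gauss _ _ _ * gauss _ _ _ = 1) ?mulr1//.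
  rewrite /gauss -rmorphM/= -expRD (_ : _ + _ = 0) ?expR0//; ring.
exact: measCM m1 (cont_measC (@cont_gauss R n _ _)).
Qed.

Lemma measR_rsub m n (h : E n -> R) : measR h -> measR (fun z : E (m + n) => h (rsubmx z)).
Proof.
move=> mh; pose q (t : T (m + n)) : T n := [tuple tnth t (rshift m i) | i < n].
have qE t : rsubmx (tuple_vec t) = tuple_vec (q t) :> E n.
  by apply/rowP => i; rewrite !mxE tnth_mktuple.
rewrite /measR; under eq_fun do rewrite qE.
apply: (measurableT_comp (f := fun t : T n => h (tuple_vec t))) => //.
apply/measurable_fun_tnthP => i.
rewrite (_ : _ \o _ = fun t : T (m + n) => tnth t (rshift m i)); first exact: measurable_tnth.
by apply/funext => t /=; rewrite tnth_mktuple.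
Qed.

Lemma measC_rsub m n (F : E n -> C) : measC F -> measC (fun z : E (m + n) => F (rsubmx z)).
Proof. by move=> [m1 m2]; split; [exact: (measR_rsub m1)|exact: (measR_rsub m2)]. Qed.

Lemma word_scale n W (a : C) (psi : E n -> C) : smooth psi ->
  word W (fun x => a * psi x) = fun x => a * word W psi x.
Proof.
elim/last_ind: W a psi => // W l IH a psi sp; rewrite !word_rcons.
have -> : letter l (fun x => a * psi x) = fun x => a * letter l psi x.
  by case: l => j; [apply/funext => x; rewrite /= mulrCA|exact: (pdiffZ a (smooth_pdiff sp)).2].
exact: IH (smooth_letter l sp).
Qed.

End Measurability.

(** * Superpositions of time-frequency shifts and the recovery of the distribution *)

Section Synthesis.
Context {R : realType} {n : nat}.
Local Notation C := R[i].
Local Notation E := 'rV[R]_n.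
Local Notation E2 := 'rV[R]_(n + n).
Implicit Types (s : R) (psi phi chi : E -> C) (x y : E) (F : E2 -> C) (z : E2).

Definition coords (l : seq 'I_n) (xi : E) : R := \prod_(j <- l) xi 0 j.

Lemma coords_le l xi : `|coords l xi| <= rho xi ^+ size l.
Proof.
rewrite /coords; elim: l => [|j l IH]; first by rewrite big_nil normr1.
by rewrite big_cons normrM exprS; apply: ler_pM => //; exact: coord_le_rho.
Qed.

Lemma cont_coords l : continuous (coords l).
Proof.
rewrite /coords; elim: l => [|j l IH].
  by under eq_fun do rewrite big_nil; exact: contR_cst.
by under eq_fun do rewrite big_cons; exact: (contRM (@coord_cont R n j) IH).
Qed.

Definition skernel F chi (l1 l2 : seq 'I_n) y z : C :=
  (F z * (coords l1 (rsubmx z))%:C) *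
  (dl l2 chi (y - lsubmx z) * cis (1 * dot (rsubmx z) y)).

(* Superposition of time-frequency shifts of [chi] with density [F]; the
   derivatives in [y] produce the coordinates [l1] of [xi] and the derivatives
   [l2] of [chi]. *)
Definition synth F chi l1 l2 y : C := integralC (skernel F chi l1 l2 y).

Lemma measC_skernel F chi l1 l2 y : measC F -> smooth chi -> measC (skernel F chi l1 l2 y).
Proof.
move=> mF sc; apply: measCM.
  apply: measCM => //; apply: cont_measC; apply: cont_real.
  exact: (continuous_compose (@cont_rsub R n n) (@cont_coords l1)).
apply: cont_measC; apply: contM.
  apply: (cont_comp _ (smooth_cont (smooth_dl l2 sc))).
  exact: (continuous_compose (@cont_lsub R n n) (@cont_sub_from R n y)).
apply: cont_cis; apply: (@contRZ R _ 1).
under eq_fun do rewrite dotC.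
exact: (continuous_compose (@cont_rsub R n n) (@cont_dot R n y)).
Qed.

Lemma ler_mul3_regroup (a b d KF P Q f1 g1 S Kc f2 g2 T X Y Z W : R) :
  a <= KF * (P * Q) -> b <= f1 * g1 * S -> d <= Kc * f2 * g2 * T ->
  f1 * f2 <= X -> g1 * g2 <= Y -> P * T <= Z -> Q * S <= W ->
  0 <= a -> 0 <= b -> 0 <= d -> 0 <= KF -> 0 <= Kc -> 0 <= P -> 0 <= Q -> 0 <= S ->
  0 <= T -> 0 <= f1 -> 0 <= f2 -> 0 <= g1 -> 0 <= g2 ->
  a * b * d <= KF * Kc * (X * Y * (Z * W)).
Proof.
move=> Ha Hb Hd HX HY HZ HW a0 b0 d0 KF0 Kc0 P0 Q0 S0 T0 f10 f20 g10 g20.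
apply: (@le_trans _ _ (KF * Kc * ((f1 * f2) * (g1 * g2) * ((P * T) * (Q * S))))).
  rewrite [leRHS](_ : _ = KF * (P * Q) * (f1 * g1 * S) * (Kc * f2 * g2 * T)); last by ring.
  by apply: ler_pM; rewrite ?mulr_ge0//; apply: ler_pM.
by apply: ler_wpM2l; rewrite ?mulr_ge0//; apply: ler_pM; rewrite ?mulr_ge0//; apply: ler_pM;
  rewrite ?mulr_ge0.
Qed.

(** Half of the decay in xi absorbs the coordinates [l1] at the price of factorials; the other half,
    with decay in x extracted from [chi], gives [pw z]. H is fixed before c1, as [Gamma] fixes its
    geometric constant before the growth rate. *)
Lemma skernel_le s F chi h Kc Hc c : 2^-1 <= s -> 0 < h ->
  (forall e, 0 < e -> exists2 K, 0 < K & forall z,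
     cabs (F z) <= K * expR (e * wt s (lsubmx z) - h * wt s (rsubmx z))) ->
  0 < Kc -> 1 <= Hc -> 0 < c ->
  (forall l x, cabs (dl l chi x) <=
     Kc * Hc ^+ size l * factp s (size l) * expR (- (c * wt s x))) ->
  exists2 H, 1 <= H & forall c1, 0 < c1 -> c1 <= c -> exists2 M, 0 < M &
    forall l1 l2 y z, cabs (skernel F chi l1 l2 y z) <=
      M * H ^+ (size l1 + size l2) * factp s (size l1 + size l2) * expR (c1 * wt s y) * pw z.
Proof.
move=> s2 h0 bF Kc0 Hc1 c0 bc.
have s0 : 0 < s by lra.
have h20 : 0 < h / 2 by rewrite divr_gt0.
have [h1 h10 Hh1] := powX_le_expR s0 h20.
pose H := Num.max h1 Hc.
have H1 : 1 <= H by rewrite le_max Hc1 orbT.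
have H0 : 0 <= H by rewrite (le_trans ler01).
have Hc0 : 0 <= Hc by rewrite (le_trans ler01).
exists H => // c1 c10 c1c.
have e0 : 0 < c1 / 8 by rewrite divr_gt0.
have [KF KF0 HKF] := bF _ e0.
have [Kx Kx0 HKx] := @pw_of_exp R n s (c1 / 8) s0 e0.
have [Kxi Kxi0 HKxi] := @pw_of_exp R n s (h / 2) s0 h20.
exists (KF * Kc * (Kx * Kxi)); first by rewrite !mulr_gt0.
move=> l1 l2 y z; rewrite -[z]hsubmxK /skernel row_mxKl row_mxKr pw_row hsubmxK.
set x := lsubmx z; set xi := rsubmx z.
rewrite !cabsM cabs_cis mulr1 cabs_real.
have b1 : `|coords l1 xi| <= h1 ^+ size l1 * factp s (size l1) * expR (h / 2 * wt s xi).
  by apply: (le_trans (coords_le l1 xi)); exact: Hh1 (rho_ge0 xi).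
have b3 : expR (c1 / 8 * wt s x) * expR (- (c * wt s (y - x))) <=
    expR (c1 * wt s y) * (Kx * pw x).
  rewrite -(wtN s (y - x)) opprB; apply: (le_trans (exp_wt_shift_le y x s2 c10 c1c)).
  by apply: ler_wpM2l; [exact: expR_ge0|exact: HKx].
have b4 : expR (- (h * wt s xi)) * expR (h / 2 * wt s xi) <= Kxi * pw xi.
  apply: le_trans (HKxi xi); move: (wt s xi) => t.
  by rewrite -expRD ler_expR; clear; lra.
have b5 : h1 ^+ size l1 * Hc ^+ size l2 <= H ^+ (size l1 + size l2).
  rewrite exprD; apply: ler_pM; rewrite ?exprn_ge0 ?(ltW h10)//.
    by rewrite lerXn2r ?nnegrE ?(ltW h10)// le_max lexx.
  by rewrite lerXn2r ?nnegrE// le_max lexx orbT.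
have b6 : factp s (size l1) * factp s (size l2) <= factp s (size l1 + size l2).
  by apply: factpM; exact: ltW.
have {}HKF := HKF z; rewrite expRD in HKF.
rewrite [leRHS](_ : _ = KF * Kc * (H ^+ (size l1 + size l2) * factp s (size l1 + size l2) *
  ((expR (c1 * wt s y) * (Kx * pw x)) * (Kxi * pw xi)))); last by ring.
by apply: (ler_mul3_regroup HKF b1 (bc l2 (y - x)) b5 b6 b3 b4);
  rewrite ?cabs_ge0 ?exprn_ge0 ?factp_ge0 ?expR_ge0 ?(ltW KF0) ?(ltW Kc0) ?(ltW h10).
Qed.

Lemma skernel_pdiff F chi l1 l2 z : smooth chi ->
  pdiff (fun y => skernel F chi l1 l2 y z) /\
  forall j, partial j (fun y => skernel F chi l1 l2 y z) = fun y =>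
    skernel F chi l1 (j :: l2) y z + (0 +i* 1) * skernel F chi (j :: l1) l2 y z.
Proof.
move=> sc.
have [pe de] := cis_pdiff 1 (rsubmx z).
have [ps ds] := shift_pdiff (- lsubmx z) (smooth_pdiff (smooth_dl l2 sc)).
have [pm dm] := pdiffM ps pe.
have [pz dz] := pdiffZ (F z * (coords l1 (rsubmx z))%:C) pm.
split; first exact: pz.
move=> j; rewrite dz dm ds de; apply/funext => y; rewrite /skernel.
have -> : (coords (j :: l1) (rsubmx z))%:C = (rsubmx z 0 j)%:C * (coords l1 (rsubmx z))%:C :> C.
  by rewrite /coords big_cons rmorphM.
have -> : (0 +i* (1 * rsubmx z 0 j)) = (0 +i* 1) * (rsubmx z 0 j)%:C :> C.
  by apply: complex_eq => /=; ring.
by rewrite mulrDr; congr (_ + _); ring.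
Qed.

Definition synthesizable s F chi (H c : R) : Prop := [/\ measC F, smooth chi &
  forall c1, 0 < c1 -> c1 <= c -> exists2 M, 0 < M &
    forall l1 l2 y z, cabs (skernel F chi l1 l2 y z) <=
      M * H ^+ (size l1 + size l2) * factp s (size l1 + size l2) * expR (c1 * wt s y) * pw z].

Lemma wt_near1 s x y : 0 < s -> near1 y x -> wt s y <= (rho x + n%:R) `^ s^-1.
Proof.
move=> s0 nyx; rewrite /wt ge0_ler_powR ?nnegrE ?invr_ge0 ?rho_ge0 ?(ltW s0)//.
  by rewrite addr_ge0// rho_ge0.
rewrite /rho -addrA lerD2l -[X in _ + X]mulr1 -[n in n%:R]card_ord.
rewrite mulr_natl -sumr_const -big_split/= ler_sum// => i _.
have Ni := nyx i; have := ler_normD (x 0 i) (y 0 i - x 0 i).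
by rewrite [x 0 i + _]addrC subrK => /le_trans; apply; rewrite lerD2l.
Qed.

Lemma synth_pdiff s F chi H c l1 l2 : 0 < s -> 0 <= H -> 0 < c -> synthesizable s F chi H c ->
  pdiff (synth F chi l1 l2) /\ forall j, partial j (synth F chi l1 l2) = fun y =>
    synth F chi l1 (j :: l2) y + (0 +i* 1) * synth F chi (j :: l1) l2 y.
Proof.
move=> s0 H0 c0 [mF sc bk]; have [M M0 HM] := bk c c0 (lexx _).
have cK l l' y : cpb (M * H ^+ (size l + size l') * factp s (size l + size l') * expR (c * wt s y))
    (skernel F chi l l' y).
  by split; [exact: measC_skernel|exact: HM].
have [p dp] : pdiff (fun y => integralC (skernel F chi l1 l2 y)) /\ forall j,
    partial j (fun y => integralC (skernel F chi l1 l2 y)) =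
    fun y => integralC (fun z => partial j (fun y => skernel F chi l1 l2 y z) y).
  apply: int_pdiff.
  - by move=> y; exact: measC_skernel.
  - by move=> z; exact: (skernel_pdiff F l1 l2 z sc).1.
  - move=> y0; pose N := (size l1 + size l2)%N.
    pose e := expR (c * (rho y0 + n%:R) `^ s^-1).
    exists (M * H ^+ N * factp s N * e + 2 * (M * H ^+ N.+1 * factp s N.+1 * e)) => y z yy0.
    have ee : expR (c * wt s y) <= e.
      by rewrite ler_expR ler_wpM2l ?(ltW c0)// wt_near1.
    have bnd l l' : cabs (skernel F chi l l' y z) <=
        (M * H ^+ (size l + size l') * factp s (size l + size l') * e) * pw z.
      apply: (le_trans (HM l l' y z)); apply: ler_wpM2r; first exact: pw_ge0.
      apply: ler_wpM2l ee.
      by rewrite !mulr_ge0 ?exprn_ge0 ?factp_ge0// ltW.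
    have e0 : 0 <= e by exact: expR_ge0.
    have g0 k : 0 <= M * H ^+ k * factp s k * e.
      by rewrite !mulr_ge0 ?exprn_ge0 ?factp_ge0// ltW.
    split.
      rewrite (le_trans (bnd l1 l2))// ler_wpM2r ?pw_ge0// lerDl mulr_ge0//.
    move=> j; rewrite (skernel_pdiff F l1 l2 z sc).2 (le_trans (cabsD _ _))// cabsM.
    have -> : cabs (0 +i* 1 : C) = 1 by rewrite /cabs/= expr0n add0r expr1n sqrtr1.
    rewrite mul1r.
    have b1 := bnd l1 (j :: l2); have b2 := bnd (j :: l1) l2.
    rewrite /= addnS -/N in b1; rewrite /= addSn -/N in b2.
    apply: (le_trans (lerD b1 b2)); rewrite -mulrDl ler_wpM2r ?pw_ge0//.
    by rewrite [X in _ <= _ + X]mulr_natl mulr2n lerDr.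
split; first exact: p.
move=> j; rewrite -[synth F chi l1 l2]/(fun y => integralC (skernel F chi l1 l2 y)) dp.
apply/funext => y.
rewrite /synth -(integralCZ _ (cK (j :: l1) l2 y)) -(integralCD (cK l1 (j :: l2) y) (cpbZ _ (cK (j :: l1) l2 y))).
by congr integralC; apply/funext => z; rewrite (skernel_pdiff F l1 l2 z sc).2.
Qed.

Lemma synth_dl_le s F chi H c : 0 < s -> 1 <= H -> 0 < c -> synthesizable s F chi H c ->
  smooth (synth F chi [::] [::]) /\
  forall c1, 0 < c1 -> exists2 M, 0 < M & forall l y,
    cabs (dl l (synth F chi [::] [::]) y) <=
    M * (2 * H) ^+ size l * factp s (size l) * expR (c1 * wt s y).
Proof.
move=> s0 H1 c0 sF; have [mF sc bk] := sF; have H0 : 0 <= H by rewrite (le_trans ler01).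
pose Q N (f : E -> C) := exists l1 l2 (a : C), [/\ (size l1 + size l2)%N = N, cabs a <= 1 &
  f = fun y => a * synth F chi l1 l2 y].
have I0 := pwI_ge0 (R := R) (n + n).
have main c1 : 0 < c1 -> c1 <= c -> smooth (synth F chi [::] [::]) /\ exists2 M, 0 < M &
    forall l y, cabs (dl l (synth F chi [::] [::]) y) <=
    M * (2 * H) ^+ size l * factp s (size l) * expR (c1 * wt s y).
  move=> c10 c1c; have [M M0 HM] := bk c1 c10 c1c.
  pose beta N (y : E) := 2 * (M * H ^+ N * factp s N * expR (c1 * wt s y)) * pwI (R := R) (n + n).
  (* Derivative letters only: the function may grow, and multiplications would not respect the
     bound. *)
  pose P (a : 'I_n + 'I_n) := if a is inr _ then true else false.
  have [||||//|sm] := @words_of_family R n P Q beta _ _ _ _ 0%N (synth F chi [::] [::]).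
  - by [].
  - move=> N f [l1 [l2 [a [_ _ ->]]]].
    exact: (pdiffZ a (synth_pdiff l1 l2 s0 H0 c0 sF).1).1.
  - move=> N f y [l1 [l2 [a [<- a1 ->]]]]; rewrite cabsM.
    apply: (@le_trans _ _ (1 * cabs (synth F chi l1 l2 y))).
      by apply: ler_wpM2r; [exact: cabs_ge0|].
    rewrite mul1r; apply: integralC_le; split; [exact: measC_skernel|exact: HM].
  - move=> N f [//|j] [l1 [l2 [a [sN a1 ->]]]] _.
    have [pS dS] := synth_pdiff l1 l2 s0 H0 c0 sF.
    exists (fun y => a * synth F chi l1 (j :: l2) y),
      (fun y => (a * (0 +i* 1)) * synth F chi (j :: l1) l2 y); split.
    + by exists l1, (j :: l2), a; split; [rewrite /= addnS sN| |].
    + exists (j :: l1), l2, (a * (0 +i* 1)); split; [by rewrite /= addSn sN| |by []].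
      by rewrite cabsM [X in _ * X](_ : _ = 1) ?mulr1// /cabs/= expr0n add0r expr1n sqrtr1.
    + rewrite -[letter _ _]/(partial j _) (pdiffZ a pS).2 dS.
      by apply/funext => y; rewrite mulrDr mulrA.
  - by exists [::], [::], 1; rewrite cabs1; split => //; apply/funext => y; rewrite mul1r.
  move=> bnd; split=> //; exists (2 * M * pwI (R := R) (n + n) + 1) => [|l y].
    by rewrite ltr_wpDl// !mulr_ge0// ltW.
  rewrite -word_inr; have := bnd (map inr l) y; rewrite size_map => /(_ _)/le_trans; apply.
    by elim: (l).
  rewrite add0n /beta exprMn.
  set m := size l; set e := expR _.
  rewrite [leLHS](_ : _ = 2 * M * pwI (R := R) (n + n) * (2 ^+ m * H ^+ m) * factp s m * e); last by ring.
  rewrite ler_wpM2r ?expR_ge0// ler_wpM2r ?factp_ge0// ler_wpM2r ?mulr_ge0 ?exprn_ge0//.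
  by rewrite lerDl.
split; first by have [] := main c c0 (lexx _).
(* The kernel bounds hold for rates up to c; a larger rate only weakens the estimate. *)
move=> c1 c10; pose c2 := Num.min c1 c.
have c20 : 0 < c2 by rewrite lt_min c10.
have c2c : c2 <= c by rewrite ge_min lexx orbT.
have [_ [M M0 HM]] := main c2 c20 c2c.
exists M => // l y; rewrite (le_trans (HM l y))// ler_wpM2l//.
  by rewrite !mulr_ge0 ?exprn_ge0 ?factp_ge0// ?mulr_ge0// ltW.
by rewrite ler_expR ler_wpM2r ?wt_ge0// ge_min lexx.
Qed.

Lemma is_function_synth s (T : functional R n) F phi Kp chi (k : R[i]) H c : 2^-1 <= s ->
  0 <= H -> 0 < c -> is_function (STFT phi T) F ->
  synthesizable s (fun z => k * F z) chi H c ->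
  cont phi -> (forall x, cabs (phi x) <= Kp * pw x) ->
  (exists K0 H0, [/\ 0 < K0, 1 <= H0 & wordb 2^-1 K0 H0 chi]) ->
  ((2 * pi) `^ (- (n%:R / 2)))%:C * k * integralC (gauss 2^-1 (0 : E)) ^+ 2 *
    integralC (fun w => chi w * conjc (phi w)) = 1 ->
  is_function T (synth (fun z => k * F z) chi [::] [::]).
Proof.
move=> s2 H0 c0 iF sF cp bp [Kc [Hc [Kc0 Hc1 wc]]] kE psi Gpsi.
have [mF sc bk] := sF.
have s0 : 0 < s by lra.
have hf0 : 0 < 2^-1 :> R by rewrite invr_gt0.
have n1 : (1 : R) ^+ 2 = 1 by rewrite expr1n.
have [K0 [H1 [K00 H11 dP]]] := decay_of_GS (ltW hf0) Gpsi.
have [K2 [H2 [c2 [K20 H21 c20 bP]]]] := decay_exp hf0 (ltW K00) H11 dP.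
have {}bP y : cabs (psi y) <= K2 * expR (- (c2 * wt 2^-1 y)).
  by have := bP [::] y; rewrite expr0 factp0 !mulr1.
have wP := wordb_of_decay (lexx _) (ltW K00) H11 dP.
have H12 : 1 <= 2 * H1 by lra.
have sP : smooth psi by case: dP.
have [K3 [H3 [K30 H31 w3]]] := wordb_tensor (ltW hf0) K00 H12 Kc0 Hc1 wP wc.
have r3 := rapid_of_wordb (ltW hf0) K30 H31 w3.
have [K4 [H4 [K40 H41 w4]]] := wordb_FT2 n1 (ltW hf0) K30 H31 w3.
have r4 := rapid_of_wordb (ltW hf0) K40 H41 w4.
have s4 := rapid_smooth r4.
(* The sign 1 is opposite to that of [fourier_snd], so the partial transform applied by the STFT
   inverts this one. *)
pose Psi z := k * FT2 1 (tensor psi chi) z.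
have GPsi : GS (n + n) 2^-1 Psi.
  apply: (@GS_of_wordb R (n + n) 2^-1 (cabs k * K4 + 1) H4).
  - exact: ltW.
  - by rewrite ltr_wpDl// mulr_ge0 ?cabs_ge0// ltW.
  - exact: lt_le_trans ltr01 H41.
  split; first exact: smoothZ.
  move=> W z; rewrite (word_scale W k s4) cabsM.
  apply: (@le_trans _ _ (cabs k * (K4 * H4 ^+ size W * factp 2^-1 (size W)))).
    by apply: ler_wpM2l; [exact: cabs_ge0|case: w4].
  rewrite !mulrA ler_wpM2r ?factp_ge0// ler_wpM2r ?exprn_ge0 ?lerDl//.
  exact: le_trans ler01 H41.
pose a : R := (2 * pi) `^ (- (n%:R / 2)).
pose A := integralC (gauss 2^-1 (0 : E)).
have [B3 B30 HB3] := rapid_bound r3.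
have [B4 B40 HB4] := rapid_bound r4.
pose u x y := tensor psi chi (row_mx x y).
have uE x y : u x y = psi y * chi (y - x) by rewrite /u /tensor row_mxKl row_mxKr.
have cu x : cont (u x).
  exact: (cont_comp (@cont_row_r R n n x) (smooth_cont (rapid_smooth r3))).
have bu x y : cabs (u x y) <= (B3 * pw x) * pw y by rewrite -mulrA -pw_row; exact: HB3.
have F4 x xi : FT2 1 (tensor psi chi) (row_mx x xi) = FT 1 (u x) xi.
  by rewrite /FT2 row_mxKl row_mxKr.
have cFu x : cont (FT 1 (u x)).
  rewrite (_ : FT 1 (u x) = fun xi => FT2 1 (tensor psi chi) (row_mx x xi)).
    exact: (cont_comp (@cont_row_r R n n x) (smooth_cont s4)).
  by apply/funext => xi; rewrite F4.
have bFu x xi : cabs (FT 1 (u x) xi) <= (B4 * pw x) * pw xi.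
  by rewrite -F4 -mulrA -pw_row; exact: HB4.
have inv x y : FT2 (-1) Psi (row_mx x y) = k * A ^+ 2 * (psi y * chi (y - x)).
  rewrite -uE -[RHS]mulrA -(FT_inversion y n1 (cu x) (bu x) (cFu x) (bFu x)).
  rewrite /FT2 row_mxKl row_mxKr {1}/FT.
  rewrite [FT (-1) _ y]/FT -(integralCZ k (cpb_FT (-1) y (cFu x) (bFu x))).
  by congr integralC; apply/funext => xi; rewrite /Psi F4 mulrA.
have [Bc Bc0 HBc] := rapid_bound (rapid_of_wordb (ltW hf0) Kc0 Hc1 wc).
have bc w : cabs (chi w) <= Bc by rewrite (le_trans (HBc w))// ler_piMr// pw_le1.
have Kp0 : 0 <= Kp.
  by rewrite -(pmulr_lge0 _ (pw_gt0 (0 : E))) (le_trans _ (bp 0)) ?cabs_ge0.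
have cc := smooth_cont sc.
have bph w : cabs (conjc (phi w)) <= Kp * pw w by rewrite cabs_conj.
have chh := cpb_mul cc (cont_conj cp) bc bph.
(* Inversion leaves k A^2 psi(y) chi(y - x); the integral over x then detaches psi(y) from the
   average of [chi] against the conjugate window, and [kE] makes the constants multiply to 1. *)
have twE : (fun y => integralC (fun x => conjc (phi (y - x)) * fourier_snd Psi (row_mx x y))) = psi.
  apply/funext => y.
  have cyx := @cont_sub_from R n y.
  have byx x : cabs (conjc (phi (y - x))) <= (Kp * pwinv y) * pw x.
    rewrite (le_trans (bph _))// -mulrA; apply: ler_wpM2l => //.
    by rewrite addrC (le_trans (pw_shift _ _))// pwN.
  have c2' := cpb_mul (cont_comp cyx cc) (cont_comp cyx (cont_conj cp)) (fun x => bc _) byx.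
  have N0 : -1 != 0 :> R by rewrite oppr_eq0 oner_eq0.
  have kapE : integralC (fun w => chi w * conjc (phi w)) =
      integralC (fun x => chi (y - x) * conjc (phi (y - x))).
    rewrite (integralC_affine y N0 chh) normrN1 expr1n mul1r.
    by congr integralC; apply/funext => x; rewrite scaleN1r [- x + y]addrC.
  transitivity (a%:C * k * A ^+ 2 * psi y *
      integralC (fun x => chi (y - x) * conjc (phi (y - x)))).
    rewrite -(integralCZ (a%:C * k * A ^+ 2 * psi y) c2').
    congr integralC; apply/funext => x.
    rewrite fourier_sndE inv -/a /=.
    by move: (a%:C) (A ^+ 2) => a' A2; ring.
  by rewrite -kapE mulrAC kE mul1r.
have SE : STFT phi T Psi = T psi.
  by rewrite /STFT /fourier_snd_dual /twist twE.
have [_ iPsi] := iF _ GPsi.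
pose c1 := Num.min c (c2 / 2).
have c10 : 0 < c1 by rewrite lt_min c0 divr_gt0.
have c1c : c1 <= c by rewrite ge_min lexx.
have c1c2 : c1 <= c2 / 2 by rewrite ge_min lexx orbT.
have [M M0 HM] := bk c1 c10 c1c.
have {}HM y z : cabs (skernel (fun z => k * F z) chi [::] [::] y z) <=
    M * expR (c1 * wt s y) * pw z.
  by have := HM [::] [::] y z; rewrite expr0 factp0 !mulr1.
have c22 : 0 < c2 / 2 by rewrite divr_gt0.
have [Ky Ky0 HKy] := @pw_of_exp R n 2^-1 (c2 / 2) hf0 c22.
have Ey y : expR (c1 * wt s y) * expR (- (c2 * wt 2^-1 y)) <= Ky * pw y.
  apply: le_trans (HKy y); have := ler_pM (ltW c10) (wt_ge0 s y) c1c2 (wt_half y s2).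
  move: (wt s y) (wt 2^-1 y) => t t'; clear.
  by rewrite -expRD ler_expR; lra.
pose G (Z : 'rV[R]_(n + (n + n))) :=
  psi (lsubmx Z) * skernel (fun z => k * F z) chi [::] [::] (lsubmx Z) (rsubmx Z).
have cx : continuous (fun Z : 'rV[R]_(n + (n + n)) => lsubmx (rsubmx Z)).
  exact: (continuous_compose (@cont_rsub R n (n + n)) (@cont_lsub R n n)).
have cxi : continuous (fun Z : 'rV[R]_(n + (n + n)) => rsubmx (rsubmx Z)).
  exact: (continuous_compose (@cont_rsub R n (n + n)) (@cont_rsub R n n)).
have mG : measC G.
  apply: measCM.
    exact: cont_measC (cont_comp (@cont_lsub R n (n + n)) (smooth_cont sP)).
  apply: measCM.
    apply: measCM; first exact: (measC_rsub n mF).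
    apply: cont_measC; apply: cont_real.
    exact: (continuous_compose cxi (@cont_coords [::])).
  apply: cont_measC; apply: contM.
    exact: (cont_comp (cont_sub_maps (@cont_lsub R n (n + n)) cx) cc).
  apply: cont_cis; apply: (@contRZ R _ 1).
  exact: (cont_dot_maps cxi (@cont_lsub R n (n + n))).
have cpG : cpb (K2 * M * Ky) G.
  split=> // Z; rewrite -[Z]hsubmxK /G row_mxKl row_mxKr pw_row.
  set y := lsubmx Z; set z := rsubmx Z.
  rewrite cabsM; apply: (le_trans (ler_pM (cabs_ge0 _) (cabs_ge0 _) (bP y) (HM y z))).
  have := Ey y; move: (expR (c1 * _)) (expR (- _)) => e1 e2 ee.
  rewrite [leLHS](_ : _ = (K2 * M * pw z) * (e1 * e2)); last by ring.
  rewrite [leRHS](_ : _ = (K2 * M * pw z) * (Ky * pw y)); last by ring.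
  by apply: ler_wpM2l ee; rewrite !mulr_ge0 ?pw_ge0// ltW.
have [I1 I2 E1 E2] := fubiniC cpG.
have inner_z : (fun y => integralC (fun z => G (row_mx y z))) =
    fun y => synth (fun z => k * F z) chi [::] [::] y * psi y.
  apply/funext => y.
  have ck : cpb (M * expR (c1 * wt s y)) (skernel (fun z => k * F z) chi [::] [::] y).
    by split; [exact: measC_skernel|exact: HM].
  rewrite mulrC /synth -(integralCZ (psi y) ck); congr integralC.
  by apply/funext => z; rewrite /G row_mxKl row_mxKr.
have inner_y : (fun z => integralC (fun y => G (row_mx y z))) = fun z => F z * Psi z.
  apply/funext => z; rewrite /Psi -[z in FT2 _ _ z]hsubmxK F4.
  have cft := cpb_FT 1 (rsubmx z) (cu (lsubmx z)) (bu (lsubmx z)).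
  transitivity ((F z * k) * FT 1 (u (lsubmx z)) (rsubmx z)); last by rewrite mulrA.
  rewrite /FT -(integralCZ (F z * k) cft); congr integralC; apply/funext => y.
  rewrite /G row_mxKl row_mxKr /skernel /coords big_nil uE mulr1 [dl _ _ _]/=.
  by move: (cis _) => e; ring.
rewrite inner_y in I2 E2; rewrite inner_z in I1 E1.
split; first exact: cpb_integrableC I1.
by rewrite -SE iPsi -E2 E1.
Qed.

End Synthesis.

(** * Choice of a dual window and the two implications *)

Section Final.
Context {R : realType} {n : nat}.
Local Notation C := R[i].
Local Notation E := 'rV[R]_n.

(* Otherwise all the averages of [conj phi] against Gaussians vanish, hence so
   does their limit at a concentration point. *)
Lemma exists_window (phi : E -> C) B : cont phi -> (forall x, cabs (phi x) <= B) ->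
  phi <> (fun=> 0) -> exists a p, 0 < a /\
    integralC (fun w => gauss a p w * conjc (phi w)) <> 0.
Proof.
move=> cp bp phi0; apply: contrapT => noW.
have {}noW a p : 0 < a -> integralC (fun w => gauss a p w * conjc (phi w)) = 0.
  by move=> a0; apply: contrapT => ne; apply: noW; exists a, p.
apply: phi0; apply/funext => p.
pose I k := integralC (fun w => conjc (phi (p + (k.+1%:R : R)^-1 *: w)) * gauss 2^-1 (0 : E) w).
have h0 := @half_gt0 R.
(* By w -> w / N + p, [I k] is up to a nonzero Jacobian the average against the Gaussian with a =
   N^2 / 2 centred at p. *)
have I0 k : I k = 0.
  set N : R := k.+1%:R; have N0 : 0 < N by rewrite /N.
  have Nv0 : N^-1 != 0 by rewrite invr_eq0 gt_eqF.
  have aN0 : 0 < 2^-1 * N ^+ 2 by rewrite mulr_gt0 ?exprn_gt0.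
  have [Bg Bg0 [_ bg]] := cpb_gauss p aN0.
  have bc w : cabs (conjc (phi w)) <= B by rewrite cabs_conj.
  have c1 := cpb_mul (cont_conj cp) (@cont_gauss R n _ p) bc bg.
  have := noW _ p aN0.
  rewrite (_ : (fun w => _) = fun w => conjc (phi w) * gauss (2^-1 * N ^+ 2) p w); last first.
    by apply/funext => w; rewrite mulrC.
  rewrite (integralC_affine p Nv0 c1) => /eqP; rewrite mulf_eq0 => /orP[/eqP H|/eqP].
    have : `|N^-1| ^+ n != 0 by rewrite expf_neq0// normr_eq0.
    by move: H => [->]; rewrite eqxx.
  move=> <-; congr integralC; apply/funext => w; rewrite [_ *: w + p]addrC; congr (_ * _).
  rewrite /gauss /sqdist; congr ((expR (- _))%:C).
  rewrite -mulrA; congr (_ * _); rewrite mulr_sumr; apply: eq_bigr => i _.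
  rewrite !mxE subr0 [p 0 i + _]addrC addrK exprMn mulrA exprVn divff ?mul1r//.
  by rewrite expf_neq0// gt_eqF.
have bc w : cabs (conjc (phi w)) <= B by rewrite cabs_conj.
have [J1 J2] := approx_identity p (cont_conj cp) bc.
have z0 : conjc (phi p) * integralC (gauss 2^-1 (0 : E)) = 0.
  have c0 : (fun k => complex.Re (I k)) = fun=> 0 by apply/funext => k; rewrite I0.
  have c0' : (fun k => complex.Im (I k)) = fun=> 0 by apply/funext => k; rewrite I0.
  apply: complex_eq.
    have Z : complex.Re (I k) @[k --> \oo] --> (0 : R) by rewrite c0; exact: cvg_cst.
    exact: (cvg_unique _ J1 Z).
  have Z : complex.Im (I k) @[k --> \oo] --> (0 : R) by rewrite c0'; exact: cvg_cst.
  exact: (cvg_unique _ J2 Z).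
move/eqP: z0; rewrite mulf_eq0 (negbTE (@integral_gauss_neq0 R n)) orbF => /eqP z0.
by rewrite -[phi p]conjcK z0 conjc0.
Qed.

End Final.

Lemma stft_of_Gamma (R : realType) (d : nat) (s : R) (phi : 'rV[R]_d -> R[i])
    (T : functional R d) (g : 'rV[R]_d -> R[i]) :
  2^-1 <= s -> GS d s phi -> Gamma d s g -> is_function T g ->
  exists2 F : 'rV[R]_(d + d) -> R[i], is_function (STFT phi T) F &
    exists2 h : R, 0 < h & forall e : R, 0 < e -> exists2 K : R, 0 < K &
      forall x xi : 'rV[R]_d,
        cabs (F (row_mx x xi)) <= K * expR (e * enorm x `^ s^-1 - h * enorm xi `^ s^-1).
Proof.
move=> s2 phiS Gg fg; have s0 : 0 < s by lra.
have [K0 [H0 [K00 H01 dphi]]] := decay_of_GS (ltW s0) phiS.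
have sp : smooth phi by case: dphi.
have [Kp [Hp [c [Kp0 Hp1 c0 bp]]]] := decay_exp s0 (ltW K00) H01 dphi.
have [sg [e e1 bg]] := Gamma_dl s2 Gg.
have [c' c'0 bF] := stft_decay s2 sg e1 bg sp Kp0 Hp1 c0 bp.
set a : R := (2 * pi) `^ (- (d%:R / 2)).
exists (fun z => a%:C * FT (-1) (windowed g phi (lsubmx z)) (rsubmx z)).
  apply: (@is_function_stft R d s T g phi Kp c) => //.
  - exact: smooth_cont.
  - move=> h h0; have [K K_0 HK] := bg h h0; exists K => // x.
    by have := HK [::] x; rewrite expr0 factp0 !mulr1.
  - exact: smooth_cont.
  - by move=> x; have := bp [::] x; rewrite expr0 factp0 !mulr1.
exists c' => // eps eps0.
pose D : R := d.+1%:R `^ s^-1; have D0 : 0 < D by rewrite powR_gt0.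
(* c / 8 is the constraint of [stft_decay]. In 16 D, one factor 4 comes from the growth rate 4 h
   there, the other 4 and D from [wt_le_enorm]. *)
pose h := Num.min (c / 8) (eps / (16 * D)).
have h0 : 0 < h by rewrite lt_min !divr_gt0// mulr_gt0.
have hc : 8 * h <= c.
  by rewrite mulrC -ler_pdivlMr// ge_min lexx.
have he : 16 * D * h <= eps.
  by rewrite mulrC -ler_pdivlMr ?mulr_gt0// ge_min lexx orbT.
have [M M0 HM] := bF h h0 hc.
exists (`|a| * M * expR (16 * h) + 1) => [|x xi].
  by rewrite ltr_wpDl// !mulr_ge0 ?expR_ge0// ltW.
rewrite row_mxKl row_mxKr cabsM cabs_real.
apply: (le_trans (ler_wpM2l (normr_ge0 a) (HM x xi))).
rewrite mulrA [leRHS]mulrDl mul1r; apply: ler_wpDr; first exact: expR_ge0.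
rewrite -[leRHS]mulrA -expRD.
apply: ler_wpM2l; first by rewrite mulr_ge0// ltW.
rewrite ler_expR.
have w1 := wt_le_enorm x s2; have w2 := enorm_le_wt xi s0; rewrite -/D in w1.
have u1 := ler_wpM2l (ltW c'0) w2.
have h40 : 0 <= 4 * h by lra.
have u2 := ler_wpM2l h40 w1.
have u3 := ler_wpM2r (powR_ge0 (enorm x) s^-1) he.
move: u1 u2 u3; move: (enorm x `^ _) (enorm xi `^ _) (wt s x) (wt s xi) (D) (h).
by clear=> p q r t D h u1 u2 u3; lra.
Qed.

Lemma Gamma_of_stft (R : realType) (d : nat) (s : R) (phi : 'rV[R]_d -> R[i])
    (T : functional R d) (F : 'rV[R]_(d + d) -> R[i]) (h : R) :
  2^-1 <= s -> GS d s phi -> phi <> (fun=> 0) -> is_function (STFT phi T) F -> 0 < h ->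
  (forall e : R, 0 < e -> exists2 K : R, 0 < K & forall x xi : 'rV[R]_d,
     cabs (F (row_mx x xi)) <= K * expR (e * enorm x `^ s^-1 - h * enorm xi `^ s^-1)) ->
  exists2 g : 'rV[R]_d -> R[i], Gamma d s g & is_function T g.
Proof.
move=> s2 phiS phi0 fF h0 bF; have s0 : 0 < s by lra.
have hf0 : 0 < 2^-1 :> R by rewrite invr_gt0.
have [K0 [H0 [K00 H01 dphi]]] := decay_of_GS (ltW s0) phiS.
have sp : smooth phi by case: dphi.
have [Kp [Hp [c [Kp0 Hp1 c0 bp]]]] := decay_exp s0 (ltW K00) H01 dphi.
have [Kw Kw0 HKw] := @pw_of_exp R d s c s0 c0.
have bpw x : cabs (phi x) <= (Kp * Kw) * pw x.
  have := bp [::] x; rewrite expr0 factp0 !mulr1 => /le_trans; apply.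
  by rewrite -[leRHS]mulrA; apply: ler_wpM2l; [exact: ltW|exact: HKw].
have bpB x : cabs (phi x) <= Kp * Kw.
  by rewrite (le_trans (bpw x))// ler_piMr ?pw_le1// mulr_ge0// ltW.
have [a [p [a0 kap0]]] := exists_window (smooth_cont sp) bpB phi0.
pose chi := gauss a p.
have [Kg [Hg [Kg0 Hg1 dg]]] := gauss_decay p a0.
have [Kc [Hc [cc [Kc0 Hc1 cc0 bc]]]] := decay_exp hf0 (ltW Kg0) Hg1 dg.
(* The Gaussian has order 1/2; its factorials and its decay are both relaxed to order s. *)
have {}bc l x : cabs (dl l chi x) <=
    Kc * Hc ^+ size l * factp s (size l) * expR (- (cc * wt s x)).
  rewrite (le_trans (bc l x))//; apply: ler_pM; rewrite ?mulr_ge0 ?exprn_ge0 ?factp_ge0 ?expR_ge0 ?(ltW Kc0)//.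
  - exact: le_trans ler01 Hc1.
  - rewrite ler_wpM2l ?mulr_ge0 ?exprn_ge0 ?(ltW Kc0)//; first exact: le_trans ler01 Hc1.
    exact: le_factp_exponent.
  - by rewrite ler_expR lerN2 ler_wpM2l ?(ltW cc0)// wt_half.
pose kap := integralC (fun w => chi w * conjc (phi w)).
pose A := integralC (gauss 2^-1 (0 : 'rV[R]_d)).
pose b : R := (2 * pi) `^ (- (d%:R / 2)).
have b0 : b%:C != 0 :> R[i].
  by rewrite eq_complex /= negb_and gt_eqF// powR_gt0// mulr_gt0// pi_gt0.
(* The inverse of all constants met: the normalisation, A^2 from Fourier inversion, and the average
   of [chi] against the conjugate window, nonzero by the choice of [chi]. *)
pose k := (b%:C * A ^+ 2 * kap)^-1.
have kE : b%:C * k * A ^+ 2 * kap = 1.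
  have A0 : A != 0 := @integral_gauss_neq0 R d.
  have k0 : kap != 0 by apply/eqP.
  rewrite (_ : _ * kap = k * (b%:C * A ^+ 2 * kap)); last by ring.
  by rewrite mulVf// !mulf_neq0// expf_neq0.
pose D : R := d.+1%:R `^ s^-1; have D0 : 0 < D by rewrite powR_gt0.
(* Passing from the Euclidean norm to [wt] shrinks the rate by the factor 4 D of [wt_le_enorm]. *)
have h'0 : 0 < h / (4 * D) by rewrite divr_gt0// mulr_gt0.
have bkF e : 0 < e -> exists2 K, 0 < K & forall z : 'rV[R]_(d + d),
    cabs (k * F z) <= K * expR (e * wt s (lsubmx z) - h / (4 * D) * wt s (rsubmx z)).
  move=> e0; have [K K_0 HK] := bF e e0.
  exists (cabs k * K * expR (h / D) + 1) => [|z].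
    by rewrite ltr_wpDl// !mulr_ge0 ?cabs_ge0 ?expR_ge0// ltW.
  rewrite cabsM -[z in F z]hsubmxK.
  apply: (le_trans (ler_wpM2l (cabs_ge0 k) (HK _ _))).
  rewrite mulrA [leRHS]mulrDl mul1r; apply: ler_wpDr; first exact: expR_ge0.
rewrite -[leRHS]mulrA -expRD.
  apply: ler_wpM2l; first by rewrite mulr_ge0 ?cabs_ge0// ltW.
  rewrite ler_expR.
  have w1 := enorm_le_wt (lsubmx z) s0; have w2 := wt_le_enorm (rsubmx z) s2.
  have u1 := ler_wpM2l (ltW e0) w1; have u2 := ler_wpM2l (ltW h'0) w2.
  rewrite -/D in u2; move: u1 u2.
  have -> : h / (4 * D) * (4 * (1 + D * enorm (rsubmx z) `^ s^-1)) =
      h / D + h * enorm (rsubmx z) `^ s^-1 by field; rewrite gt_eqF.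
  clear; move: (_ * enorm _ `^ _) (_ * enorm _ `^ _) (_ * wt _ _) (_ * wt _ _) => v1 v2 v3 v4.
  by move: (h / D) => v5; lra.
have [H H1 bK] := skernel_le s2 h'0 bkF Kc0 Hc1 cc0 bc.
have sF : synthesizable s (fun z => k * F z) chi H cc.
  split; [|exact: smooth_gauss|exact: bK].
  exact: measCM (cont_measC (@cont_cst R (d + d) k)) (measC_of_is_function fF).
have H_0 : 0 <= H := le_trans ler01 H1.
have [sS bS] := synth_dl_le s0 H1 cc0 sF.
exists (synth (fun z => k * F z) chi [::] [::]).
  apply: (Gamma_of_dl s2 sS _ bS); rewrite mulr_gt0//; exact: lt_le_trans ltr01 H1.
apply: (is_function_synth s2 H_0 cc0 fF sF (smooth_cont sp) bpw _ kE).
have [K1 [H2 [K10 H21 w1]]] := wordb_gauss p a0.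
by exists K1, H2.
Qed.

Theorem proposition3p3 (R : realType) (d : nat) (d_gt0 : (0 < d)%N)
    (s : R) (s_ge : 2^-1 <= s)
    (phi : 'rV[R]_d -> R[i]) (phiS : GS d s phi) (phi_neq0 : phi <> (fun=> 0))
    (f : functional R d) (f_dual : GS_dual d 2^-1 f) :
  (exists2 g : 'rV[R]_d -> R[i], Gamma d s g & is_function f g)
  <->
  (exists2 F : 'rV[R]_(d + d) -> R[i], is_function (STFT phi f) F &
    exists2 h : R, 0 < h &
      forall e : R, 0 < e -> exists2 K : R, 0 < K &
        forall x xi : 'rV[R]_d,
          cabs (F (row_mx x xi)) <=
            K * expR (e * enorm x `^ s^-1 - h * enorm xi `^ s^-1)).
Proof.
split=> [[g Gg fg]|[F fF [h h0 bF]]]; first exact: stft_of_Gamma s_ge phiS Gg fg.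
exact: Gamma_of_stft s_ge phiS phi_neq0 fF h0 bF.
Qed.
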